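(* Let the data $D$ be sampled i.i.d. from the true distribution $\dot q$ on $\Gamma$. Let $z$ be a binary string with $\ell(z)=l\le m'<m+1\le\infty$ and let $\vec q_{z*'}:=(q_{zy}:y\in\mathbb B_1^{m'-l})$. Then the evidence, prior and posterior $p_z(\dots)$ exist for $m=\infty$ and have the following properties for $m\le\infty$, where all convergences as $n_z\to\infty$ hold with probability 1 and are uniform in $m$: (i) The marginal prior $p_z(\vec q_{z*'})$ is independent of $m$. (ii) $p_z(D_z)\to\infty$ exponentially as $n_z\to\infty$, for $us>0$ and non-uniform $\dot q_z(\cdot)$. (iii) As $n_z\to\infty$, weakly, $$p_z(\vec q_{z*'}|D_z)\;\longrightarrow\;\prod_{y\in\mathbb B_1^{m'-l}}\delta(q_{zy}-\dot q_{zy}).$$ (iv) As $n_z\to\infty$, for finite binary strings $y^1,\dots,y^k$ and $k\in\mathbb N$, $$p_z(\Gamma_{y^1},\dots,\Gamma_{y^k}|D_z)\;\longrightarrow\;\dot q_z(\Gamma_{y^1})\cdots\dot q_z(\Gamma_{y^k}).$$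
   Context: Tree partition. $\Gamma$ is a sample space of total volume $|\Gamma|=1$, and $\mathbb B_k^m=\bigcup_{i=k}^m\{0,1\}^i$ is the set of binary strings of length between $k$ and $m$ (empty if $k>m$). For every finite binary string $z$ there is a set $\Gamma_z\subseteq\Gamma$, with $\Gamma_\epsilon=\Gamma$ for the empty string $\epsilon$, and $\Gamma_z$ is the disjoint union of $\Gamma_{z0}$ and $\Gamma_{z1}$ with $|\Gamma_{z0}|=|\Gamma_{z1}|=\frac12|\Gamma_z|$; these sets generate the $\sigma$-algebra on $\Gamma$ (e.g. $\Gamma=[0,1)$ with dyadic intervals). For $x\in\Gamma$, $x_{1:i}$ is the unique string of length $i$ with $x\in\Gamma_{x_{1:i}}$. Write $l=\ell(z)$ for the length of $z$. A distribution $q$ is parametrized by its branching probabilities $q_{z0}=P[\Gamma_{z0}|\Gamma_z,q]$ and $q_{z1}=P[\Gamma_{z1}|\Gamma_z,q]$, with $q_{z0}+q_{z1}=1$; those of $\dot q$ are $\dot q_{z0},\dot q_{z1}$. Finite-$m$ prior. Fix $\alpha>0$ and $u,s\in[0,1]$ with $u+s=1$. For finite $m$ (tree height) and $\ell(z)\le m$ let $\vec q_{z*}:=(q_{zy}:y\in\mathbb B_1^{m-l})$. The prior $p_z^m(\vec q_{z*})$ (a probability measure, written as a generalized density with Dirac deltas) is $1$ if $\ell(z)=m$ (empty collection), and for $\ell(z)<m$ $$p_z^m(\vec q_{z*})=u\prod_{y\in\mathbb B_1^{m-l}}\delta(q_{zy}-\tfrac12)+s\cdot\mathrm{Beta}(q_{z0},q_{z1}|\alpha,\alpha)\,p_{z0}^m(\vec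 q_{z0*})\,p_{z1}^m(\vec q_{z1*}),$$ where $\mathrm{Beta}(p,q|a,b)=\frac{\Gamma(a+b)}{\Gamma(a)\Gamma(b)}p^{a-1}q^{b-1}\delta(p+q-1)$ and $\Gamma(\cdot)$ with a real argument is the Gamma function. Finite-$m$ evidence and posterior. The data is $D=(x^1,\dots,x^n)$; $D_z$ is the sublist (with multiplicity) of points of $D$ lying in $\Gamma_z$, and $n_z:=|D_z|$. For $x\in\Gamma_z$, $p_z^m(x|q):=\prod_{i=l+1}^m 2q_{x_{1:i}}$ (empty product $=1$), $p_z^m(D_z|\vec q_{z*}):=\prod_{x\in D_z}p_z^m(x|q)$, $p_z^m(D_z):=\int p_z^m(D_z|\vec q_{z*})p_z^m(\vec q_{z*})d\vec q_{z*}$ (the evidence), and $p_z^m(\vec q_{z*}|D_z):=p_z^m(D_z|\vec q_{z*})p_z^m(\vec q_{z*})/p_z^m(D_z)$ (the posterior). $p_z^m(\vec q_{z*'})$ and $p_z^m(\vec q_{z*'}|D_z)$ are the marginals of prior and posterior on the coordinates $\vec q_{z*'}$. Infinite trees. $p_z^\infty:=\lim_{m\to\infty}p_z^m$ if the limit exists (possibly infinite). The superscript $m\le\infty$ is dropped in the claim. True distribution on $\Gamma_z$. $\dot q_z(\cdot)$ denotes $p_z(\cdot|\dot q)$ (for tree height $m$, built from the branching probabilities down to level $m$). It is non-uniform on $\Gamma_z$ iff $\dot q_{zy0}\ne\frac12$ for some string $y$ with $\ell(zy)<m$. Cells. $q_z(\Gamma_y):=2^{-l}P[\Gamma_y|\Gamma_z,q]$,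 and likewise $\dot q_z(\Gamma_y)$ for $\dot q$ (for $z=\epsilon$, $q_\epsilon(\Gamma_y)=q_{y_1}q_{y_{1:2}}\cdots q_{y_{1:\ell(y)}}$ with $y_{1:i}$ the length-$i$ prefix of $y$). $p_z(\Gamma_{y^1},\dots,\Gamma_{y^k}|D_z):=\int q_z(\Gamma_{y^1})\cdots q_z(\Gamma_{y^k})\,p_z(\vec q_{z*'}|D_z)\,d\vec q_{z*'}$, where the finite $m'\le m$ is chosen with $m'\ge\max\{\ell(z),\ell(y^1),\dots,\ell(y^k)\}$.
   Formalization: (iii) and (iv) additionally assume s>0 or that the true distribution on Γ_z is uniform down to level m' (with s=0 the prior is a point mass); (iii) also assumes every cell Γ_{zy} with ℓ(zy)<m' has positive true probability, since otherwise the branching probabilities below it are undefined. *)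

(* Defs.v *)
From HB Require Import structures.
From mathcomp Require Import all_boot all_order all_algebra.
From mathcomp Require Import all_classical all_reals all_analysis.
Import Order.TTheory GRing.Theory Num.Theory.
Import numFieldNormedType.Exports.

Set Implicit Arguments.
Unset Strict Implicit.
Unset Printing Implicit Defensive.

Local Open Scope classical_set_scope.
Local Open Scope ring_scope.

(* A binary string is a [seq bool]; z0 and z1 are [rcons z false] and
   [rcons z true]. *)

Section gamma_beta.
Context {R : realType}.
Local Notation mu := (@lebesgue_measure R).

Definition Gamma (a : R) : R :=
  \int[mu]_(t in `]0, +oo[) (t `^ (a - 1) * expR (- t)).

Definition beta_density (a b p q : R) : R :=
  Gamma (a + b) / (Gamma a * Gamma b) * p `^ (a - 1) * q `^ (b - 1).

(* The factor delta(p + q - 1) puts the mass on the segment {(p, 1 - p)}, so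
   Beta(., .|a, b) is the image of a density on ]0, 1[ under p |-> (p, 1 - p). *)
Definition Beta (a b : R) : set (R * R) -> \bar R :=
  pushforward
    (fun A : set R =>
       \int[mu]_(p in A `&` `]0%R, 1%R[) (beta_density a b p (1 - p))%:E)%E
    (fun p : R => (p, 1 - p)).

End gamma_beta.

Section partition_and_data.
Context {R : realType} d {T : measurableType d}.

Record tree_partition (vol : probability T R) (G : seq bool -> set T) : Prop := {
  tree_root : G [::] = setT ;
  tree_split : forall z, G z = G (rcons z false) `|` G (rcons z true) ;
  tree_disjoint : forall z, G (rcons z false) `&` G (rcons z true) = set0 ;
  tree_half : forall z b, vol (G (rcons z b)) = (2^-1%:E * vol (G z))%E ;
  tree_generate : @measurable d T = <<s range G >>
}.

Definition address (G : seq bool -> set T) (x : T) (i : nat) : seq bool :=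
  xget [::] [set w | size w = i /\ G w x].

Definition sublist (G : seq bool -> set T) (z : seq bool) (D : seq T) : seq T :=
  [seq x <- D | x \in G z].

(* [qdot (rcons z b)] is P[G_{zb} | G_z, Q] when [Q (G z) > 0]; when
   [Q (G z) = 0] this conditional probability is undefined and [qdot] is only
   constrained by the normalization. *)
Definition branching_of (G : seq bool -> set T) (Q : probability T R)
    (qdot : seq bool -> R) : Prop :=
  [/\ forall w, 0 <= qdot w,
      forall z, qdot (rcons z false) + qdot (rcons z true) = 1 &
      forall z b, Q (G (rcons z b)) = ((qdot (rcons z b))%:E * Q (G z))%E].

Definition iid d' (Omega : measurableType d') (P : probability Omega R)
    (Q : probability T R) (X : nat -> {RV P >-> T}) : Prop :=
  (forall i (A : set T), measurable A -> distribution P (X i) A = Q A) /\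
  (forall n (A : nat -> set T), (forall i, measurable (A i)) ->
     P (\bigcap_(i < n) (X i @^-1` A i)) =
     (\prod_(i < n) P (X i @^-1` A i))%E).

Definition data d' (Omega : measurableType d') (P : probability Omega R)
    (X : nat -> {RV P >-> T}) (n : nat) (omega : Omega) : seq T :=
  [seq X i omega | i <- iota 0 n].

End partition_and_data.

Section branching_space.
Context (R : realType).

(* The index set {zy : y in B_1^{m-l}} of the collection q_{z*}. *)
Definition tree_index (z : seq bool) (m : nat) : Type :=
  {w : seq bool | prefix z w && (size z < size w <= m)%N}.

Definition cylinders (z : seq bool) (m : nat) : set (set (tree_index z m -> R)) :=
  [set C | exists w (B : set R),
     measurable B /\ C = (fun q : tree_index z m -> R => q w) @^-1` B].

(* R^{zy : y in B_1^{m-l}} with its product sigma-algebra; this is a single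
   point when l = m. *)
Definition branching (z : seq bool) (m : nat) :=
  g_sigma_algebraType (@cylinders z m).

(* q_w, with the dummy value 0 if [w] is not an index of the collection. *)
Definition lookup z m (q : tree_index z m -> R) (w : seq bool) : R :=
  if insub w is Some w' then q w' else 0.

Definition half_tree z m : branching z m := fun=> 2^-1.

(* Assembles q_{z*} out of (q_{z0}, q_{z1}), q_{z0*} and q_{z1*}. *)
Definition node z m
    (t : (R * R) * (branching (rcons z false) m * branching (rcons z true) m)) :
    branching z m :=
  fun w => if insub (val w) is Some w0 then t.2.1 w0
           else if insub (val w) is Some w1 then t.2.2 w1
           else if val w == rcons z false then t.1.1 else t.1.2.

Definition restrict_tree z m m' (q : branching z m) : branching z m' :=
  fun w => lookup q (val w).

(* P[G_y | G_z, q]; the second case covers the strings [y] that do not extend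
   [z], for which G_y contains G_z or is disjoint from it. *)
Definition cond_prob (q : seq bool -> R) (z y : seq bool) : R :=
  if prefix z y then \prod_((size z).+1 <= i < (size y).+1) q (take i y)
  else (prefix y z)%:R.

Definition cell (q : seq bool -> R) (z y : seq bool) : R :=
  2^-1 ^+ size z * cond_prob q z y.

End branching_space.

Arguments half_tree {R z m}.
Arguments node {R z m}.
Arguments restrict_tree {R z m} m'.

(* Tree heights m <= oo : [None] is m = oo. *)
Definition le_height (k : nat) (m : option nat) : Prop :=
  if m is Some m0 then (k <= m0)%N else True.
Definition lt_height (k : nat) (m : option nat) : Prop :=
  if m is Some m0 then (k < m0)%N else True.

Unset Implicit Arguments.

Section model.
Context {R : realType} {d} {T : measurableType d}.
Variables (G : seq bool -> set T) (alpha u s : R).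

(* Recursion on k = m - l(z).  Priors and posteriors are plain set functions,
   probability measures when restricted to events (see [is_probability]). *)
Fixpoint prior_rec (k m : nat) (z : seq bool) : set (branching R z m) -> \bar R :=
  if k is k'.+1 then
    fun A =>
      (u%:E * \d_(half_tree : branching R z m) A +
       s%:E * pushforward
                (Beta alpha alpha \x
                   (prior_rec k' m (rcons z false) \x
                    prior_rec k' m (rcons z true))) node A)%E
  else fun A => \d_(half_tree : branching R z m) A.

Definition prior (m : nat) (z : seq bool) : set (branching R z m) -> \bar R :=
  prior_rec (m - size z) m z.

Definition likelihood1 m z (q : branching R z m) (x : T) : R :=
  \prod_((size z).+1 <= i < m.+1) (2 * lookup q (address G x i)).

Definition likelihood m z (Dz : seq T) (q : branching R z m) : R :=
  \prod_(x <- Dz) likelihood1 m z q x.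

Definition evidence (m : nat) (z : seq bool) (Dz : seq T) : \bar R :=
  (\int[prior m z]_q (likelihood m z Dz q)%:E)%E.

Definition posterior (m : nat) (z : seq bool) (Dz : seq T) :
    set (branching R z m) -> \bar R :=
  fun A => ((\int[prior m z]_(q in A) (likelihood m z Dz q)%:E)
            / evidence m z Dz)%E.

Definition marg_prior (m : nat) (z : seq bool) (m' : nat) :
    set (branching R z m') -> \bar R :=
  pushforward (prior m z) (restrict_tree m').

Definition marg_posterior (m : nat) (z : seq bool) (m' : nat) (Dz : seq T) :
    set (branching R z m') -> \bar R :=
  pushforward (posterior m z Dz) (restrict_tree m').

Definition evidence_h (m : option nat) (z : seq bool) (Dz : seq T) : \bar R :=
  if m is Some m0 then evidence m0 z Dz
  else lim (evidence k z Dz @[k --> \oo]).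

(* p^oo(A) := lim_m p^m(A) for every event A. *)
Definition marg_prior_h (m : option nat) (z : seq bool) (m' : nat) :
    set (branching R z m') -> \bar R :=
  fun A => if m is Some m0 then marg_prior m0 z m' A
           else lim (marg_prior k z m' A @[k --> \oo]).

Definition marg_posterior_h (m : option nat) (z : seq bool) (m' : nat)
    (Dz : seq T) : set (branching R z m') -> \bar R :=
  fun A => if m is Some m0 then marg_posterior m0 z m' Dz A
           else lim (marg_posterior k z m' Dz A @[k --> \oo]).

(* p_z(G_{y^1}, ..., G_{y^k} | D_z) with ys = [:: y^1; ...; y^k]. *)
Definition cells_posterior (m : option nat) (z : seq bool) (m' : nat)
    (ys : seq (seq bool)) (Dz : seq T) : R :=
  fine (\int[marg_posterior_h m z m' Dz]_q
          (\prod_(y <- ys) cell (lookup q) z y)%:E)%E.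

End model.

Set Implicit Arguments.

Definition nonuniform {R : realType} (qdot : seq bool -> R) (m : option nat)
    (z : seq bool) : Prop :=
  exists y, lt_height (size (z ++ y)) m /\ qdot (rcons (z ++ y) false) != 2^-1.

(* The set function [mu] is, on events, a probability measure. *)
Definition is_probability {R : realType} d (T : measurableType d)
    (mu : set T -> \bar R) : Prop :=
  exists nu : probability T R, forall A, measurable A -> mu A = nu A.

(* F n m --> L as N n --> oo, uniformly in the height m, k <= m <= oo. *)
Definition unif_cvg {R : realType} (N : nat -> nat) (k : nat)
    (F : nat -> option nat -> R) (L : R) : Prop :=
  forall e : R, 0 < e -> exists N0, forall n, (N0 <= N n)%N ->
    forall m, le_height k m -> `|F n m - L| < e.

(* mu n m --> nu weakly as N n --> oo, uniformly in the height m. *)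
Definition unif_weak_cvg {R : realType} (z : seq bool) (m' : nat)
    (N : nat -> nat) (k : nat)
    (mu : nat -> option nat -> set (branching R z m') -> \bar R)
    (nu : set (branching R z m') -> \bar R) : Prop :=
  forall f : {ptws tree_index z m' -> R} -> R,
    continuous f -> (exists M, forall q, `|f q| <= M) ->
    unif_cvg N k (fun n m => fine (\int[mu n m]_q (f q)%:E)%E)
             (fine (\int[nu]_q (f q)%:E)%E).

(* Main.v *)
(* By conjugacy of the Beta prior, the evidence of the tree below [z] satisfies
     ev(z) = u + s W(n_z0, n_z1) ev(z0) ev(z1),
   and the posterior has the shape of the prior: at each node [w] the tree stops (all lower
   branching probabilities are 1/2) with probability u / ev(w), and otherwise q_w0 has law
   Beta(alpha + n_w0, alpha + n_w1).  Once the tree is so high that distinct data paths have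
   separated, the evidence is nondecreasing in [m], because W(n, 0) >= 1; hence the evidence and
   the stopping probabilities converge, and so do the marginal posteriors, which depend
   continuously on the stopping probabilities.
   By the strong law of large numbers the cell frequencies converge.  Laplace's method shows that
   W(n_w0, n_w1) grows exponentially at a node with unfair limit frequencies and decays slower than
   any exponential elsewhere, uniformly in [m]: the evidence explodes at and above such a node, so
   the stopping probabilities there vanish.  As the Beta law has variance O(1/n), the posterior
   second moments of q_w - qdot_w tend to 0 whenever the parent cell of [w] has positive mass.
   This yields weak convergence, and also the convergence of products of cell masses, since below
   a null cell such a product contains a factor that tends to 0. *)

Require Import Defs.
From HB Require Import structures.
From mathcomp Require Import all_boot all_order all_algebra.
From mathcomp Require Import all_classical all_reals all_analysis.
From mathcomp Require Import measurable_realfun ring lra.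
Import Order.TTheory GRing.Theory Num.Theory.
Import numFieldNormedType.Exports.

Set SsrOldRewriteGoalsOrder.
Set Implicit Arguments.
Unset Strict Implicit.
Unset Printing Implicit Defensive.

Local Open Scope classical_set_scope.
Local Open Scope ring_scope.

(** * Euler's Gamma and Beta integrals *)

(** Priors and posteriors are plain set functions, so they are first identified, on events, with
    genuine probability measures [tree_post] given by stopping probabilities and Beta parameters.
    The height [m] enters these only through the stopping probabilities, and [m = oo] is a limit of
    parameters. Likelihoods are nonnegative only on the unit cube, so conjugacy is proved for their
    absolute values and transferred almost everywhere.

    Uniformity in [m] comes from following a single path to the unfair node: each subtree off the
    path is bounded below by [u], whatever its height. The path costs finitely many exponential
    losses of arbitrarily small rate, and the one gain at its end beats them all; this is why
    subexponential decay of W suffices.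

    Test functions are integrated without using their measurability: a measurable majorant of
    [|f - c|], built from second moments, is integrated instead. Coordinates below null cells are
    never learned from the data; the filter [observable_nbhs] leaves them free in the unit interval,
    and both weak limits and limits of cell masses are ordinary limits along it. *)

Section affine.
Context {R : realType}.
Local Notation mu := (@lebesgue_measure R).
Local Open Scope ereal_scope.

Lemma measurable_affine (c d : R) :
  measurable_fun [set: measurableTypeR R] (fun x : R => (c * x + d)%R : measurableTypeR R).
Proof. by apply: measurable_funD => //; apply: measurable_funM. Qed.

Lemma preimage_affine_itv (c d a b : R) : (0 < c)%R ->
  ((fun x : R => (c * x + d)%R) @^-1` [set` `]a, b]] = [set` `]((a - d) / c), ((b - d) / c)]])%R.
Proof.
move=> c0; apply/seteqP; split=> x /=; rewrite !in_itv/= ltr_pdivrMr// ler_pdivlMr//;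
  by rewrite ltrBlDr lerBrDr mulrC.
Qed.

(** Two measures that agree on half-open intervals are equal. *)
Lemma lebesgue_measure_affine (c d : R) (A : set (measurableTypeR R)) : (0 < c)%R ->
  measurable A -> mu A = c%:E * pushforward mu (fun x : R => (c * x + d)%R) A.
Proof.
move=> c0 mA.
pose f : measurableTypeR R -> measurableTypeR R := fun x => (c * x + d)%R.
pose F : {mfun measurableTypeR R >-> measurableTypeR R} :=
  HB.pack f (isMeasurableFun.Build _ _ _ _ f (measurable_affine c d)).
rewrite [LHS](@lebesgue_measure_unique R (mscale (NngNum (ltW c0)) (pushforward mu F)))//.
move=> _ [[a b] _ <-]; transitivity (c%:E * mu ((fun x : R => (c * x + d)%R) @^-1` [set` `]a, b]]))
    => //.
rewrite preimage_affine_itv//.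
rewrite !lebesgue_measure_itv/= !lte_fin ltr_pM2r ?invr_gt0// ltrD2r.
case: ifPn => _; last by rewrite mule0.
rewrite -!EFinB -EFinM; congr EFin.
by rewrite -mulrBl mulrCA mulfV ?gt_eqF// mulr1; ring.
Qed.

Lemma ge0_integral_affine (c d : R) (f : R -> \bar R) : (0 < c)%R ->
  measurable_fun setT f -> (forall x, 0 <= f x) ->
  \int[mu]_x f x = c%:E * \int[mu]_x f (c * x + d)%R.
Proof.
move=> c0 mf f0.
pose g : measurableTypeR R -> measurableTypeR R := fun x => (c * x + d)%R.
pose F : {mfun measurableTypeR R >-> measurableTypeR R} :=
  HB.pack g (isMeasurableFun.Build _ _ _ _ g (measurable_affine c d)).
rewrite (eq_measure_integral (mscale (NngNum (ltW c0)) (pushforward mu F))); last first.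
  by move=> A mA _; rewrite [LHS](lebesgue_measure_affine d c0 mA).
rewrite ge0_integral_mscale//; congr (_ * _).
by rewrite ge0_integral_pushforward.
Qed.

End affine.

Lemma gt0_powRD {R : realType} (x r s : R) : 0 < x -> x `^ (r + s) = x `^ r * x `^ s.
Proof. by move=> x0; rewrite powRD//; apply/implyP => _; rewrite gt_eqF. Qed.

Lemma powR_subr1 {R : realType} (a x : R) : 0 < x -> x `^ a = x `^ (a - 1) * x.
Proof.
by move=> x0; rewrite -{1}(subrK 1 a) (@gt0_powRD _ x (a - 1) 1)// powRr1// ltW.
Qed.

Section gamma_fun.
Context {R : realType}.
Local Notation mu := (@lebesgue_measure R).
Local Open Scope ereal_scope.

(** Extended by 0 to the whole line, so that Tonelli's theorem and affine substitutions need no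
    domain. *)
Definition gamma_kernel (a x : R) : R :=
  if (0 < x)%R then (x `^ (a - 1) * expR (- x))%R else 0%R.

Lemma gamma_kernel_ge0 a x : (0 <= gamma_kernel a x)%R.
Proof. by rewrite /gamma_kernel; case: ifP => // _; rewrite mulr_ge0 ?powR_ge0 ?expR_ge0. Qed.

Lemma measurable_gamma_kernel a : measurable_fun [set: R] (gamma_kernel a).
Proof.
apply: measurable_fun_ifT => //.
  by apply: measurable_fun_ltr => //.
apply: measurable_funM; first exact: measurable_powR.
by apply: measurableT_comp => //; apply: measurable_funN.
Qed.

(** Extended values allow the functional equations to be proved by Tonelli's theorem before
    finiteness is known; finiteness is then deduced from them. *)
Definition egamma (a : R) : \bar R := \int[mu]_x (gamma_kernel a x)%:E.

Lemma egamma_ge0 a : 0 <= egamma a.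
Proof. by apply: integral_ge0 => x _; rewrite lee_fin gamma_kernel_ge0. Qed.

Lemma gamma_kernelE a :
  \int[mu]_(x in `]0%R, +oo[) (x `^ (a - 1) * expR (- x))%:E = egamma a.
Proof.
rewrite integral_mkcond; apply: eq_integral => x _; rewrite patchE/gamma_kernel mem_setE in_itv/=
    andbT.
by case: ifP.
Qed.

Lemma GammaE a : Gamma a = fine (egamma a).
Proof. by rewrite /Gamma /Rintegral gamma_kernelE. Qed.

(** Otherwise the kernel would vanish almost everywhere, but it is positive on an interval of
    measure 1. *)
Lemma egamma_gt0 a : 0 < egamma a.
Proof.
rewrite lt0e egamma_ge0 andbT; apply/eqP => h.
have : {ae mu, forall x, [set: R] x -> (gamma_kernel a x)%:E = 0}.
  apply/ae_eq_integral_abs => //.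
    by apply/measurable_EFinP; exact: measurable_gamma_kernel.
  rewrite -h; apply: eq_integral => x _; by rewrite gee0_abs// lee_fin gamma_kernel_ge0.
case=> N [mN N0 sub].
suff : mu `]0%R, 1%R[ <= mu N.
  by rewrite N0 lebesgue_measure_itv/= lte_fin ltr01 -EFinB subr0 lee_fin ler10.
apply: le_measure; rewrite ?inE// => x; rewrite /= in_itv/= => /andP[x0 x1].
apply: sub => /= /(_ I) []; rewrite /gamma_kernel x0 => /eqP.
by rewrite gt_eqF// mulr_gt0 ?powR_gt0 ?expR_gt0.
Qed.

Lemma egamma1 : egamma 1 = 1.
Proof.
rewrite -(@integral_exponential_pdf R 1 ltr01) /egamma.
(* The kernel and the exponential density of rate 1 can differ only at 0, which is removed from both
   integrals. *)
rewrite -(@integral_setD1 _ _ 0%R setT)//=; last first.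
- by apply/measurable_EFinP/measurable_funTS; exact: measurable_gamma_kernel.
- by apply: measurableD.
rewrite -[RHS](@integral_setD1 _ _ 0%R setT)//=; last first.
- by apply/measurable_EFinP/measurable_funTS; exact: measurable_exponential_pdf.
- by apply: measurableD.
apply: eq_integral => x; rewrite inE/= => -[_ x0].
rewrite /gamma_kernel; case: ltP => [x1|].
  by rewrite exponential_pdfE ?ltW// subrr powRr0 mul1r mulN1r mul1r.
move=> xle; rewrite lt0_exponential_pdf// lt_neqAle xle andbT; exact/eqP.
Qed.

Lemma ge0_integral_is_derive_y (f F : R -> R) (a l : R) :
  (forall x, (a <= x)%R -> (0 <= f x)%R) ->
  (forall x, (a <= x)%R -> derivable f x 1) ->
  (forall x, (a <= x)%R -> derivable F x 1 /\ (F^`() x)%classic = f x) ->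
  (F x @[x --> +oo%R] --> l)%classic ->
  \int[mu]_(x in `[a, +oo[) (f x)%:E = l%:E - (F a)%:E.
Proof.
move=> f0 df dF Fl; apply: ge0_continuous_FTC2y => //.
- by apply: derivable_within_continuous => x; rewrite in_itv/= andbT => /df.
- by move=> x /ltW /dF[].
- apply: cvg_at_right_filter; apply: differentiable_continuous.
  by apply/derivable1_diffP; case: (dF a (lexx a)).
- by move=> x; rewrite in_itv/= andbT => /ltW /dF[dx <-].
Qed.

Lemma cvg_expR_scale (c y : R) : (0 < c)%R -> (0 < y)%R ->
  ((- c * expR (- (x * y)))%R @[x --> +oo%R] --> (0%R : R))%classic.
Proof.
move=> c0 y0; apply/cvgr0Pnorm_lt => e e0; near=> x.
rewrite mulNr normrN ger0_norm ?mulr_ge0 ?expR_ge0 ?ltW// -ltr_pdivlMl//.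
rewrite -(@lnK _ (c^-1 * e)%R) ?posrE ?mulr_gt0 ?invr_gt0// ltr_expR ltrNl -ltr_pdivrMr//.
near: x; apply: nbhs_pinfty_gt; exact: num_real.
Unshelve. all: by end_near. Qed.

Lemma cvg_powRN_y (a : R) : (0 < a)%R ->
  ((- a^-1 * x `^ (- a))%R @[x --> +oo%R] --> (0%R : R))%classic.
Proof.
move=> a0; apply/cvgr0Pnorm_lt => e e0; near=> x.
have x0 : (0 < x)%R by near: x; apply: nbhs_pinfty_gt; exact: num_real.
rewrite mulNr normrN ger0_norm ?mulr_ge0 ?powR_ge0 ?invr_ge0 ?ltW// ltr_pdivrMl//.
rewrite -(@lnK _ (a * e)%R) ?posrE ?mulr_gt0// /powR gt_eqF// ltr_expR.
have H : (- ln (a * e) / a < ln x)%R.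
  rewrite -ltr_expR (@lnK _ x) ?posrE//.
by move: H; rewrite ltr_pdivrMr// => H; lra.
Unshelve. all: by end_near. Qed.

Lemma gamma_kernel_Laplace a y : (0 < y)%R ->
  \int[mu]_(x in `[1%R, +oo[) (y `^ a * expR (- (x * y)))%:E =
  (y `^ (a - 1) * expR (- y))%:E.
Proof.
move=> y0.
rewrite (@ge0_integral_is_derive_y _ (fun x => - (y `^ (a - 1)) * expR (- (x * y)))%R 1%R 0%R).
- by rewrite sub0e -EFinN mul1r mulNr opprK.
- by move=> x _; rewrite mulr_ge0 ?powR_ge0 ?expR_ge0.
- by move=> x _; apply: ex_derive.
- move=> x x1.
  have D : is_derive x (1%R : R^o) (fun x => - (y `^ (a - 1)) * expR (- (x * y)))%R
      (- (y `^ (a - 1)) * (- y * expR (- (x * y))))%R.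
    by apply: is_derive_eq; rewrite /GRing.scale/=; ring.
  split; first by case: D.
  rewrite derive1E (@derive_val _ _ _ _ _ _ _ D).
  by rewrite (powR_subr1 a y0); ring.
- by apply: cvg_expR_scale => //; rewrite powR_gt0.
Qed.

Lemma gamma_kernel_scale a x : (0 < x)%R ->
  \int[mu]_y (if (0 < y)%R then y `^ a * expR (- (x * y)) else 0)%:E =
  (x `^ (- a - 1))%:E * egamma (a + 1).
Proof.
move=> x0.
pose h y : R := (if (0 < y)%R then y `^ a * expR (- (x * y)) else 0)%R.
have mh : measurable_fun setT h.
  apply: measurable_fun_ifT => //; first exact: measurable_fun_ltr.
  apply: measurable_funM; first exact: measurable_powR.
  by apply: measurableT_comp => //; apply: measurable_funN; apply: measurable_funM.
have h0 y : (0 <= h y)%R by rewrite /h; case: ifP; rewrite // mulr_ge0 ?powR_ge0 ?expR_ge0.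
rewrite (@ge0_integral_affine _ (x^-1) 0%R (EFin \o h)) ?invr_gt0//; last first.
  exact/measurable_EFinP.
have mhx : measurable_fun [set: R] (fun y => (h (x^-1 * y + 0)%R)%:E).
  by apply/measurable_EFinP; exact: (measurableT_comp mh (measurable_affine _ _)).
rewrite -(ge0_integralZl mu measurableT mhx); last 2 first.
- by move=> y _; rewrite lee_fin.
- by rewrite lee_fin invr_ge0 ltW.
have mg : measurable_fun [set: R] (fun y => (gamma_kernel (a + 1) y)%:E).
  by apply/measurable_EFinP; exact: measurable_gamma_kernel.
rewrite /egamma -(ge0_integralZl mu measurableT mg); last 2 first.
- by move=> y _; rewrite lee_fin gamma_kernel_ge0.
- by rewrite lee_fin powR_ge0.
apply: eq_integral => y _; rewrite /gamma_kernel /h addr0 pmulr_rgt0 ?invr_gt0//.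
case: ifPn => y0; last by rewrite !mule0.
rewrite -!EFinM; congr EFin; rewrite addrK mulrA mulrA mulfV ?gt_eqF// mul1r.
rewrite powRM ?invr_ge0 ?ltW// -powR_inv1 ?ltW// -powRrM mulN1r.
have -> : (x `^ (- a - 1) = x `^ (- a) * x `^ (-1))%R.
  by rewrite gt0_powRD.
ring.
Qed.

Lemma integral_powRN a : (0 < a)%R ->
  \int[mu]_(x in `[1%R, +oo[) (x `^ (- a - 1))%:E = (a^-1)%:E.
Proof.
move=> a0; rewrite (@ge0_integral_is_derive_y _ (fun x => - a^-1 * x `^ (- a))%R 1%R 0%R).
- by rewrite powR1 mulr1 sub0e -EFinN opprK.
- by move=> x _; rewrite powR_ge0.
- move=> x x1; have x0 : (0 < x)%R by exact: lt_le_trans x1.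
  by have [] := is_derive1_powR (-a - 1)%R x0.
- move=> x x1; have x0 : (0 < x)%R by exact: lt_le_trans x1.
  have D := is_derive1_powR (-a)%R x0.
  have [Dd _] := D.
  split; first by apply: derivableM => //; exact: Dd.
  rewrite derive1E deriveM; [|exact: derivable_cst|exact: Dd].
  rewrite (@derive_val _ _ _ _ _ _ _ D) derive_cst /GRing.scale/= mulr0 addr0.
  by rewrite mulrA mulrNN mulVf ?gt_eqF// mul1r.
- exact: cvg_powRN_y.
Qed.

(* Integrating [t^a e^{-l t}] over [l >= 1] before [t], or after rescaling [t]. *)
Lemma egammaD1 a : (0 < a)%R -> egamma (a + 1) = a%:E * egamma a.
Proof.
move=> a0.
pose F (x : R * R) : \bar R :=
  (if ((1 <= x.1) && (0 < x.2))%R then x.2 `^ a * expR (- (x.1 * x.2)) else 0)%:E.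
have F0 x : 0 <= F x.
  by rewrite lee_fin; case: ifP => // _; rewrite mulr_ge0 ?powR_ge0 ?expR_ge0.
have mF : measurable_fun setT F.
  apply/measurable_EFinP; apply: measurable_fun_ifT => //.
    by apply: measurable_and; [apply: measurable_fun_ler|apply: measurable_fun_ltr].
  apply: measurable_funM.
    by apply: (measurableT_comp (measurable_powR a)).
  apply: measurableT_comp => //; apply: measurable_funN; exact: measurable_funM.
have FT := @fubini_tonelli _ _ _ _ R mu mu F mF F0.
have E1 : \int[mu]_y \int[mu]_x F (x, y) = egamma a.
  apply: eq_integral => y _; rewrite /gamma_kernel /F/=.
  have [y0|y0] := ltP 0%R y; last first.
    by apply: integral0_eq => x _; rewrite andbF.
  rewrite -(gamma_kernel_Laplace _ y0) [RHS]integral_mkcond; apply: eq_integral => x _.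
  by rewrite patchE mem_setE in_itv/= !andbT; case: ifP.
have E2 : \int[mu]_x \int[mu]_y F (x, y) = (a^-1)%:E * egamma (a + 1).
  transitivity (\int[mu]_(x in `[1%R, +oo[) (egamma (a + 1) * (x `^ (- a - 1))%:E)).
    rewrite [RHS]integral_mkcond; apply: eq_integral => x _.
    rewrite patchE mem_setE in_itv/= andbT /F/=; case: ifPn => [x1|x1]; last first.
      by apply: integral0_eq.
    rewrite [RHS]muleC; apply: gamma_kernel_scale; exact: lt_le_trans x1.
  have mp : measurable_fun (`[1%R, +oo[ : set R) (fun x : R => (x `^ (- a - 1))%:E).
    by apply/measurable_EFinP/measurable_funTS; exact: measurable_powR.
  rewrite (ge0_integralZl mu (measurable_itv _) mp); last 2 first.
  + by move=> x _; rewrite lee_fin powR_ge0.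
  + exact: egamma_ge0.
  by rewrite (integral_powRN a0); exact: muleC.
have -> : egamma a = (a^-1)%:E * egamma (a + 1) := etrans (esym E1) (etrans (esym FT) E2).
clear E1 E2 FT mF F0; by rewrite muleA -EFinM mulfV ?gt_eqF// mul1e.
Qed.

(** For [1 <= x] the power grows with the exponent, and below 1 it is at most 1. This reduces
    finiteness to integer arguments, where the functional equation gives it. *)
Lemma gamma_kernel_le a n x : (1 <= a)%R -> (a <= n.+1%:R)%R ->
  (gamma_kernel a x <= gamma_kernel 1 x + gamma_kernel n.+1%:R x)%R.
Proof.
move=> a1 an; rewrite /gamma_kernel; case: ifPn => [x0|_]; last by rewrite addr0.
rewrite -mulrDl ler_wpM2r ?expR_ge0// subrr powRr0.
have [x1|x1] := leP 1%R x.
  by rewrite (le_trans (ler_powR x1 (lerB an (lexx 1%R))))// lerDr.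
apply: (@le_trans _ _ 1%R); last by rewrite lerDl powR_ge0.
rewrite /powR gt_eqF// -[leRHS]expR0 ler_expR; apply: mulr_ge0_le0; first by rewrite subr_ge0.
by apply: ln_le0; exact: ltW.
Qed.

Lemma egammaS_lty n : egamma n.+1%:R < +oo.
Proof.
elim: n => [|n ih]; first by rewrite egamma1 ltry.
by rewrite -addn1 natrD egammaD1// lte_mul_pinfty// lee_fin.
Qed.

Lemma egamma_lty a : (0 < a)%R -> egamma a < +oo.
Proof.
move=> a0.
have H b : (1 <= b)%R -> egamma b < +oo.
  move=> b1; have b0 : (0 <= b)%R by exact: le_trans b1.
  apply: (@le_lt_trans _ _ (egamma 1 + egamma (Num.truncn b).+1%:R)); last first.
    by apply: lte_add_pinfty; [rewrite egamma1 ltry|exact: egammaS_lty].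
  rewrite /egamma -ge0_integralD//=; last 4 first.
  - by move=> x _; rewrite lee_fin gamma_kernel_ge0.
  - by apply/measurable_EFinP; exact: measurable_gamma_kernel.
  - by move=> x _; rewrite lee_fin gamma_kernel_ge0.
  - by apply/measurable_EFinP; exact: measurable_gamma_kernel.
  apply: ge0_le_integral => //.
  - by move=> x _; rewrite lee_fin gamma_kernel_ge0.
  - by apply/measurable_EFinP; exact: measurable_gamma_kernel.
  - by apply: emeasurable_funD; apply/measurable_EFinP; exact: measurable_gamma_kernel.
  - move=> x _; rewrite lee_fin gamma_kernel_le// ltW//.
    exact: truncnS_gt.
(* The functional equation brings finiteness down from [a + 1], which is at least 1, to [a]. *)
have := H (a + 1)%R; rewrite lerDr => /(_ (ltW a0)); rewrite egammaD1//.
case: (egamma a) (egamma_gt0 a) => [r _ _| _| //]; first exact: ltry.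
by rewrite gt0_muley ?lte_fin// ltxx.
Qed.

End gamma_fun.

Section beta_gamma.
Context {R : realType}.
Local Notation mu := (@lebesgue_measure R).
Local Open Scope ereal_scope.

Definition beta_kernel (a b p : R) : R :=
  if (0 < p < 1)%R then (p `^ (a - 1) * (1 - p) `^ (b - 1))%R else 0%R.

Lemma beta_kernel_ge0 a b p : (0 <= beta_kernel a b p)%R.
Proof. by rewrite /beta_kernel; case: ifP => // _; rewrite mulr_ge0 ?powR_ge0. Qed.

Lemma measurable_beta_kernel a b : measurable_fun [set: R] (beta_kernel a b).
Proof.
apply: measurable_fun_ifT => //.
  by apply: measurable_and; apply: measurable_fun_ltr.
apply: measurable_funM; first exact: measurable_powR.
apply: (measurableT_comp (measurable_powR _)).
exact: measurable_funB.
Qed.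

Lemma gamma_kernelM (a b x t : R) :
  (gamma_kernel a x * gamma_kernel b (t - x) =
   if (0 < x < t)%R then x `^ (a - 1) * (t - x) `^ (b - 1) * expR (- t) else 0 : R)%R.
Proof.
rewrite /gamma_kernel subr_gt0; case: ltP => x0; last by rewrite mul0r.
case: ltP => xt; last by rewrite mulr0.
have -> : (- t = - x + - (t - x))%R by ring.
by rewrite expRD; ring.
Qed.

Lemma gamma_kernelM_le0 (a b x t : R) : (t <= 0)%R ->
  (gamma_kernel a x * gamma_kernel b (t - x) = 0)%R.
Proof.
move=> t0; rewrite gamma_kernelM; case: ifPn => // /andP[x0 xt].
by move: (lt_le_trans (lt_trans x0 xt) t0); rewrite ltxx.
Qed.

Lemma gamma_kernel_conv a b t : (0 < t)%R ->
  \int[mu]_x (gamma_kernel a x * gamma_kernel b (t - x))%:E =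
  (gamma_kernel (a + b) t)%:E * \int[mu]_p (beta_kernel a b p)%:E.
Proof.
move=> t0.
have mB : measurable_fun [set: R] (fun p => (beta_kernel a b p)%:E).
  by apply/measurable_EFinP; exact: measurable_beta_kernel.
rewrite -(ge0_integralZl mu measurableT mB); last 2 first.
- by move=> p _; rewrite lee_fin beta_kernel_ge0.
- by rewrite lee_fin gamma_kernel_ge0.
have mg : measurable_fun [set: R] (fun x => (gamma_kernel a x * gamma_kernel b (t - x))%:E).
  apply/measurable_EFinP; apply: measurable_funM; first exact: measurable_gamma_kernel.
  apply: (measurableT_comp (measurable_gamma_kernel b)).
  exact: measurable_funB.
have g0 x : 0 <= (gamma_kernel a x * gamma_kernel b (t - x))%:E.
  by rewrite lee_fin mulr_ge0 ?gamma_kernel_ge0.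
rewrite (ge0_integral_affine 0%R t0 mg g0).
have mgt : measurable_fun [set: R] (fun p => (gamma_kernel a (t * p + 0) * gamma_kernel b (t - (t *
    p + 0)))%:E).
  exact: (measurableT_comp mg (measurable_affine _ _)).
rewrite -(ge0_integralZl mu measurableT mgt); last 2 first.
- by move=> p _; exact: g0.
- by rewrite lee_fin ltW.
apply: eq_integral => p _; rewrite -!EFinM gamma_kernelM /beta_kernel /gamma_kernel t0 addr0; congr
    EFin.
have -> : (0 < t * p < t)%R = (0 < p < 1)%R.
  by rewrite pmulr_rgt0// gtr_pMr.
case: ifPn => [/andP[p0 p1]|_]; last by rewrite !mulr0.
have -> : (t - t * p = t * (1 - p))%R by ring.
have q0 : (0 <= 1 - p)%R by rewrite subr_ge0 ltW.
rewrite !powRM ?(ltW t0) ?(ltW p0)//.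
have -> : (t `^ (a + b - 1) = t * t `^ (a - 1) * t `^ (b - 1))%R.
  have -> : (a + b - 1 = 1 + (a - 1) + (b - 1))%R by ring.
  by rewrite !gt0_powRD// powRr1// ltW.
ring.
Qed.

(** Tonelli's theorem for [gamma_kernel a x * gamma_kernel b (t - x)]: integrating [t] first
    separates the two factors by translation, integrating [x] first gives the convolution, which
    scales like [gamma_kernel (a + b) t]. *)
Lemma egammaM a b :
  egamma a * egamma b = egamma (a + b) * \int[mu]_p (beta_kernel a b p)%:E.
Proof.
pose F (x : R * R) : \bar R := (gamma_kernel a x.1 * gamma_kernel b (x.2 - x.1))%:E.
have F0 x : 0 <= F x by rewrite lee_fin mulr_ge0 ?gamma_kernel_ge0.
have mF : measurable_fun setT F.
  apply/measurable_EFinP; apply: measurable_funM.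
    exact: (measurableT_comp (measurable_gamma_kernel a)).
  apply: (measurableT_comp (measurable_gamma_kernel b)); exact: measurable_funB.
have FT := @fubini_tonelli _ _ _ _ R mu mu F mF F0.
have mg c : measurable_fun [set: R] (fun x => (gamma_kernel c x)%:E).
  by apply/measurable_EFinP; exact: measurable_gamma_kernel.
have E1 : \int[mu]_x \int[mu]_y F (x, y) = egamma a * egamma b.
  rewrite muleC [in RHS]/egamma -[RHS](ge0_integralZl mu measurableT (mg a)); last 2 first.
  - by move=> x _; rewrite lee_fin gamma_kernel_ge0.
  - exact: egamma_ge0.
  apply: eq_integral => x _; rewrite muleC /F/=.
  have gb0 y : 0 <= (gamma_kernel b y)%:E by rewrite lee_fin gamma_kernel_ge0.
  rewrite /egamma (ge0_integral_affine (- x)%R ltr01 (mg b) gb0) mul1e.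
  have mgx : measurable_fun [set: R] (fun y => (gamma_kernel b (1 * y + - x))%:E).
    exact: (measurableT_comp (mg b) (measurable_affine _ _)).
  rewrite -(ge0_integralZl mu measurableT mgx); last 2 first.
  - by move=> y _; exact: gb0.
  - by rewrite lee_fin gamma_kernel_ge0.
  by apply: eq_integral => y _; rewrite mul1r -EFinM.
have E2 : \int[mu]_y \int[mu]_x F (x, y) = egamma (a + b) * \int[mu]_p (beta_kernel a b p)%:E.
  rewrite muleC [in RHS]/egamma -[RHS](ge0_integralZl mu measurableT (mg (a + b)%R)); last 2 first.
  - by move=> x _; rewrite lee_fin gamma_kernel_ge0.
  - by apply: integral_ge0 => p _; rewrite lee_fin beta_kernel_ge0.
  apply: eq_integral => t _; rewrite muleC /F/=.
  have [t0|t0] := ltP 0%R t; first exact: gamma_kernel_conv.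
  have -> : gamma_kernel (a + b) t = 0%R by rewrite /gamma_kernel ltNge t0.
  rewrite mul0e.
  by apply: integral0_eq => x _; congr EFin; exact: gamma_kernelM_le0.
by rewrite -E1 FT E2.
Qed.

Lemma Gamma_gt0 (a : R) : (0 < a)%R -> (0 < Gamma a)%R.
Proof. by move=> a0; rewrite GammaE fine_gt0// egamma_gt0 egamma_lty. Qed.

Lemma EFin_Gamma (a : R) : (0 < a)%R -> (Gamma a)%:E = egamma a.
Proof. by move=> a0; rewrite GammaE fineK// gt0_fin_numE ?egamma_gt0// egamma_lty. Qed.

Lemma GammaD1 (a : R) : (0 < a)%R -> (Gamma (a + 1) = a * Gamma a)%R.
Proof.
move=> a0; apply: EFin_inj; rewrite EFinM !EFin_Gamma ?addr_gt0//.
exact: egammaD1.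
Qed.

Lemma integral_beta_kernel (a b : R) : (0 < a)%R -> (0 < b)%R ->
  \int[mu]_p (beta_kernel a b p)%:E = (Gamma a * Gamma b / Gamma (a + b))%:E.
Proof.
move=> a0 b0; have ab0 := addr_gt0 a0 b0; have := egammaM a b.
rewrite -!EFin_Gamma// -EFinM => /(congr1 (fun x => (Gamma (a + b))^-1%:E * x)).
by rewrite muleA -!EFinM mulVf ?mul1e ?gt_eqF ?Gamma_gt0// mulrC => <-.
Qed.

End beta_gamma.

(** * Beta measures on the line *)

Section integral_general.
Context d (T : measurableType d) (R : realType).
Local Open Scope ereal_scope.
Import HBNNSimple.

(** Integrals are suprema over simple functions, whose level sets are measurable. Thus a prior or
    posterior, which is only a set function, may be replaced under the integral by a measure that
    agrees with it on events. *)
Lemma eq_set_integral (m1 m2 : set T -> \bar R) (f : T -> \bar R) (D : set T) :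
  (forall A, measurable A -> m1 A = m2 A) ->
  \int[m1]_(x in D) f x = \int[m2]_(x in D) f x.
Proof.
move=> m12.
have H g : [set sintegral m1 h | h in [set h : {nnsfun T >-> R} | forall x, (h x)%:E <= g x]]
  = [set sintegral m2 h | h in [set h : {nnsfun T >-> R} | forall x, (h x)%:E <= g x]].
  by apply/seteqP; split=> _ [h /= hg <-]; exists h => //; apply: eq_fsbigr => r _; rewrite m12.
by rewrite /integral !H.
Qed.

(** Enlarging a function enlarges the set of simple functions below its positive part and shrinks
    the one below its negative part; measurability does not enter. *)
Lemma le_integral_nonmeasurable (m : set T -> \bar R) (f g : T -> \bar R) :
  (forall x, f x <= g x) -> \int[m]_x f x <= \int[m]_x g x.
Proof.
move=> fg.
have H (f1 g1 : T -> \bar R) : (forall x, f1 x <= g1 x) ->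
  ereal_sup [set sintegral m h | h in [set h : {nnsfun T >-> R} | forall x, (h x)%:E <= f1 x]] <=
  ereal_sup [set sintegral m h | h in [set h : {nnsfun T >-> R} | forall x, (h x)%:E <= g1 x]].
  move=> fg1; apply: le_ereal_sup => _ [h /= hg <-]; exists h => //= x.
  exact: le_trans (hg x) (fg1 x).
rewrite /integral !patch_setT; apply: leeB; apply: H => x.
  by rewrite !funeposE ge_max !le_max fg lexx orbT.
by rewrite !funenegE ge_max !le_max leeN2 fg lexx orbT.
Qed.

(** First for simple functions, then by monotone convergence. *)
Lemma ge0_integral_density (mu nu : {measure set T -> \bar R}) (g : T -> R) (f : T -> \bar R) :
  measurable_fun setT g -> (forall x, (0 <= g x)%R) ->
  (forall A, measurable A -> nu A = \int[mu]_(x in A) (g x)%:E) ->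
  measurable_fun setT f -> (forall x, 0 <= f x) ->
  \int[nu]_x f x = \int[mu]_x (f x * (g x)%:E).
Proof.
move=> mg g0 nuE mf f0.
have meg : measurable_fun setT (EFin \o g) by exact/measurable_EFinP.
have S (h : {nnsfun T >-> R}) : \int[nu]_x (h x)%:E = \int[mu]_x ((h x)%:E * (g x)%:E).
  rewrite integral_nnsfun// patch_setT sintegralE.
  transitivity (\int[mu]_x (\sum_(r \in range h) ((r * \1_(h @^-1` [set r]) x)%:E * (g x)%:E))).
    rewrite ge0_integral_fsum//; last 2 first.
    - by move=> r; apply: emeasurable_funM => //; exact/measurable_EFinP/measurable_funM.
    - by move=> r x _; apply: mule_ge0; [rewrite EFinM nnfun_muleindic_ge0|rewrite lee_fin].
    apply: eq_fsbigr => r /set_mem [x _ <-].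
    under eq_integral do rewrite EFinM -muleA.
    rewrite ge0_integralZl//; last 3 first.
    - by apply: emeasurable_funM => //; exact/measurable_EFinP.
    - by move=> y _; rewrite mule_ge0// lee_fin.
    - by rewrite lee_fin.
    congr (_ * _); rewrite nuE//.
    rewrite [LHS]integral_mkcond; apply: eq_integral => y _.
    by rewrite patchE indicE; case: ifPn => _; rewrite ?mul1e ?mul0e.
  apply: eq_integral => x _; rewrite [in RHS](fimfunE h) -fsumEFin// ge0_mule_fsuml// => r.
  by rewrite EFinM nnfun_muleindic_ge0.
pose f_ := nnsfun_approx measurableT mf.
have E1 : \int[nu]_x f x = limn (fun n => \int[nu]_x (f_ n x)%:E).
  rewrite -monotone_convergence//.
  - apply: eq_integral => y _; apply/esym/cvg_lim => //.
    by apply: cvg_nnsfun_approx.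
  - by move=> n; exact/measurable_EFinP/measurable_funP.
  - by move=> n y _; rewrite lee_fin.
  - by move=> y _ m n mn; rewrite lee_fin; exact/lefP/nd_nnsfun_approx.
have E2 : \int[mu]_x (f x * (g x)%:E) = limn (fun n => \int[mu]_x ((f_ n x)%:E * (g x)%:E)).
  rewrite -monotone_convergence//.
  - apply: eq_integral => y _; apply/esym/cvg_lim => //.
    by apply: cvgeZr => //; apply: cvg_nnsfun_approx.
  - by move=> n; apply: emeasurable_funM => //; exact/measurable_EFinP/measurable_funP.
  - by move=> n y _; rewrite mule_ge0// lee_fin.
  - move=> y _ m n mn; apply: lee_wpmul2r; first by rewrite lee_fin.
    by rewrite lee_fin; exact/lefP/nd_nnsfun_approx.
by rewrite E1 E2; congr (limn _); apply/funext => n; exact: S.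
Qed.

End integral_general.

Section density_measure.
Context d (T : measurableType d) (R : realType).
Local Open Scope ereal_scope.
Variables (mu : {measure set T -> \bar R}) (g : T -> R).
Hypotheses (mg : measurable_fun setT g) (g0 : forall x, (0 <= g x)%R).

Definition density_measure (_ : measurable_fun setT g) (_ : forall x, (0 <= g x)%R) (A : set T) :
    \bar R :=
  \int[mu]_(x in A) (g x)%:E.
Local Notation nu := (density_measure mg g0).

Let nu0 : nu set0 = 0. Proof. by rewrite /density_measure integral_set0. Qed.
Let nu_ge0 A : 0 <= nu A.
Proof. by apply: integral_ge0 => x _; rewrite lee_fin. Qed.
Let nu_sigma_additive : semi_sigma_additive nu.
Proof.
move=> /= F mF tF mUF; rewrite /density_measure; apply: cvg_toP.
  apply: ereal_nondecreasing_is_cvgn => m n mn.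
  by apply: lee_sum_nneg_natr => // k _ _; exact: nu_ge0.
rewrite ge0_integral_bigcup//=.
- by apply/measurable_EFinP; exact: measurable_funTS.
- by move=> x _; rewrite lee_fin.
Qed.
HB.instance Definition _ := isMeasure.Build _ _ _ nu nu0 nu_ge0 nu_sigma_additive.
End density_measure.

Section mixture.
Context d (T : measurableType d) (R : realType).
Local Open Scope ereal_scope.

Lemma mnormalizeE (mu : {measure set T -> \bar R}) (P : probability T R) (c : R) A :
  (0 < c)%R -> mu setT = c%:E -> mnormalize mu P A = (c^-1)%:E * mu A.
Proof. by move=> c0 muT; rewrite /mnormalize muT eqe gt_eqF//= muleC. Qed.

(** The absolute values make this a measure for every real [g]; they disappear when [g] is a
    probability. *)
Definition scaled_sum (g : R) (P Q : probability T R) : {measure set T -> \bar R} :=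
  measure_add (mscale (NngNum (normr_ge0 g)) P) (mscale (NngNum (normr_ge0 (1 - g)%R)) Q).

Lemma scaled_sumE (g : R) (P Q : probability T R) A : (0 <= g <= 1)%R ->
  scaled_sum g P Q A = g%:E * P A + (1 - g)%:E * Q A.
Proof.
move=> /andP[g0 g1].
rewrite [LHS](measure_addE (mscale (NngNum (normr_ge0 g)) P) (mscale (NngNum (normr_ge0 (1 - g)%R))
    Q)).
transitivity (`|g|%:E * P A + `|1 - g|%:E * Q A) => //.
by rewrite !ger0_norm ?subr_ge0.
Qed.

(* The measures below are sealed behind opaque existence proofs: unification would otherwise unfold them. *)
Lemma mixture_sig (g : R) (P Q : probability T R) :
  {M : probability T R | (0 <= g <= 1)%R -> forall A, M A = g%:E * P A + (1 - g)%:E * Q A}.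
Proof.
exists (mnormalize (scaled_sum g P Q) P) => g01 A.
rewrite [LHS](@mnormalizeE (scaled_sum g P Q) P 1%R)//.
  by rewrite invr1 mul1e scaled_sumE.
by rewrite scaled_sumE// !probability_setT !mule1 -EFinD addrCA subrr addr0.
Qed.

Definition mixture (g : R) (P Q : probability T R) : probability T R := sval (mixture_sig g P Q).

Lemma mixtureE (g : R) (P Q : probability T R) A : (0 <= g <= 1)%R ->
  mixture g P Q A = g%:E * P A + (1 - g)%:E * Q A.
Proof. by move=> g01; rewrite /mixture; case: mixture_sig => /= M ->. Qed.

Lemma integral_mixture (g : R) (P Q : probability T R) (f : T -> \bar R) : (0 <= g <= 1)%R ->
  measurable_fun setT f -> (forall x, 0 <= f x) ->
  \int[mixture g P Q]_x f x = g%:E * \int[P]_x f x + (1 - g)%:E * \int[Q]_x f x.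
Proof.
move=> g01 mf f0; have /andP[g0 g1] := g01.
rewrite (@eq_set_integral _ _ _ _ (scaled_sum g P Q)); last first.
  by move=> A mA; rewrite mixtureE// scaled_sumE.
rewrite ge0_integral_measure_add// !ge0_integral_mscale//=.
by rewrite !ger0_norm ?subr_ge0.
Qed.

Lemma integral_probability_cst (P : probability T R) (c : \bar R) : \int[P]_x c = c.
Proof.
rewrite -[RHS]mule1 -(probability_setT P) -(integral_cst P measurableT c).
by apply: eq_integral.
Qed.

End mixture.

Section beta_probability.
Context {R : realType}.
Local Notation mu := (@lebesgue_measure R).
Local Open Scope ereal_scope.

(** The point mass is the fallback of the normalization if the kernel has total mass 0 or infinity,
    so that a probability is defined for all real parameters. *)
Definition betaL (a b : R) : probability (measurableTypeR R) R :=
  mnormalize (@density_measure _ (measurableTypeR R) R mu (beta_kernel a b)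
    (measurable_beta_kernel a b) (beta_kernel_ge0 a b)) (@dirac _ (measurableTypeR R) (2^-1 : R)%R
        R).

(** Lebesgue measure lives on [measurableTypeR R], the model on [R]. The identities [toR] and [ofR]
    transport measures between these two carriers. *)
Let toR : measurableTypeR R -> R := id.

Let measurable_toR : measurable_fun setT toR.
Proof. exact: measurable_id. Qed.

HB.instance Definition _ := isMeasurableFun.Build _ _ _ _ toR measurable_toR.

Definition beta_const (a b : R) : R := (Gamma (a + b) / (Gamma a * Gamma b))%R.

Lemma beta_const_gt0 (a b : R) : (0 < a)%R -> (0 < b)%R -> (0 < beta_const a b)%R.
Proof. by move=> a0 b0; rewrite divr_gt0 ?mulr_gt0 ?Gamma_gt0 ?addr_gt0. Qed.

Lemma betaP_sig (a b : R) : {P : probability R R | (0 < a)%R -> (0 < b)%R ->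
  forall A, measurable A -> P A = \int[mu]_(p in A) (beta_const a b * beta_kernel a b p)%:E}.
Proof.
exists (distribution (betaL a b) (toR : {RV (betaL a b) >-> R})) => a0 b0 A mA.
have ab0 := addr_gt0 a0 b0.
have ET : @density_measure _ (measurableTypeR R) R mu (beta_kernel a b)
    (measurable_beta_kernel a b) (beta_kernel_ge0 a b) setT = (Gamma a * Gamma b / Gamma (a +
        b))%:E.
  exact: integral_beta_kernel.
have c0 : (0 < Gamma a * Gamma b / Gamma (a + b))%R by rewrite !mulr_gt0 ?invr_gt0 ?Gamma_gt0.
rewrite [LHS](mnormalizeE _ _ c0 ET) invf_div -/(beta_const a b).
have mb : measurable_fun A (fun p : R => (beta_kernel a b p)%:E).
  by apply/measurable_EFinP/measurable_funTS; exact: measurable_beta_kernel.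
rewrite -[LHS](ge0_integralZl mu mA mb); last 2 first.
- by move=> p _; rewrite lee_fin beta_kernel_ge0.
- by rewrite lee_fin ltW// beta_const_gt0.
by apply: eq_integral => p _; rewrite EFinM.
Qed.

Definition betaP (a b : R) : probability R R := sval (betaP_sig a b).

Lemma betaPE (a b : R) A : (0 < a)%R -> (0 < b)%R -> measurable A ->
  betaP a b A = \int[mu]_(p in A) (beta_const a b * beta_kernel a b p)%:E.
Proof. by move=> a0 b0 mA; rewrite /betaP; case: betaP_sig => /= P ->. Qed.

Let ofR : R -> measurableTypeR R := id.

Let measurable_ofR : measurable_fun setT ofR.
Proof. exact: measurable_id. Qed.

HB.instance Definition _ := isMeasurableFun.Build _ _ _ _ ofR measurable_ofR.

Lemma betaP_density (a b : R) (A : set R) : (0 < a)%R -> (0 < b)%R -> measurable A ->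
  \int[mu]_(p in A `&` `]0%R, 1%R[) (beta_density a b p (1 - p))%:E = betaP a b A.
Proof.
move=> a0 b0 mA; rewrite betaPE// integral_mkcond [RHS]integral_mkcond.
apply: eq_integral => p _; rewrite !patchE in_setI mem_setE in_itv/= /beta_kernel /beta_density.
by case: (p \in A) => //=; case: ifP => // _; rewrite ?mulr0// mulrA.
Qed.

Lemma integral_betaP (a b : R) (f : R -> \bar R) : (0 < a)%R -> (0 < b)%R ->
  measurable_fun setT f -> (forall x, 0 <= f x) ->
  \int[betaP a b]_p f p =
  (beta_const a b)%:E * \int[mu]_p (f p * (beta_kernel a b p)%:E).
Proof.
move=> a0 b0 mf f0; have ab0 := addr_gt0 a0 b0.
have c0 := ltW (beta_const_gt0 a0 b0).
pose nu : probability (measurableTypeR R) R :=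
  distribution (betaP a b) (ofR : {RV (betaP a b) >-> measurableTypeR R}).
have mf' : measurable_fun [set: measurableTypeR R] f := mf.
have -> : \int[betaP a b]_p f p = \int[nu]_p f p.
  by rewrite (@ge0_integral_pushforward _ _ _ _ _ _ measurable_ofR (betaP a b) setT f)//; exact:
      measurableT.
have mg : measurable_fun [set: measurableTypeR R] (fun p : R => (beta_const a b * beta_kernel a b
    p)%R).
  by apply: measurable_funM => //; exact: measurable_beta_kernel.
have g0 (p : R) : (0 <= beta_const a b * beta_kernel a b p)%R.
  by rewrite mulr_ge0// beta_kernel_ge0.
have gE A : measurable A -> nu A = \int[mu]_(p in A) (beta_const a b * beta_kernel a b p)%:E.
  by move=> mA; exact: betaPE.
rewrite (@ge0_integral_density _ _ R mu nu _ f mg g0 gE mf' f0).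
have mh : measurable_fun [set: R] (fun p => f p * (beta_kernel a b p)%:E).
  apply: emeasurable_funM => //; apply/measurable_EFinP; exact: measurable_beta_kernel.
rewrite -[RHS](ge0_integralZl mu measurableT mh); last 2 first.
- by move=> p _; rewrite mule_ge0// lee_fin beta_kernel_ge0.
- by rewrite lee_fin.
by apply: eq_integral => p _; rewrite EFinM muleCA.
Qed.

End beta_probability.

Section beta_moments.
Context {R : realType}.
Local Notation mu := (@lebesgue_measure R).
Local Open Scope ereal_scope.

(* Conjugacy: the likelihood [p^i (1 - p)^j] turns [Beta(a, b)] into a multiple of [Beta(a + i, b + j)]. *)
Definition beta_weight (a b : R) (i j : nat) : R :=
  (beta_const a b / beta_const (a + i%:R) (b + j%:R))%R.

Lemma beta_weight_gt0 (a b : R) i j : (0 < a)%R -> (0 < b)%R -> (0 < beta_weight a b i j)%R.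
Proof.
move=> a0 b0; have ai : (0 < a + i%:R)%R by rewrite ltr_pwDl.
have bj : (0 < b + j%:R)%R by rewrite ltr_pwDl.
by rewrite divr_gt0// beta_const_gt0.
Qed.

(** The absolute values keep the likelihood factor nonnegative on the whole line; the kernel
    vanishes where they matter. *)
Lemma beta_kernelX (a b p : R) i j :
  (beta_kernel a b p * (`|p| ^+ i * `|1 - p| ^+ j) = beta_kernel (a + i%:R) (b + j%:R) p)%R.
Proof.
rewrite /beta_kernel; case: ifPn => [/andP[p0 p1]|_]; last by rewrite mul0r.
have q0 : (0 < 1 - p)%R by rewrite subr_gt0.
rewrite !ger0_norm ?(ltW p0) ?(ltW q0)// -!powR_mulrn ?(ltW p0) ?(ltW q0)//.
rewrite (_ : a + i%:R - 1 = a - 1 + i%:R)%R; last by ring.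
rewrite (_ : b + j%:R - 1 = b - 1 + j%:R)%R; last by ring.
by rewrite !gt0_powRD//; ring.
Qed.

Lemma integral_betaPX (a b : R) i j (f : R -> \bar R) : (0 < a)%R -> (0 < b)%R ->
  measurable_fun setT f -> (forall x, 0 <= f x) ->
  \int[betaP a b]_p ((`|p| ^+ i * `|1 - p| ^+ j)%:E * f p) =
  (beta_weight a b i j)%:E * \int[betaP (a + i%:R) (b + j%:R)]_p f p.
Proof.
move=> a0 b0 mf f0; have ai : (0 < a + i%:R)%R by rewrite ltr_pwDl.
have bj : (0 < b + j%:R)%R by rewrite ltr_pwDl.
have mX : measurable_fun [set: R] (fun p => (`|p| ^+ i * `|1 - p| ^+ j)%R).
  apply: measurable_funM; apply: measurable_funX.
    exact: normr_measurable.
  by apply: measurableT_comp => //; exact: measurable_funB.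
have mF : measurable_fun [set: R] (fun p => (`|p| ^+ i * `|1 - p| ^+ j)%:E * f p).
  by apply: emeasurable_funM => //; exact/measurable_EFinP.
have F0 p : 0 <= (`|p| ^+ i * `|1 - p| ^+ j)%:E * f p.
  by rewrite mule_ge0// lee_fin mulr_ge0 ?exprn_ge0.
rewrite (integral_betaP a0 b0 mF F0) (integral_betaP ai bj mf f0) muleA -EFinM.
congr (_ * _).
  congr EFin; by rewrite /beta_weight divfK// gt_eqF// beta_const_gt0.
apply: eq_integral => p _; rewrite -beta_kernelX muleAC -EFinM muleC.
by congr (_ * _%:E); exact: mulrC.
Qed.

Lemma beta_weight10 (a b : R) : (0 < a)%R -> (0 < b)%R -> beta_weight a b 1 0 = (a / (a + b))%R.
Proof.
move=> a0 b0; have ab := addr_gt0 a0 b0.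
rewrite /beta_weight /beta_const addr0 (_ : a + 1 + b = a + b + 1)%R; last by ring.
rewrite !GammaD1//.
move: (Gamma a) (Gamma b) (Gamma (a + b)) (Gamma_gt0 a0) (Gamma_gt0 b0) (Gamma_gt0 ab) => x y z x0
    y0 z0.
by field; rewrite !gt_eqF.
Qed.

Lemma integral_betaP1 (a b : R) : (0 < a)%R -> (0 < b)%R ->
  \int[betaP a b]_p (`|p|)%:E = (a / (a + b))%:E.
Proof.
move=> a0 b0; rewrite -beta_weight10//.
have := @integral_betaPX a b 1 0 (cst 1) a0 b0 (measurable_cst _) (fun=> lee01).
rewrite [X in _ = _ * X -> _]integral_probability_cst mule1 => <-.
by apply: eq_integral => p _; rewrite mule1 expr1 expr0 mulr1.
Qed.

Lemma integral_betaP2 (a b : R) : (0 < a)%R -> (0 < b)%R ->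
  \int[betaP a b]_p (p ^+ 2)%:E = (a / (a + b) * ((a + 1) / (a + b + 1)))%:E.
Proof.
move=> a0 b0; have m1 : measurable_fun [set: R] (fun p : R => `|p|%:E).
  by apply/measurable_EFinP; exact: normr_measurable.
have := @integral_betaPX a b 1 0 (fun p => `|p|%:E) a0 b0 m1 (fun p => normr_ge0 p).
have a1 : (0 < a + 1)%R by rewrite addr_gt0.
rewrite addr0 (integral_betaP1 a1 b0) (beta_weight10 a0 b0) -EFinM.
rewrite (_ : a + 1 + b = a + b + 1)%R; last by ring.
move=> <-; apply: eq_integral => p _.
by rewrite expr1 expr0 mulr1 -EFinM -normrM -expr2 ger0_norm ?sqr_ge0.
Qed.

Lemma betaP_support (a b : R) : (0 < a)%R -> (0 < b)%R -> betaP a b (~` `]0%R, 1%R[%classic) = 0.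
Proof.
move=> a0 b0; rewrite betaPE//; last by apply: measurableC.
apply: integral0_eq => p /=; rewrite in_itv/= => /negP p01.
by rewrite /beta_kernel (negbTE p01) mulr0.
Qed.

(** Squared bias plus variance; the variance [a b / ((a + b)^2 (a + b + 1))] is at most
    [1 / (a + b)]. *)
Lemma integral_betaP_sqr (a b q : R) : (0 < a)%R -> (0 < b)%R -> (0 <= q)%R ->
  \int[betaP a b]_p ((p - q) ^+ 2)%:E <= ((a / (a + b) - q) ^+ 2 + (a + b)^-1)%:E.
Proof.
move=> a0 b0 q0; have ab := addr_gt0 a0 b0.
have m1 : measurable_fun [set: R] (fun p : R => `|p|%R) by exact: normr_measurable.
have m2 : measurable_fun [set: R] (fun p : R => (p - q) ^+ 2)%R.
  by apply: measurable_funX; exact: measurable_funB.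
have m3 : measurable_fun [set: R] (fun p : R => p ^+ 2)%R by exact: measurable_funX.
(* The cross term is moved to the left and written with [|p|], which is [p] almost surely, so that
   all integrands are nonnegative and additivity applies without integrability conditions. *)
have H : \int[betaP a b]_p ((p - q) ^+ 2)%:E + (2 * q)%:E * \int[betaP a b]_p (`|p|)%:E =
    \int[betaP a b]_p (p ^+ 2)%:E + (q ^+ 2)%:E.
  rewrite -ge0_integralZl//=; last 2 first.
  - exact/measurable_EFinP.
  - by rewrite lee_fin mulr_ge0.
  rewrite -[X in _ = _ + X](integral_probability_cst (betaP a b)).
  rewrite -!ge0_integralD//=; last 7 first.
  - by move=> p _; rewrite lee_fin sqr_ge0.
  - exact/measurable_EFinP.
  - by move=> p _; rewrite lee_fin sqr_ge0.
  - by move=> p _; rewrite lee_fin sqr_ge0.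
  - exact/measurable_EFinP.
  - by move=> p _; rewrite -EFinM lee_fin !mulr_ge0.
  - by apply/measurable_EFinP; apply: measurable_funM.
  apply: ae_eq_integral => //.
  - apply: emeasurable_funD; first exact/measurable_EFinP.
    by apply: emeasurable_funM => //; exact/measurable_EFinP.
  - by apply: emeasurable_funD => //; exact/measurable_EFinP.
  exists (~` `]0%R, 1%R[%classic); split => //; [exact: measurableC|exact: betaP_support|].
  move=> p /= h; apply: contra_not h => /=; rewrite in_itv/= => /andP[p0 p1] _.
  by rewrite -!EFinM -!EFinD; congr EFin; rewrite ger0_norm ?ltW//; ring.
have : \int[betaP a b]_p ((p - q) ^+ 2)%:E = (a / (a + b) * ((a + 1) / (a + b + 1)) + q ^+ 2 - 2 *
    q * (a / (a + b)))%:E.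
  move: H; rewrite integral_betaP1// integral_betaP2// => H.
  have -> : \int[betaP a b]_p ((p - q) ^+ 2)%:E = \int[betaP a b]_p ((p - q) ^+ 2)%:E + (2 * q * (a
      / (a + b)))%:E - (2 * q * (a / (a + b)))%:E by rewrite addeK.
  by rewrite [(2 * q * _)%:E in X in X - _]EFinM H.
move=> ->; rewrite lee_fin -subr_ge0.
have -> : ((a / (a + b) - q) ^+ 2 + (a + b)^-1 - (a / (a + b) * ((a + 1) / (a + b + 1)) + q ^+ 2 -
    2 * q * (a / (a + b))) =
  (a * a + b * a + b * b + a + b)/ ((a + b) ^+ 2 * (a + b + 1)))%R.
  field.
  by rewrite !gt_eqF ?addr_gt0.
by rewrite divr_ge0// ?mulr_ge0 ?addr_ge0 ?mulr_ge0 ?exprn_ge0 ?(ltW a0) ?(ltW b0) ?addr_ge0 ?(ltW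
    a0) ?(ltW b0).
Qed.

End beta_moments.

(** * A strong law for cell frequencies *)

Section indicator_slln.
Context (R : realType) d (T : measurableType d) d' (Omega : measurableType d').
Variables (P : probability Omega R) (Q : probability T R) (X : nat -> {RV P >-> T}).
Hypothesis hX : iid Q X.
Variables (A : set T) (mA : measurable A).

Let p : R := fine (Q A).

Let QA : Q A = p%:E.
Proof. by rewrite /p fineK// fin_num_measure. Qed.

Let QAC : Q (~` A) = (1 - p)%:E.
Proof. by rewrite probability_setC// QA. Qed.

Let p0 : 0 <= p.
Proof. by rewrite -lee_fin -QA. Qed.

Let p1 : p <= 1.
Proof. by rewrite -lee_fin -QA probability_le1. Qed.

Lemma iid_prob n (B : nat -> set T) : (forall i, measurable (B i)) ->
  P (\bigcap_(i < n) (X i @^-1` B i)) = (\prod_(i < n) Q (B i))%E.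
Proof.
by move=> mB; have [h1 h2] := hX; rewrite h2//; apply: eq_bigr => i _; exact: (h1 i _ (mB i)).
Qed.

(** Independence is given for intersections of events. The product is therefore expanded over all
    patterns of hits and misses, each pattern being such an intersection, and the probabilities are
    summed up again by distributivity. *)
Lemma expectation_prod_two_valued (a b : R) n : 0 <= a -> 0 <= b ->
  (\int[P]_w (\prod_(i < n) (if X i w \in A then a else b))%:E = ((p * a + (1 - p) * b) ^+ n)%:E)%E.
Proof.
move=> a0 b0.
pose S (j : bool) := if j then A else ~` A.
pose c (j : bool) : R := if j then a else b.
pose pr (j : bool) : R := if j then p else 1 - p.
have mS j : measurable (S j) by case: j => //=; exact: measurableC.
(* [iid_prob] needs a sequence of events over all natural numbers; the default [true] only fills the
   indices from [n] on. *)
pose E (f : {ffun 'I_n -> bool}) := \bigcap_(i < n) (X i @^-1` S (nth true (fgraph f) i)).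
have mE f : measurable (E f).
  apply: bigcap_measurableType => i _; rewrite -[X in measurable X]setTI.
  exact: (measurable_funP (X i)).
have nthE (f : {ffun 'I_n -> bool}) (i : 'I_n) : nth true (fgraph f) i = f i.
  have := @tnth_fgraph _ _ f (cast_ord (esym (card_ord n)) i).
  rewrite (tnth_nth true) /= => ->; congr (f _).
  by apply: val_inj; rewrite /= enum_val_ord.
have H w : \prod_(i < n) (if X i w \in A then a else b) =
    \sum_(f : {ffun 'I_n -> bool}) (\prod_(i < n) c (f i)) * \1_(E f) w.
  have -> : \prod_(i < n) (if X i w \in A then a else b) =
      \prod_(i < n) \sum_(j : bool) (c j * \1_(S j) (X i w)).
    apply: eq_bigr => i _; rewrite big_bool/= !indicE in_setC.
    by case: (X i w \in A); rewrite !(mulr1, mulr0, addr0, add0r).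
  rewrite bigA_distr_bigA; apply: eq_bigr => f _; rewrite big_split/=; congr (_ * _).
  rewrite indicE; have [wE|wE] := boolP (w \in E f).
    rewrite big1// => i _; rewrite indicE mem_set//.
    by move: wE => /set_mem /(_ i (ltn_ord i)); rewrite /= nthE.
  suff [i wi] : exists i : 'I_n, ~ S (f i) (X i w).
    by rewrite (bigD1 i)//= indicE memNset ?mul0r.
  apply: contrapT => h; move/negP: wE; apply; apply/mem_set => i /= ni.
  by apply: contrapT => si; apply: h; exists (Ordinal ni); rewrite -nthE.
under eq_integral do rewrite H -sumEFin.
rewrite ge0_integral_sum//; last 2 first.
- move=> f; apply/measurable_EFinP; apply: measurable_funM => //.
- by move=> f w _; rewrite lee_fin mulr_ge0// prodr_ge0// => i _; case: (f i).
have -> : ((p * a + (1 - p) * b) ^+ n)%:E =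
   (\sum_(f : {ffun 'I_n -> bool}) (\prod_(i < n) (c (f i) * pr (f i)))%:E)%E.
  rewrite sumEFin -(bigA_distr_bigA (fun (i : 'I_n) j => c j * pr j)).
  under [in RHS]eq_bigr do rewrite big_bool/=.
  by rewrite prodr_const card_ord; congr ((_ ^+ _)%:E); rewrite mulrC [b * _]mulrC.
apply: eq_bigr => f _.
under eq_integral do rewrite EFinM.
rewrite ge0_integralZl//; last 2 first.
- by apply/measurable_EFinP.
- by rewrite lee_fin prodr_ge0// => i _; case: (f i).
have PE : P (E f) = (\prod_(i < n) Q (S (nth true (fgraph f) i)))%E := iid_prob n (fun i => mS (nth
    true (fgraph f) i)).
have -> : (\int[P]_x (\1_(E f) x)%:E = P (E f))%E by rewrite integral_indic// setIT.
rewrite PE.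
rewrite big_split EFinM; congr (_ * _)%E; rewrite -prodEFin.
by apply: eq_bigr => i _; rewrite nthE; case: (f i).
Qed.

(* Chernoff's bound, summable in [n], followed by Borel-Cantelli. *)
Lemma ae_count_lt (e : R) : 0 < e ->
  {ae P, forall w, exists N, forall n, (N <= n)%N ->
    (count (fun x => x \in A) (data X n w))%:R <= (p + e) * n%:R}.
Proof.
move=> e0.
(* Chosen such that [(p + e) * l], the second-order error in the exponent, is at most [e / 2]. *)
pose l : R := e / (2 * (1 + e)).
have l0 : 0 < l by rewrite divr_gt0// mulr_gt0// addr_gt0.
have lE : (1 + e) * l = e / 2 by rewrite /l; field; rewrite gt_eqF// addr_gt0.
have l1 : l < 1 by rewrite /l ltr_pdivrMr ?mulr_gt0 ?addr_gt0//; lra.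
(* The two values, on and off [A], of the exponential of [l] times the centred indicator; [r] below
   is its mean, and [r < 1] makes the tail bounds summable. *)
pose a := expR (l * (1 - p - e)); pose b := expR (- (l * (p + e))).
pose r := p * a + (1 - p) * b.
have r0 : 0 <= r by rewrite addr_ge0// mulr_ge0 ?expR_ge0 ?subr_ge0.
have r1 : r < 1.
  have -> : r = b * (1 + p * (expR l - 1)).
    rewrite /r /a (_ : l * (1 - p - e) = - (l * (p + e)) + l); last by ring.
    by rewrite expRD -/b; ring.
  have h1 : 1 + p * (expR l - 1) <= expR (p * (expR l - 1)) by exact: expR_ge1Dx.
  apply: (@le_lt_trans _ _ (b * expR (p * (expR l - 1)))); first by rewrite ler_wpM2l ?expR_ge0.
  rewrite -expRD -[ltRHS]expR0 ltr_expR.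
  have h2 : expR l <= (1 - l)^-1.
    rewrite -[expR l]invrK -expRN lef_pV2 ?posrE ?expR_gt0 ?subr_gt0//.
    exact: expR_ge1Dx.
  have h3 : expR l - 1 <= l / (1 - l).
    apply: le_trans (lerB h2 (lexx 1)) _; rewrite le_eqVlt; apply/orP; left; apply/eqP.
    by field; rewrite gt_eqF// subr_gt0.
  apply: (@le_lt_trans _ _ (- (l * (p + e)) + p * (l / (1 - l)))).
    by rewrite lerD2l ler_wpM2l.
  have -> : - (l * (p + e)) + p * (l / (1 - l)) = - (l * (e - (p + e) * l) / (1 - l)).
    by field; rewrite gt_eqF// subr_gt0.
  rewrite oppr_lt0 divr_gt0 ?subr_gt0// mulr_gt0//.
  have : (p + e) * l <= (1 + e) * l by rewrite ler_wpM2r ?(ltW l0)// lerD2r.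
  rewrite lE; lra.
pose Z n (w : Omega) : R := \prod_(i < n) (if X i w \in A then a else b).
have mXA i : measurable (X i @^-1` A).
  by rewrite -[X in measurable X]setTI; exact: (measurable_funP (X i)).
have mZ n : measurable_fun setT (Z n).
  apply: measurable_prod => i _; apply: measurable_fun_ifT => //.
  apply: (measurable_fun_bool true); rewrite setTI.
  rewrite [X in measurable X](_ : _ = X i @^-1` A)//.
  by apply/seteqP; split => w /=; [move/set_mem|move/mem_set].
have ZE n w : Z n w = expR (l * ((count (fun x => x \in A) (data X n w))%:R - (p + e) * n%:R)).
  rewrite /Z /data; elim: n => [|n ih]; first by rewrite big_ord0 /= !(mulr0, subr0) expR0.
  have -> : iota 0 n.+1 = iota 0 n ++ [:: n] by rewrite -[n.+1]addn1 iotaD.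
  rewrite big_ord_recr ih map_cat count_cat natrD /= addn0.
  case: (X n w \in A); rewrite /= -expRD -addn1 natrD; congr expR; ring.
pose F n := [set w | 1 <= Z n w].
have mF n : measurable (F n).
  rewrite -[X in measurable X]setTI.
  by apply: measurable_fun_le.
have PF n : (P (F n) <= (r ^+ n)%:E)%E.
  rewrite -expectation_prod_two_valued ?expR_ge0// -(setIT (F n)) -integral_indic//.
  apply: ge0_le_integral => //.
  - by apply/measurable_EFinP.
  - by apply/measurable_EFinP; exact: mZ.
  - move=> w _; rewrite lee_fin indicE; have [/set_mem|_] := boolP (w \in F n) => //.
    by rewrite /= prodr_ge0// => i _; case: ifP; rewrite expR_ge0.
have F0 : P (lim_sup_set F) = 0.
  apply: lim_sup_set_cvg0 => //.
  apply: (@le_lt_trans _ _ (\sum_(n <oo) (r ^+ n)%:E)%E).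
    by apply: lee_nneseries => [n _ _|n _]; [exact: measure_ge0|exact: PF].
  have := @cvg_geometric_series R 1 r; rewrite ger0_norm// => /(_ r1) cv.
  rewrite (_ : (\sum_(n <oo) (r ^+ n)%:E)%E = (1 * (1 - r)^-1)%:E) ?ltry//.
  apply/cvg_lim => //; rewrite (_ : (fun n => _) = EFin \o series (geometric 1 r)).
    by apply: cvg_EFin => //; exact: nearW.
  by apply/funext => n; rewrite /series/= sumEFin; under [in RHS]eq_bigr do rewrite mul1r.
exists (lim_sup_set F); split => //.
  apply: bigcapT_measurable => k; exact: bigcup_measurable.
move=> w /= nw n _ /=; apply: contrapT => h; apply: nw; exists n => k nk.
rewrite leNgt; apply/negP => hk; apply: h; exists k => //=.
rewrite /F/= ZE -[leLHS]expR0 ler_expR mulr_ge0// ?(ltW l0)// subr_ge0 ltW//.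
Qed.

End indicator_slln.

(** An upper bound for the complement of [A] is a lower bound for [A], and the countably many
    tolerances [1 / (k + 1)] suffice. *)
Lemma ae_frequency (R : realType) d (T : measurableType d) d' (Omega : measurableType d')
    (P : probability Omega R) (Q : probability T R) (X : nat -> {RV P >-> T}) (A : set T) :
  iid Q X -> measurable A ->
  {ae P, forall w, forall e : R, 0 < e -> exists N, forall n, (N <= n)%N ->
    `|(count (fun x => x \in A) (data X n w))%:R - fine (Q A) * n%:R| <= e * n%:R}.
Proof.
move=> hX mA.
have mAC := measurableC mA.
have QAC : fine (Q (~` A)) = 1 - fine (Q A).
  by rewrite probability_setC// fineB// fin_num_measure.
have H k : {ae P, forall w, exists N, forall n, (N <= n)%N ->
    `|(count (fun x => x \in A) (data X n w))%:R - fine (Q A) * n%:R| <= k.+1%:R^-1 * n%:R :> R}.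
  have k0 : 0 < k.+1%:R^-1 :> R by rewrite invr_gt0.
  have H1 := ae_count_lt hX mA k0; have H2 := ae_count_lt hX mAC k0.
  apply: filterS2 H1 H2 => w [N1 h1] [N2 h2]; exists (maxn N1 N2) => n.
  rewrite geq_max => /andP[/h1 {}h1 /h2 {}h2].
  have E : (count (fun x => x \in ~` A) (data X n w))%:R = n%:R - (count (fun x => x \in A) (data X
      n w))%:R :> R.
    have -> : count (fun x => x \in ~` A) (data X n w) = count (predC (fun x => x \in A)) (data X n
        w).
      by apply: eq_count => x /=; rewrite in_setC.
    have := count_predC (fun x => x \in A) (data X n w).
    rewrite size_map size_iota => {2}<-.
    by rewrite natrD addrC addKr.
  move: h2; rewrite E QAC mulrDl mulrBl mul1r => h2.
  move: h1; rewrite mulrDl => h1.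
  have lem (x y t v : R) : x <= y + t -> v - x <= v - y + t -> `|x - y| <= t.
    by move=> ? ?; rewrite ler_norml; apply/andP; split; lra.
  exact: lem h1 h2.
apply: filterS (ae_foralln H) => w h e e0.
have [k ke] : exists k, k.+1%:R^-1 <= e.
  exists (Num.truncn e^-1); rewrite -[leRHS]invrK lef_pV2 ?posrE ?invr_gt0//.
  by rewrite ltW// truncnS_gt.
have [N hN] := h k; exists N => n /hN hn.
by apply: le_trans hn _; rewrite ler_wpM2r.
Qed.

(** * Trees of branching probabilities *)

Section branching_theory.
Context (R : realType).
Implicit Types (z w : seq bool) (m : nat).

Definition is_index z m w : bool := prefix z w && (size z < size w <= m)%N.

Lemma lookupE z m (q : tree_index z m -> R) (w : tree_index z m) : lookup q (val w) = q w.
Proof. by rewrite /lookup valK. Qed.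

Lemma lookup_default z m (q : tree_index z m -> R) w : ~~ is_index z m w -> lookup q w = 0.
Proof. by move=> nw; rewrite /lookup insubN. Qed.

Lemma eq_branching z m (q q' : branching R z m) :
  (forall w, is_index z m w -> lookup q w = lookup q' w) -> q = q'.
Proof. by move=> h; apply/funext => w; rewrite -!lookupE; apply: h; exact: (valP w). Qed.

Lemma branching_leaf z (q q' : branching R z (size z)) : q = q'.
Proof. by apply: eq_branching => w /andP[_ /andP[]] /leq_trans/[apply]; rewrite ltnn. Qed.

Lemma lookup_half z m w : is_index z m w -> lookup (@half_tree R z m) w = 2^-1.
Proof. by move=> iw; rewrite /lookup insubT. Qed.

Lemma lookup_restrict z m m' (q : branching R z m) w :
  is_index z m' w -> lookup (restrict_tree m' q) w = lookup q w.
Proof. by move=> iw; rewrite [LHS]/lookup insubT. Qed.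

Lemma restrict_half z m m' : (m' <= m)%N -> restrict_tree m' (@half_tree R z m) = half_tree.
Proof.
move=> mm; apply: eq_branching => w iw; rewrite lookup_restrict// !lookup_half//.
by move: iw; rewrite /is_index => /and3P[-> -> /leq_trans ->].
Qed.

Lemma is_index_rcons z m b : (size z < m)%N -> is_index z m (rcons z b).
Proof. by move=> zm; rewrite /is_index prefix_rcons size_rcons ltnSn. Qed.

Lemma prefix_rcons_neq z (b c : bool) w : prefix (rcons z b) w -> prefix (rcons z c) w -> b = c.
Proof.
by move=> /prefixP[x ->] /prefixP[y]; rewrite !cat_rcons => /eqP; rewrite eqseq_cat// eqxx/=
    eqseq_cons => /andP[/eqP].
Qed.

Lemma prefix_cases z w : prefix z w -> (size z < size w)%N ->
  exists b, prefix (rcons z b) w.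
Proof.
move=> /prefixP[[|b s] ->]; first by rewrite cats0 ltnn.
by exists b; rewrite -cat_rcons prefix_prefix.
Qed.

Lemma lookup_node_child z m t b : (size z < m)%N ->
  lookup (@node R z m t) (rcons z b) = if b then t.1.2 else t.1.1.
Proof.
move=> zm; rewrite /lookup insubT /=; first exact: is_index_rcons.
move=> iw; rewrite /node/= insubN; last by rewrite !size_rcons ltnn andbF.
rewrite insubN; last by rewrite !size_rcons ltnn andbF.
by case: b iw => // _; rewrite eqseq_rcons eqxx.
Qed.

Lemma lookup_node_desc z m t (b : bool) w : prefix (rcons z b) w -> (size (rcons z b) < size w)%N ->
  lookup (@node R z m t) w = (if b then lookup t.2.2 w else lookup t.2.1 w).
Proof.
move=> pw sw; have pz : prefix z w by apply: prefix_trans pw; exact: prefix_rcons.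
have sz : (size z < size w)%N by rewrite (ltn_trans _ sw)// size_rcons.
have [wm|wm] := leqP (size w) m; last first.
  have -> : lookup (node t) w = 0 by apply: lookup_default; rewrite /is_index (leqNgt _ m) wm
      !andbF.
  by case: b {pw sw} => //; rewrite lookup_default// /is_index (leqNgt _ m) wm !andbF.
rewrite {1}/lookup insubT; first by rewrite pz sz wm.
move=> iw; rewrite /node/=; case: b pw sw => pw sw.
- rewrite insubN; first by rewrite /lookup insubT// pw sw wm.
  by apply/negP => /andP[/prefix_rcons_neq /(_ pw)].
- by rewrite /lookup insubT// pw sw wm.
Qed.

Lemma restrict_node z m m' t : (size z < m')%N -> (m' <= m)%N ->
  restrict_tree m' (@node R z m t) =
  node (t.1, (restrict_tree m' t.2.1, restrict_tree m' t.2.2)).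
Proof.
move=> zm mm; apply: eq_branching => w iw; rewrite lookup_restrict//.
have /andP[pz /andP[sz wm]] := iw.
have [b pb] := prefix_cases pz sz.
have [sb|sb] := ltnP (size (rcons z b)) (size w).
  rewrite !(lookup_node_desc _ pb sb)/=; case: b pb sb => pb sb.
    by rewrite lookup_restrict// /is_index pb sb wm.
  by rewrite lookup_restrict// /is_index pb sb wm.
have -> : w = rcons z b.
  have /prefixP[[|c r] e] := pb; first by rewrite cats0 in e.
  by move: sb; rewrite e size_cat/= addnS ltnNge leq_addr.
by rewrite !lookup_node_child// (leq_trans zm).
Qed.

Lemma measurable_coord z m (w : tree_index z m) :
  measurable_fun setT (fun q : branching R z m => q w).
Proof.
move=> _ B mB; rewrite setTI; apply: sub_sigma_algebra.
by exists w, B.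
Qed.

Lemma measurable_branching d (T : measurableType d) z m (f : T -> branching R z m) :
  (forall w : tree_index z m, measurable_fun setT (fun t => f t w)) -> measurable_fun setT f.
Proof.
move=> mf; apply: (@measurability _ _ T (branching R z m) setT f (@cylinders R z m) erefl).
move=> _ [_ [w [B [mB ->]]] <-]; exact: (mf w measurableT B mB).
Qed.

Lemma measurable_lookup z m w : measurable_fun setT (fun q : branching R z m => lookup q w).
Proof.
have [iw|iw] := boolP (is_index z m w); last first.
  rewrite (_ : (fun q => _) = cst 0) //; apply/funext => q; exact: lookup_default.
rewrite (_ : (fun q => _) = (fun q : branching R z m => q (Sub w iw))).
  exact: measurable_coord.
by apply/funext => q; rewrite -lookupE SubK.
Qed.

Lemma measurable_restrict z m m' : measurable_fun setT (@restrict_tree R z m m').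
Proof. by apply: measurable_branching => w; exact: measurable_lookup. Qed.

Lemma measurable_node z m : measurable_fun setT (@node R z m).
Proof.
apply: measurable_branching => w; rewrite /node.
have mc b (w' : tree_index (rcons z b) m) :
    measurable_fun setT (fun q : branching R (rcons z b) m => q w') := measurable_coord w'.
case: insubP => [w0 _ _|_].
  exact: (measurableT_comp (mc false w0) (measurableT_comp measurable_fst measurable_snd)).
case: insubP => [w1 _ _|_].
  exact: (measurableT_comp (mc true w1) (measurableT_comp measurable_snd measurable_snd)).
case: (val w == rcons z false).
  exact: (measurableT_comp measurable_fst measurable_fst).
exact: (measurableT_comp measurable_snd measurable_fst).
Qed.

Lemma index_catP z w m : is_index z m w ->
  exists t b, [/\ w = z ++ rcons t b, (size (z ++ t) < m)%N & take (size w).-1 w = z ++ t].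
Proof.
move=> /and3P[/prefixP[t ->] zt tm]; case/lastP: t zt tm => [|t b] zt tm; first by rewrite cats0
    ltnn in zt.
exists t, b; split=> //; first by rewrite -rcons_cat size_rcons in tm.
by rewrite -rcons_cat size_rcons/= -cats1 take_cat ltnn subnn take0 cats0.
Qed.

End branching_theory.

(** * Product measures and the law of a tree *)

Section product_congruence.
Context d1 d2 (T1 : measurableType d1) (T2 : measurableType d2) (R : realType).
Local Open Scope ereal_scope.

(** [prior_rec] forms products of plain set functions; only their values on events are under
    control. *)
Lemma eq_product_measure1 (m1 m1' : set T1 -> \bar R) (m2 m2' : set T2 -> \bar R) A :
  (forall B, measurable B -> m1 B = m1' B) ->
  (forall B, measurable B -> m2 B = m2' B) ->
  measurable A -> (m1 \x m2) A = (m1' \x m2') A.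
Proof.
move=> h1 h2 mA; rewrite /product_measure1 (eq_set_integral _ _ h1).
congr (integral _ _ _); apply/funext => x /=; apply: h2; exact: measurable_xsection.
Qed.

Lemma product_probability_sig (P1 : probability T1 R) (P2 : probability T2 R) :
  {M : probability (T1 * T2)%type R |
    (forall A, M A = (P1 \x P2) A) /\
    forall f : T1 * T2 -> \bar R, measurable_fun setT f -> (forall x, 0 <= f x) ->
    \int[M]_x f x = \int[P1]_x \int[P2]_y f (x, y)}.
Proof.
exists (P1 \x P2); split=> // f mf f0; exact: fubini_tonelli1.
Qed.

Definition product_probability (P1 : probability T1 R) (P2 : probability T2 R) :
  probability (T1 * T2)%type R := sval (product_probability_sig P1 P2).

Lemma product_probabilityE (P1 : probability T1 R) (P2 : probability T2 R) A :
  product_probability P1 P2 A = (P1 \x P2) A.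
Proof. by rewrite /product_probability; case: product_probability_sig => /= M []. Qed.

Lemma integral_product_probability (P1 : probability T1 R) (P2 : probability T2 R)
    (f : T1 * T2 -> \bar R) : measurable_fun setT f -> (forall x, 0 <= f x) ->
  \int[product_probability P1 P2]_x f x = \int[P1]_x \int[P2]_y f (x, y).
Proof.
by rewrite /product_probability; case: product_probability_sig => /= M [_ h]; exact: h.
Qed.

Lemma measurable_integral_snd (P2 : probability T2 R) (f : T1 * T2 -> \bar R) :
  measurable_fun setT f -> (forall x, 0 <= f x) ->
  measurable_fun setT (fun x => \int[P2]_y f (x, y)).
Proof. by move=> mf f0; exact: measurable_fun_fubini_tonelli_F. Qed.

End product_congruence.

Section branch_measure.
Context (R : realType) (z : seq bool) (m : nat).
Local Open Scope ereal_scope.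

Let pairp (p : R) : R * R := (p, 1 - p)%R.

Let mpairp : measurable_fun setT pairp.
Proof. apply: measurable_fun_pair => //; exact: measurable_funB. Qed.

HB.instance Definition _ := isMeasurableFun.Build _ _ _ _ pairp mpairp.

HB.instance Definition _ := isMeasurableFun.Build _ _ _ _ (@node R z m) (@measurable_node R z m).

Definition beta2 (a b : R) : probability (R * R)%type R :=
  distribution (betaP a b) (pairp : {RV betaP a b >-> (R * R)%type}).

Lemma Beta_beta2 (a b : R) A : (0 < a)%R -> (0 < b)%R -> measurable A ->
  Beta a b A = beta2 a b A.
Proof.
move=> a0 b0 mA; rewrite /Beta /pushforward; apply: betaP_density => //.
by rewrite -[X in measurable X]setTI; exact: mpairp.
Qed.

Definition node_measure (a b : R) (n0 : probability (branching R (rcons z false) m) R)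
  (n1 : probability (branching R (rcons z true) m) R) : probability (branching R z m) R :=
  distribution (product_probability (beta2 a b) (product_probability n0 n1))
    (@node R z m : {RV product_probability (beta2 a b) (product_probability n0 n1) >-> branching R
        z m}).

Lemma measurable_node_pair (f : branching R z m -> \bar R) : measurable_fun setT f ->
  measurable_fun setT (fun x : R * (branching R (rcons z false) m * branching R (rcons z true) m) =>
    f (node ((x.1, 1 - x.1)%R, x.2))).
Proof.
move=> mf; apply: (measurableT_comp mf); apply: (measurableT_comp (@measurable_node R z m)).
apply: measurable_fun_pair => //; apply: measurable_fun_pair => //.
exact: measurable_funB.
Qed.

Lemma measurable_node_triple (f : branching R z m -> \bar R) : measurable_fun setT f ->
  measurable_fun setT (fun x : (R * branching R (rcons z false) m) * branching R (rcons z true) m =>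
    f (node ((x.1.1, 1 - x.1.1)%R, (x.1.2, x.2)))).
Proof.
move=> mf; apply: (measurableT_comp mf); apply: (measurableT_comp (@measurable_node R z m)).
have m11 : measurable_fun setT (fun x : (R * branching R (rcons z false) m) * branching R (rcons z
    true) m => x.1.1).
  exact: (measurableT_comp measurable_fst measurable_fst).
apply: measurable_fun_pair; apply: measurable_fun_pair => //.
  exact: measurable_funB.
exact: (measurableT_comp measurable_snd measurable_fst).
Qed.

Lemma integral_node_measure a b n0 n1 (f : branching R z m -> \bar R) :
  measurable_fun setT f -> (forall q, 0 <= f q) ->
  \int[node_measure a b n0 n1]_q f q =
  \int[betaP a b]_p \int[n0]_q0 \int[n1]_q1 f (node ((p, 1 - p)%R, (q0, q1))).
Proof.
move=> mf f0.
rewrite (@ge0_integral_pushforward _ _ _ _ _ _ (@measurable_node R z m)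
  (product_probability (beta2 a b) (product_probability n0 n1)) setT f)//.
rewrite preimage_setT.
have mfn : measurable_fun setT (f \o @node R z m) := measurableT_comp mf (@measurable_node R z m).
rewrite integral_product_probability//; last by move=> x; exact: f0.
rewrite (@ge0_integral_pushforward _ _ _ _ _ _ mpairp (betaP a b) setT)//; last 2 first.
- apply: (@measurable_integral_snd _ _ _ _ R (product_probability n0 n1) _ mfn) => x; exact: f0.
- by move=> x _; apply: integral_ge0 => y _; exact: f0.
rewrite preimage_setT; apply: eq_integral => p _ /=.
rewrite integral_product_probability//.
exact: (measurableT_comp (measurable_node_pair mf) (pair1_measurable p)).
Qed.

(** One level of the recursion: the formula on events identifies the prior, the formula for
    integrals serves all later computations. *)
Lemma branch_sig (g a b : R) (n0 : probability (branching R (rcons z false) m) R)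
    (n1 : probability (branching R (rcons z true) m) R) :
  {M : probability (branching R z m) R | (0 <= g <= 1)%R ->
    (forall A, measurable A -> M A = g%:E * \d_(half_tree : branching R z m) A +
      (1 - g)%:E * pushforward (beta2 a b \x (n0 \x n1)) node A) /\
    forall f : branching R z m -> \bar R, measurable_fun setT f -> (forall q, 0 <= f q) ->
    \int[M]_q f q = g%:E * f half_tree +
      (1 - g)%:E * \int[betaP a b]_p \int[n0]_q0 \int[n1]_q1 f (node ((p, 1 - p)%R, (q0, q1)))}.
Proof.
exists (mixture g (dirac (half_tree : branching R z m)) (node_measure a b n0 n1)) => g01; split.
  move=> A mA; rewrite mixtureE//; congr (_ + _ * _).
  rewrite [LHS]product_probabilityE; apply: eq_product_measure1 => //.
    by move=> B mB; exact: product_probabilityE.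
  by rewrite -[X in measurable X]setTI; exact: measurable_node.
move=> f mf f0; rewrite integral_mixture// integral_node_measure//.
by rewrite integral_dirac// diracT mul1e.
Qed.

Definition branch (g a b : R) n0 n1 := sval (branch_sig g a b n0 n1).

Lemma branchE (g a b : R) n0 n1 A : (0 <= g <= 1)%R -> measurable A ->
  branch g a b n0 n1 A = g%:E * \d_(half_tree : branching R z m) A + (1 - g)%:E * pushforward
      (beta2 a b \x (n0 \x n1)) node A.
Proof. by move=> g01; rewrite /branch; case: branch_sig => /= M /(_ g01)[h _]; exact: h. Qed.

Lemma integral_branch (g a b : R) n0 n1 (f : branching R z m -> \bar R) : (0 <= g <= 1)%R ->
  measurable_fun setT f -> (forall q, 0 <= f q) ->
  \int[branch g a b n0 n1]_q f q = g%:E * f half_tree +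
      (1 - g)%:E * \int[betaP a b]_p \int[n0]_q0 \int[n1]_q1 f (node ((p, 1 - p)%R, (q0, q1))).
Proof. move=> g01; rewrite /branch; case: branch_sig => /= M /(_ g01)[_ h]; exact: h. Qed.

End branch_measure.

Lemma ae_forall_countable d (T : measurableType d) (R : realType) (mu : {measure set T -> \bar R})
    (I : countType) (P : I -> T -> Prop) :
  (forall i, {ae mu, forall x, P i x}) -> {ae mu, forall x, forall i, P i x}.
Proof.
move=> H; have H' n : {ae mu, forall x, if unpickle n is Some i then P i x else True}.
  by case: (unpickle n) => [i|]; [exact: H|apply: nearW].
by apply: filterS (ae_foralln H') => x h i; have := h (pickle i); rewrite pickleK.
Qed.

Section tree_posterior.
Context (R : realType).
Implicit Types (g a : seq bool -> R).
Local Open Scope ereal_scope.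

(* [k = m - size z]; at each node [w] the tree stops at [half_tree] with probability [g w]. *)
Fixpoint tree_post (k m : nat) (z : seq bool) g a : probability (branching R z m) R :=
  if k is k'.+1 then
    branch (g z) (a (rcons z false)) (a (rcons z true))
      (tree_post k' m (rcons z false) g a) (tree_post k' m (rcons z true) g a)
  else dirac (half_tree : branching R z m).

Lemma prior_rec_post (alpha u s : R) k m z A :
  (0 < alpha)%R -> (0 <= u <= 1)%R -> (u + s = 1)%R -> measurable A ->
  prior_rec alpha u s k m z A = tree_post k m z (fun=> u) (fun=> alpha) A.
Proof.
move=> al0 u01 us; elim: k z A => [//|k ih] z A mA.
have -> : s = (1 - u)%R by rewrite -us; ring.
rewrite /= branchE//; congr (_ + _ * _); rewrite /pushforward.
have mB : measurable (@node R z m @^-1` A).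
  by rewrite -[X in measurable X]setTI; exact: measurable_node.
apply: eq_product_measure1 => //; first by move=> B; exact: Beta_beta2.
move=> B mB'; apply: eq_product_measure1 => //.
  by move=> C mC; rewrite -us addrAC subrr add0r in ih *; exact: ih.
by move=> C mC; rewrite -us addrAC subrr add0r in ih *; exact: ih.
Qed.

Lemma measurable_phi_lookup z m w (phi : R -> \bar R) : measurable_fun setT phi ->
  measurable_fun setT (fun q : branching R z m => phi (lookup q w)).
Proof. by move=> mphi; exact: (measurableT_comp mphi (@measurable_lookup R z m w)). Qed.

Lemma integral_branch_child z m (c a b : R) n0 n1 (phi : R -> \bar R) d :
  (0 <= c <= 1)%R -> (size z < m)%N -> measurable_fun setT phi -> (forall x, 0 <= phi x) ->
  \int[@branch R z m c a b n0 n1]_q phi (lookup q (rcons z d)) =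
  c%:E * phi (2^-1)%R + (1 - c)%:E * \int[betaP a b]_p phi (if d then 1 - p else p)%R.
Proof.
move=> c01 zm mphi phi0; rewrite integral_branch//; last exact: measurable_phi_lookup.
rewrite lookup_half ?is_index_rcons//; congr (_ + _ * _).
apply: eq_integral => p _; under eq_integral do under eq_integral do rewrite lookup_node_child//=.
by rewrite !integral_probability_cst.
Qed.

(** Only the subtree that contains [w] matters; the root split and the other subtree integrate to
    1. *)
Lemma integral_branch_desc z m (c a b : R) n0 n1 (phi : R -> \bar R) (d : bool) w :
  (0 <= c <= 1)%R -> prefix (rcons z d) w -> (size (rcons z d) < size w <= m)%N ->
  measurable_fun setT phi -> (forall x, 0 <= phi x) ->
  \int[@branch R z m c a b n0 n1]_q phi (lookup q w) =
  c%:E * phi (2^-1)%R + (1 - c)%:E *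
    (if d then \int[n1]_q phi (lookup q w) else \int[n0]_q phi (lookup q w)).
Proof.
move=> c01 pw /andP[sw wm] mphi phi0; rewrite integral_branch//; last exact: measurable_phi_lookup.
rewrite lookup_half; last first.
  rewrite /is_index wm andbT (prefix_trans (prefix_rcons z d) pw).
  by rewrite (leq_trans _ (ltnW sw))// size_rcons.
congr (_ + _ * _).
transitivity (\int[betaP a b]_p (if d then \int[n1]_q phi (lookup q w) else \int[n0]_q phi (lookup
    q w))).
  apply: eq_integral => p _.
  under eq_integral do under eq_integral do rewrite (lookup_node_desc _ pw sw)/=.
  by case: d pw sw => pw sw; [|under eq_integral do rewrite integral_probability_cst];
    rewrite ?integral_probability_cst.
by rewrite integral_probability_cst.
Qed.

(** A stopped tree has coordinates 1/2, and a Beta law charges only the open unit interval. Extended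
    values of [phi] admit an infinite penalty outside the interval. *)
Lemma tree_post_support k m z g a w (phi : R -> \bar R) :
  (forall w, 0 <= g w <= 1)%R -> (forall w, 0 < a w)%R ->
  measurable_fun setT phi -> (forall x, 0 <= phi x) -> (forall x, (0 <= x <= 1)%R -> phi x = 0) ->
  (k + size z)%N = m -> is_index z m w ->
  \int[tree_post k m z g a]_q phi (lookup q w) = 0.
Proof.
move=> g01 a0 mphi phi0 phi01.
have h12 : phi (2^-1)%R = 0 by apply: phi01; apply/andP; split; lra.
elim: k z => [|k ih] z kz iw.
  by move: iw => /and3P[_ /leq_trans/[apply]]; rewrite -kz add0n ltnn.
have /and3P[pz sz wm] := iw; have [d pd] := prefix_cases pz sz.
have [sd|sd] := ltnP (size (rcons z d)) (size w).
  rewrite /= (@integral_branch_desc _ _ _ _ _ _ _ _ d)// ?sd//.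
  rewrite h12 mule0 add0e; case: d pd sd => pd sd; rewrite ih ?mule0//.
  - by rewrite size_rcons addnS -addSn.
  - by rewrite /is_index pd sd.
  - by rewrite size_rcons addnS -addSn.
  - by rewrite /is_index pd sd.
have -> : w = rcons z d.
  have /prefixP[[|c r] e] := pd; first by rewrite cats0 in e.
  by move: sd; rewrite e size_cat/= addnS ltnNge leq_addr.
rewrite /= integral_branch_child//; last by rewrite -kz addSn ltnS leq_addl.
rewrite h12 mule0 add0e [X in _ * X](_ : _ = 0) ?mule0//.
transitivity (\int[betaP (a (rcons z false)) (a (rcons z true))]_p (cst 0 p)); last exact:
    integral0.
have mg : measurable_fun [set: R] (fun p : R => phi (if d then 1 - p else p)%R).
  by case: d {pd sd} => //; apply: (measurableT_comp mphi); exact: measurable_funB.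
apply: ae_eq_integral => //.
exists (~` `]0%R, 1%R[%classic); split => //; [exact: measurableC|exact: betaP_support|].
move=> p /= h; apply: contra_not h => /=; rewrite in_itv/= => /andP[p0 p1] _.
by apply: phi01; case: d {pd sd mg}; apply/andP; split; lra.
Qed.

Lemma tree_post_ae01 k m z g a :
  (forall w, 0 <= g w <= 1)%R -> (forall w, 0 < a w)%R -> (k + size z)%N = m ->
  {ae tree_post k m z g a, forall q, forall w, is_index z m w -> (0 <= lookup q w <= 1)%R}.
Proof.
move=> g01 a0 kz.
have H w : {ae tree_post k m z g a, forall q, is_index z m w -> (0 <= lookup q w <= 1)%R}.
  have [iw|iw] := boolP (is_index z m w); last by apply: nearW => q.
  pose phi (x : R) : \bar R := (\1_(~` `[0%R, 1%R]%classic : set R) x)%:E.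
  have mC : measurable (~` `[0%R, 1%R]%classic : set R) by exact: measurableC.
  have : \int[tree_post k m z g a]_q phi (lookup q w) = 0.
    apply: tree_post_support => //.
    - by apply/measurable_EFinP; exact: measurable_indic.
    - by move=> x; rewrite lee_fin.
    - by move=> x x01; rewrite /phi indicE memNset//=; apply; rewrite /= in_itv.
  have mL : measurable ((fun q : branching R z m => lookup q w) @^-1` (~` `[0%R, 1%R]%classic)).
    by rewrite -[X in measurable X]setTI; exact: measurable_lookup.
  rewrite [X in X = _ -> _](_ : _ = tree_post k m z g a ((fun q => lookup q w) @^-1` (~` `[0%R,
      1%R]%classic))); last first.
    by rewrite (@integral_indic _ _ _ (tree_post k m z g a) setT measurableT _ mL) setIT.
  move=> h; exists ((fun q => lookup q w) @^-1` (~` `[0%R, 1%R]%classic)); split => //.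
  by move=> q /= nq; rewrite in_itv/= => h01; apply: nq.
exact: ae_forall_countable H.
Qed.

End tree_posterior.

(** * Cells and likelihoods *)

Section partition_theory.
Context (R : realType) d (T : measurableType d) (vol : probability T R) (G : seq bool -> set T).
Hypothesis hG : tree_partition vol G.
Implicit Types (z w : seq bool) (x : T) (D : seq T).

Lemma measurable_cell z : measurable (G z).
Proof. by rewrite (tree_generate hG); apply: sub_sigma_algebra; exists z. Qed.

Lemma cell_rcons z b x : G (rcons z b) x -> G z x.
Proof. by rewrite (tree_split hG z); case: b; [right|left]. Qed.

Lemma cell_prefix z w x : prefix z w -> G w x -> G z x.
Proof.
move=> /prefixP[s ->]; elim/last_ind: s => [|s b ih]; first by rewrite cats0.
by rewrite -rcons_cat => /cell_rcons.
Qed.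

Lemma cell_cases z x : G z x -> exists b, G (rcons z b) x.
Proof. by rewrite (tree_split hG z) => -[]; [exists false|exists true]. Qed.

Lemma cell_rcons_inj z b c x : G (rcons z b) x -> G (rcons z c) x -> b = c.
Proof.
have h : ~ (G (rcons z false) `&` G (rcons z true)) x by rewrite (tree_disjoint hG).
by case: b c => -[]// h1 h2; exfalso; apply: h.
Qed.

Lemma cell_inj z w x : size z = size w -> G z x -> G w x -> z = w.
Proof.
elim/last_ind: z w => [|z b ih] w; first by move=> /esym/size0nil ->.
case/lastP: w => [|w c]; rewrite ?size_rcons// => -[szw] h1 h2.
have e := ih w szw (cell_rcons h1) (cell_rcons h2); subst w.
by rewrite (cell_rcons_inj h1 h2).
Qed.

Lemma cell_ex x i : exists w, size w = i /\ G w x.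
Proof.
elim: i => [|i [w [sw gw]]]; first by exists [::]; rewrite (tree_root hG).
by have [b gb] := cell_cases gw; exists (rcons w b); rewrite size_rcons sw.
Qed.

Lemma addressP x i : size (address G x i) = i /\ G (address G x i) x.
Proof.
have [w hw] := cell_ex x i.
by rewrite /address; case: xgetP => [y _ //|/(_ w)].
Qed.

Lemma address_eq z x : G z x -> address G x (size z) = z.
Proof. by have [h1 h2] := addressP x (size z); move=> /(cell_inj h1 h2). Qed.

Lemma address_prefix z x i : G z x -> (size z <= i)%N -> prefix z (address G x i).
Proof.
move=> gz zi; have [s1 g1] := addressP x i.
have p : prefix (take (size z) (address G x i)) (address G x i) by exact: prefix_take.
have := cell_prefix p g1; rewrite prefixE => h; apply/eqP.
by apply: (cell_inj _ h gz); rewrite size_take s1; case: ltnP => // /(conj zi)/andP; rewrite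
    -eqn_leq => /eqP.
Qed.

Definition cnt z D := size (sublist G z D).

Lemma cnt_cons z x D : cnt z (x :: D) = ((x \in G z) + cnt z D)%N.
Proof. by rewrite /cnt /sublist /=; case: ifP. Qed.

Lemma mem_cell_split z x : (x \in G z) = (x \in G (rcons z false)) || (x \in G (rcons z true)).
Proof. by rewrite -in_setU -(tree_split hG). Qed.

Lemma mem_cell_disj z x : (x \in G (rcons z false)) && (x \in G (rcons z true)) = false.
Proof. by rewrite -in_setI (tree_disjoint hG) in_set0. Qed.

Lemma cnt_split z D : cnt z D = (cnt (rcons z false) D + cnt (rcons z true) D)%N.
Proof.
elim: D => [//|x D ih]; rewrite !cnt_cons ih mem_cell_split.
by have := mem_cell_disj z x; case: (x \in _); case: (x \in _) => //= _; rewrite ?add0n ?addSn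
    ?addnS ?add1n.
Qed.

Section likelihood_theory.
Variable (m : nat).
Local Notation lik1 := (likelihood1 G m).
Local Notation lik := (likelihood G m).

Lemma measurable_likelihood1 z x :
  measurable_fun setT (fun q : branching R z m => lik1 z q x).
Proof.
apply: measurable_prod => i _; apply: measurable_funM => //; exact: measurable_lookup.
Qed.

Lemma measurable_likelihood z D :
  measurable_fun setT (fun q : branching R z m => lik z D q).
Proof. by apply: measurable_prod => x _; exact: measurable_likelihood1. Qed.

Lemma likelihood_half z D : lik z (sublist G z D) half_tree = 1 :> R.
Proof.
rewrite /likelihood big_filter big1// => x /set_mem gx.
rewrite /likelihood1 big_nat big1// => i /andP[zi im].
have [s1 g1] := addressP x i.
rewrite lookup_half ?divff ?pnatr_eq0//.
by rewrite /is_index address_prefix ?(ltnW zi)//= s1 zi.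
Qed.

Lemma likelihood1_node z b t x : (size z < m)%N -> G (rcons z b) x ->
  lik1 z (@node R z m t) x = 2 * (if b then t.1.2 else t.1.1) *
    (if b then lik1 (rcons z true) t.2.2 x else lik1 (rcons z false) t.2.1 x).
Proof.
move=> zm gx; rewrite /likelihood1 big_ltn//.
have -> : address G x (size z).+1 = rcons z b by rewrite -(address_eq gx) size_rcons.
rewrite lookup_node_child//; congr (_ * _).
have H (F : seq bool -> R) : (forall w, prefix (rcons z b) w -> (size (rcons z b) < size w)%N ->
    lookup (@node R z m t) w = F w) ->
   \prod_((size z).+2 <= i < m.+1) (2 * lookup (@node R z m t) (address G x i)) =
   \prod_((size z).+2 <= i < m.+1) (2 * F (address G x i)).
  move=> h; rewrite big_nat [RHS]big_nat; apply: eq_bigr => i /andP[zi im].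
  have [s1 g1] := addressP x i.
  by rewrite h// ?s1 ?size_rcons// address_prefix// size_rcons ltnW.
have E : size (rcons z b) = (size z).+1 by rewrite size_rcons.
case: b gx H E => gx H E; rewrite E; apply: H => w pw sw; by rewrite (lookup_node_desc _ pw sw).
Qed.

(** The factorization behind conjugacy: each point contributes twice the branching probability of
    its child and a factor that depends on that child's subtree only. *)
Lemma likelihood_node z D t : (size z < m)%N ->
  lik z (sublist G z D) (@node R z m t) =
  (2 * t.1.1) ^+ cnt (rcons z false) D * (2 * t.1.2) ^+ cnt (rcons z true) D *
  (lik (rcons z false) (sublist G (rcons z false) D) t.2.1 *
   lik (rcons z true) (sublist G (rcons z true) D) t.2.2).
Proof.
move=> zm; rewrite /likelihood !big_filter.
elim: D => [|x D ih]; first by rewrite !big_nil !expr0 !mulr1.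
rewrite !big_cons !cnt_cons ih mem_cell_split.
have := mem_cell_disj z x.
have [x0|x0] := boolP (x \in G (rcons z false)).
  move=> /= ->; rewrite add0n add1n exprS.
  by rewrite (likelihood1_node _ zm (set_mem x0)); ring.
have [x1|x1] //= := boolP (x \in G (rcons z true)) => _.
rewrite add0n add1n exprS.
by rewrite (likelihood1_node _ zm (set_mem x1)); ring.
Qed.

End likelihood_theory.
End partition_theory.

(** * The weight of a split *)

Section split_weights.
Context (R : realType).
Local Notation mu := (@lebesgue_measure R).

Lemma betaP_itv_gt0 (a b lo hi : R) : 0 < a -> 0 < b -> 0 < lo -> lo < hi -> hi < 1 ->
  (0 < betaP a b `[lo, hi]%classic)%E.
Proof.
move=> a0 b0 lo0 lohi hi1; have hi1' : 0 < 1 - hi by rewrite subr_gt0.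
(* The density has exponents [a - 1] and [b - 1], which may be negative. Raising them by 1 can only
   lower the powers of numbers in the unit interval and makes these powers monotone. *)
pose c := beta_const a b * (lo `^ a * (1 - hi) `^ b).
have c0 : 0 < c by rewrite mulr_gt0 ?beta_const_gt0// mulr_gt0// powR_gt0.
have mA : measurable (`[lo, hi]%classic : set R) by exact: measurable_itv.
rewrite betaPE//; apply: (@lt_le_trans _ _ (\int[mu]_(p in `[lo, hi]) c%:E)%E).
  rewrite integral_cst//= lebesgue_measure_itv/= lte_fin lohi -EFinD -EFinM lte_fin.
  by rewrite mulr_gt0// subr_gt0.
apply: ge0_le_integral => //.
- by move=> p _; rewrite lee_fin ltW.
- apply/measurable_EFinP/measurable_funTS; apply: measurable_funM => //; exact:
    measurable_beta_kernel.
move=> p /=; rewrite in_itv/= => /andP[lop phi].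
have p0 : 0 < p := lt_le_trans lo0 lop; have p1 : p < 1 := le_lt_trans phi hi1.
have q0 : 0 < 1 - p by rewrite subr_gt0.
rewrite lee_fin /c /beta_kernel p0 p1/= ler_wpM2l ?(ltW (beta_const_gt0 _ _))//.
have le1 (x e : R) : 0 < x -> x <= 1 -> x `^ e <= x `^ (e - 1).
  by move=> x0 x1; rewrite (powR_subr1 e x0) ler_piMr// powR_ge0.
apply: ler_pM; rewrite ?powR_ge0//.
  apply: le_trans (le1 _ _ p0 (ltW p1)); apply: ge0_ler_powR => //; rewrite ?nnegrE ltW//.
apply: le_trans (le1 _ _ q0 _); last by rewrite lerBlDr lerDl ltW.
by apply: ge0_ler_powR; rewrite ?nnegrE; [exact: ltW|exact: ltW|exact: ltW|rewrite lerD2l lerN2].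
Qed.

Variable alpha : R.
Hypothesis al0 : 0 < alpha.

(** The mean of [(2 p)^i (2 (1 - p))^j] for [p] of law Beta(alpha, alpha): the evidence of a single
    split relative to the uniform distribution. It is the W of the evidence recursion. *)
Definition split_weight (i j : nat) : R := 2 ^+ (i + j) * beta_weight alpha alpha i j.

Lemma split_weight_gt0 i j : 0 < split_weight i j.
Proof. by rewrite mulr_gt0 ?exprn_gt0 ?beta_weight_gt0. Qed.

Lemma integral_betaP_split i j (f : R -> \bar R) :
  measurable_fun setT f -> (forall p, (0 <= f p)%E) ->
  (\int[betaP alpha alpha]_p (`|(2 * p) ^+ i * (2 * (1 - p)) ^+ j|%:E * f p) =
   (split_weight i j)%:E * \int[betaP (alpha + i%:R) (alpha + j%:R)]_p f p)%E.
Proof.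
move=> mf f0; rewrite /split_weight EFinM -muleA -integral_betaPX//.
have mX : measurable_fun [set: R] (fun p => (`|p| ^+ i * `|1 - p| ^+ j)%R).
  apply: measurable_funM; apply: measurable_funX.
    exact: normr_measurable.
  by apply: measurableT_comp => //; exact: measurable_funB.
rewrite -ge0_integralZl//; last 2 first.
- by apply: emeasurable_funM => //; exact/measurable_EFinP.
- by move=> p _; rewrite mule_ge0// lee_fin mulr_ge0 ?exprn_ge0.
apply: eq_integral => p _; rewrite muleA -EFinM; congr (_%:E * _)%E.
by rewrite !(exprMn, normrM, normrX) (ger0_norm (ler0n _ 2)) exprD; ring.
Qed.

Lemma beta_constC (a b : R) : beta_const a b = beta_const b a.
Proof. by rewrite /beta_const addrC [in X in _ / X]mulrC. Qed.

Lemma split_weightC i j : split_weight i j = split_weight j i.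
Proof. by rewrite /split_weight addnC /beta_weight [in X in _ / X]beta_constC. Qed.

(** The new factor is twice the mean of Beta(alpha + i, alpha + j), that is, twice the predictive
    probability of the next point. *)
Lemma split_weightS i j : split_weight i.+1 j =
  split_weight i j * (2 * (alpha + i%:R) / (alpha + i%:R + (alpha + j%:R))).
Proof.
have ai : 0 < alpha + i%:R by rewrite ltr_pwDl.
have aj : 0 < alpha + j%:R by rewrite ltr_pwDl.
have h := beta_weight10 ai aj.
rewrite /split_weight addSn exprS -[in RHS]mulrA -[2 * _ / _]mulrA -h /beta_weight.
rewrite addr0 -(addrA alpha i%:R 1) natr1.
have c1 := beta_const_gt0 ai aj.
have ai1 : 0 < alpha + i.+1%:R by rewrite ltr_pwDl.
have c2 := beta_const_gt0 ai1 aj.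
move: c1 c2; move: (beta_const (alpha + i%:R) _) (beta_const (alpha + i.+1%:R) _) (beta_const alpha
    alpha) (2 ^+ _) => b c a e b0 c0.
by field; rewrite !gt_eqF.
Qed.

Lemma split_weight00 : split_weight 0 0 = 1.
Proof. by rewrite /split_weight expr0 mul1r /beta_weight !addr0 divff// gt_eqF// beta_const_gt0.
    Qed.

Lemma split_weight_ge1 n : 1 <= split_weight n 0.
Proof.
elim: n => [|n ih]; first by rewrite split_weight00.
rewrite split_weightS addr0 -[leLHS]mulr1 ler_pM//.
rewrite ler_pdivlMr; first by rewrite mul1r mulr_natl mulr2n lerD2l lerDl.
by rewrite addr_gt0// ltr_pwDl.
Qed.

Lemma split_weight_ge1r n : 1 <= split_weight 0 n.
Proof. by rewrite split_weightC; exact: split_weight_ge1. Qed.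

Local Notation W := split_weight.

(* Laplace's method: only the fractions [p] near [q] are kept. *)
Lemma split_weight_ge (q r : R) : 0 < q < 1 -> 0 < r < 1 ->
  exists2 C, 0 < C & forall i j, C * ((2 * q * r) ^+ i * (2 * (1 - q) * r) ^+ j) <= W i j.
Proof.
(* On this interval [p >= r q] and [1 - p >= r (1 - q)], so the integrand is bounded below; the
   constant [C] is the mass of the interval. *)
move=> /andP[q0 q1] /andP[r0 r1]; pose lo := r * q; pose hi := 1 - r * (1 - q).
have q1' : 0 < 1 - q by rewrite subr_gt0.
have lo0 : 0 < lo by rewrite mulr_gt0.
have hi1 : hi < 1 by rewrite ltrBlDr ltrDl mulr_gt0.
have lohi : lo < hi by rewrite /lo /hi ltrBrDr -mulrDr addrC subrK mulr1.
have mA : measurable (`[lo, hi]%classic : set R) by exact: measurable_itv.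
have fA : betaP alpha alpha `[lo, hi]%classic \is a fin_num := fin_num_measure _ _ mA.
exists (fine (betaP alpha alpha `[lo, hi]%classic)).
  by rewrite fine_gt0// betaP_itv_gt0//= ltey_eq fA.
move=> i j; rewrite -lee_fin EFinM fineK//.
set K := (_ * _)%R; have K0 : 0 <= K by rewrite mulr_ge0// exprn_ge0 ?mulr_ge0 ?(ltW r0)// ltW.
have mX : measurable_fun [set: R] (fun p : R => `|(2 * p) ^+ i * (2 * (1 - p)) ^+ j|).
  apply: measurableT_comp; first exact: normr_measurable.
  apply: measurable_funM; apply: measurable_funX; apply: measurable_funM => //.
  exact: measurable_funB.
have -> : (W i j)%:E = (\int[betaP alpha alpha]_p (`|(2 * p) ^+ i * (2 * (1 - p)) ^+ j|%:E * 1))%E.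
  by rewrite integral_betaP_split// integral_probability_cst// mule1.
rewrite muleC (_ : betaP alpha alpha _ = (\int[betaP alpha alpha]_p (\1_(`[lo, hi]%classic : set R)
    p)%:E)%E); last first.
  by rewrite (@integral_indic _ _ _ (betaP alpha alpha) setT measurableT _ mA) setIT.
have mI : measurable_fun [set: R] (fun p : R => (\1_(`[lo, hi]%classic : set R) p)%:E : \bar R).
  by apply/measurable_EFinP; exact: measurable_indic.
rewrite -ge0_integralZl//.
apply: ge0_le_integral => //.
- by move=> p _; rewrite mule_ge0// lee_fin.
- by apply: emeasurable_funM.
- by apply: emeasurable_funM => //; exact/measurable_EFinP.
move=> p _; rewrite mule1 -EFinM lee_fin indicE; have [|_] := boolP (p \in _); last by rewrite
    mulr0.
rewrite inE/= in_itv/= mulr1 => /andP[lop phi].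
have p0 : 0 <= p := le_trans (ltW lo0) lop.
have p1 : 0 <= 1 - p by rewrite subr_ge0 (le_trans phi)// ltW.
rewrite ger0_norm; last by rewrite mulr_ge0// exprn_ge0// mulr_ge0.
rewrite /K; apply: ler_pM.
- by rewrite exprn_ge0// !mulr_ge0 ?(ltW r0)// ltW.
- by rewrite exprn_ge0// !mulr_ge0 ?(ltW r0)// ltW.
- apply: lerXn2r; rewrite ?nnegrE ?mulr_ge0 ?(ltW r0)//; first exact: ltW.
  by rewrite -mulrA ler_wpM2l// mulrC.
- apply: lerXn2r; rewrite ?nnegrE ?mulr_ge0 ?(ltW r0)//; first exact: ltW.
  rewrite -mulrA ler_wpM2l// mulrC; move: phi; rewrite /hi; lra.
Qed.

(** With [r = exp (- k)] the loss per point is an arbitrarily small rate [k], while [C] does not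
    depend on the counts. *)
Lemma split_weight_ge_expR (q k : R) : 0 < q < 1 -> 0 < k ->
  exists2 C, 0 < C & forall i j : nat,
    C * expR (i%:R * ln (2 * q) + j%:R * ln (2 * (1 - q)) - k * (i + j)%:R) <= W i j.
Proof.
move=> q01 k0; have /andP[q0 q1] := q01.
have r01 : 0 < expR (- k) < 1 by rewrite expR_gt0/= -[ltRHS]expR0 ltr_expR oppr_lt0.
have [C C0 h] := split_weight_ge q01 r01; exists C => // i j; apply: le_trans (h i j).
apply: ler_wpM2l; first exact: ltW.
have E (x : R) n : 0 < x -> (x * expR (- k)) ^+ n = expR (n%:R * ln x - k * n%:R).
  move=> x0; rewrite -[X in X * _](lnK x0) -expRD -expRM_natl mulrDr; congr (expR (_ + _)).
  by rewrite mulrN mulrC.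
have A1 : 0 < 2 * q by rewrite mulr_gt0.
have A2 : 0 < 2 * (1 - q) by rewrite mulr_gt0// subr_gt0.
rewrite !E// -expRD natrD ler_expR; lra.
Qed.

Lemma split_weight_ge_half (k : R) : 0 < k ->
  exists2 C, 0 < C & forall i j : nat, C * expR (- (k * (i + j)%:R)) <= W i j.
Proof.
move=> k0; have q01 : 0 < (2^-1 : R) < 1 by apply/andP; split; lra.
have [C C0 h] := split_weight_ge_expR q01 k0; exists C => // i j; apply: le_trans (h i j).
rewrite (_ : 1 - 2^-1 = 2^-1 :> R); last by lra.
by rewrite divff// ln1 !mulr0 !add0r.
Qed.

(* The Kullback-Leibler divergence from the fair coin is positive; it is compared with the midpoint
   between [t] and [1/2], which stays away from 0 and 1. *)
Lemma split_weight_ge_biased (t : R) : 0 <= t <= 1 -> t != 2^-1 ->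
  exists c e C : R, [/\ 0 < c, 0 < e, 0 < C & forall i j : nat,
    `|i%:R - t * (i + j)%:R| <= e * (i + j)%:R -> C * expR (c * (i + j)%:R) <= W i j].
Proof.
move=> /andP[t0 t1] t2; pose q := (t + 2^-1) / 2.
have q01 : 0 < q < 1 by rewrite /q; apply/andP; split; lra.
have [e1 e2] : 2 * q = t + 2^-1 /\ 2 * (1 - q) = 3 / 2 - t by rewrite /q; split; lra.
pose A := ln (2 * q); pose B := ln (2 * (1 - q)).
pose f := t * A + (1 - t) * B.
(* This replaces the logarithms by rational functions; the resulting lower bound of [f] is a square
   over a positive number. *)
have lnge (x : R) : 0 < x -> 1 - x^-1 <= ln x.
  move=> x0; have := @le_ln1Dx R (x^-1 - 1); rewrite (addrC 1) subrK lnV ?posrE//.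
  have : 0 < x^-1 by rewrite invr_gt0.
  move=> xi h; have := h _; lra.
have f0 : 0 < f.
  have x0 : 0 < t + 2^-1 by lra.
  have y0 : 0 < 3 / 2 - t by lra.
  have A1 : 1 - (t + 2^-1)^-1 <= A by rewrite /A e1; exact: lnge.
  have B1 : 1 - (3 / 2 - t)^-1 <= B by rewrite /B e2; exact: lnge.
  apply: (@lt_le_trans _ _ (t * (1 - (t + 2^-1)^-1) + (1 - t) * (1 - (3 / 2 - t)^-1))); last first.
    by apply: lerD; apply: ler_wpM2l => //; lra.
  have -> : t * (1 - (t + 2^-1)^-1) + (1 - t) * (1 - (3 / 2 - t)^-1) =
     (t - 2^-1) ^+ 2 / ((t + 2^-1) * (3 / 2 - t)).
    by field; rewrite !gt_eqF//; lra.
  by apply: divr_gt0; [rewrite exprn_even_gt0// subr_eq0|exact: mulr_gt0].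
(* Of the expected gain [f] per point, the deviation of the frequency may cost a quarter and
   Laplace's bound another quarter; the rate [f / 2] remains. *)
pose e := f / (4 * (`|A - B| + 1)).
have M0 : 0 < `|A - B| + 1 by rewrite ltr_wpDl.
have e0 : 0 < e by rewrite divr_gt0// mulr_gt0.
have eM : e * `|A - B| <= f / 4.
  have -> : f / 4 = e * (`|A - B| + 1) by rewrite /e; field; rewrite gt_eqF.
  by rewrite ler_wpM2l ?(ltW e0)// lerDl.
have k0 : 0 < f / 4 by rewrite divr_gt0.
have [C C0 h] := split_weight_ge_expR q01 k0.
exists (f / 2), e, C; split; rewrite ?divr_gt0// => i j hij.
apply: le_trans (h i j); rewrite ler_wpM2l ?(ltW C0)// ler_expR -/A -/B.
set n : R := (i + j)%:R in hij *.
have jE : j%:R = n - i%:R by rewrite /n natrD addrC addKr.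
have n0 : 0 <= n by rewrite ler0n.
have : - (f / 4 * n) <= (i%:R - t * n) * (A - B).
  apply: le_trans (lerNnormlW (lexx _)); rewrite lerN2 normrM.
  apply: (@le_trans _ _ (e * n * `|A - B|)); first by rewrite ler_wpM2r.
  by rewrite mulrAC ler_wpM2r.
rewrite jE /f; nra.
Qed.

End split_weights.

(** * Continuity in the stopping probabilities *)

Section tree_variation.
Context (R : realType).
Local Open Scope ereal_scope.
Implicit Types g a : seq bool -> R.

(** Sum of the changes over all nodes of the first [k] levels; it bounds the difference of the two
    tree laws on every event. *)
Fixpoint stop_dist (k : nat) (z : seq bool) (g g' : seq bool -> R) : R :=
  (if k is k'.+1 then
    `|g z - g' z| + (stop_dist k' (rcons z false) g g' + stop_dist k' (rcons z true) g g') else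
        0)%R.

Lemma stop_dist_ge0 k z g g' : (0 <= stop_dist k z g g')%R.
Proof. by elim: k z => [|k ih] z //=; rewrite !addr_ge0. Qed.

Lemma stop_distC k z g g' : stop_dist k z g g' = stop_dist k z g' g.
Proof. by elim: k z => [|k ih] z //=; rewrite distrC !ih. Qed.

Lemma probability_integral_le1 d (T : measurableType d) (P : probability T R) (f : T -> \bar R) :
  measurable_fun setT f -> (forall q, 0 <= f q <= 1) -> 0 <= \int[P]_x f x <= 1.
Proof.
move=> mf f01; rewrite integral_ge0/=; last by move=> x _; case/andP: (f01 x).
rewrite -[leRHS](@integral_probability_cst _ _ _ P 1)//.
apply: ge0_le_integral => //.
- by move=> x _; case/andP: (f01 x).
- by move=> x _; case/andP: (f01 x).
Qed.

(** Since [f] takes values in the unit interval, changing the stopping probability at one node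
    changes the integral by at most that change; the Beta laws are common to both sides. *)
Lemma tree_post_le_dist k m z g g' a (f : branching R z m -> \bar R) :
  (forall w, 0 <= g w <= 1)%R -> (forall w, 0 <= g' w <= 1)%R ->
  measurable_fun setT f -> (forall q, 0 <= f q <= 1) ->
  \int[tree_post k m z g a]_q f q <= \int[tree_post k m z g' a]_q f q + (stop_dist k z g g')%:E.
Proof.
move=> g01 g'01; elim: k z f => [|k ih] z f mf f01; first by rewrite /= adde0.
have f0 q : 0 <= f q by case/andP: (f01 q).
rewrite [tree_post _ _ _ g _]/= [tree_post _ _ _ g' _]/= !integral_branch//.
set I := \int[betaP _ _]_p _; set I' := \int[betaP _ _]_p _.
pose n0 := tree_post k m (rcons z false) g a; pose n1 := tree_post k m (rcons z true) g a.
pose n0' := tree_post k m (rcons z false) g' a; pose n1' := tree_post k m (rcons z true) g' a.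
have mn := measurable_node_triple mf.
have mK (n : probability (branching R (rcons z true) m) R) := @measurable_integral_snd _ _ _ _ R n
    _ mn (fun=> f0 _).
have mF (p : R) q0 : measurable_fun setT (fun q1 => f (node ((p, 1 - p)%R, (q0, q1)))).
  exact: (measurableT_comp mn (pair1_measurable (p, q0))).
have mG (n : probability (branching R (rcons z true) m) R) (p : R) :
    measurable_fun setT (fun q0 => \int[n]_q1 f (node ((p, 1 - p)%R, (q0, q1)))).
  exact: (measurableT_comp (mK n) (pair1_measurable p)).
have G01 (n : probability (branching R (rcons z true) m) R) (p : R) q0 :
    0 <= \int[n]_q1 f (node ((p, 1 - p)%R, (q0, q1))) <= 1 by exact: probability_integral_le1.
have mH (n : probability (branching R (rcons z false) m) R) (n' : probability (branching R (rcons z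
    true) m) R) :
    measurable_fun setT (fun p : R => \int[n]_q0 \int[n']_q1 f (node ((p, 1 - p)%R, (q0, q1)))).
  by apply: (@measurable_integral_snd _ _ _ _ R n _ (mK n')) => x; case/andP: (G01 n' x.1 x.2).
have H01 (n : probability (branching R (rcons z false) m) R) (n' : probability (branching R (rcons
    z true) m) R) (p : R) :
    0 <= \int[n]_q0 \int[n']_q1 f (node ((p, 1 - p)%R, (q0, q1))) <= 1 by exact:
        probability_integral_le1.
set t0 := stop_dist k (rcons z false) g g'; set t1 := stop_dist k (rcons z true) g g'.
have t00 : 0 <= t0%:E by rewrite lee_fin stop_dist_ge0.
have t10 : 0 <= t1%:E by rewrite lee_fin stop_dist_ge0.
have II' : I <= I' + (t0 + t1)%:E.
  rewrite -[X in _ + X](@integral_probability_cst _ _ _ (betaP (a (rcons z false)) (a (rcons z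
      true))))//.
  rewrite -ge0_integralD//; last 2 first.
  - by move=> p _; case/andP: (H01 n0' n1' p).
  - by move=> p _; rewrite EFinD adde_ge0.
  apply: ge0_le_integral => //.
  - by move=> p _; case/andP: (H01 n0 n1 p).
  - by apply: emeasurable_funD; [exact: (mH n0' n1')|exact: measurable_cst].
  move=> p _; apply: (@le_trans _ _ (\int[n0]_q0 \int[n1']_q1 f (node ((p, 1 - p)%R, (q0, q1))) +
      t1%:E)).
    rewrite -[X in _ + X](@integral_probability_cst _ _ _ n0)// -ge0_integralD//; last first.
      by move=> q0 _; case/andP: (G01 n1' p q0).
    apply: ge0_le_integral => //.
    - by move=> q0 _; case/andP: (G01 n1 p q0).
    - by apply: emeasurable_funD; [exact: (mG n1' p)|exact: measurable_cst].
    by move=> q0 _; exact: ih.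
  by rewrite EFinD addeA leeD2r//; exact: ih.
have I01 : 0 <= I <= 1 by apply: probability_integral_le1; [exact: mH|exact: H01].
have I'01 : 0 <= I' <= 1 by apply: probability_integral_le1; [exact: mH|exact: H01].
have /andP[g0 g1] := g01 z; have /andP[g'0 g'1] := g'01 z.
move: (f01 half_tree) I01 I'01 II'; clearbody I I'.
case: (f half_tree) => [h| |]; [|by rewrite andbF|by []].
case: I => [x| |]; [|by rewrite andbF|by []].
case: I' => [y| |]; [|by rewrite andbF|by []].
rewrite -!EFinD !lee_fin => /andP[h0 h1] /andP[x0 x1] /andP[y0 y1] xy.
rewrite /= -/t0 -/t1; have := ler_norm (g z - g' z); have := ler_norm (g' z - g z); rewrite (distrC
    (g' z)).
move: `|_|%R => e e1 e2.
(* First the weights are exchanged at the fixed continuation [y], then the continuations at the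
   fixed weight [1 - g z]. *)
have -> : (g z * h + (1 - g z) * x = g' z * h + (1 - g' z) * y + ((g z - g' z) * (h - y)) + (1 - g
    z) * (x - y))%R by ring.
have A : ((g z - g' z) * (h - y) <= e)%R.
  have [hy|hy] := lerP y h; nra.
have B : ((1 - g z) * (x - y) <= t0 + t1)%R.
  move: t00 t10; rewrite !lee_fin => t00 t10; nra.
by lra.
Qed.

(** Only finitely many nodes enter [stop_dist], so pointwise convergence of the stopping
    probabilities is enough for convergence on every event. *)
Lemma tree_post_cvg (gn : nat -> seq bool -> R) g a k m z (A : set (branching R z m)) :
  (forall n w, 0 <= gn n w <= 1)%R -> (forall w, 0 <= g w <= 1)%R ->
  (forall w, gn n w @[n --> \oo] --> g w) -> measurable A ->
  tree_post k m z (gn n) a A @[n --> \oo] --> tree_post k m z g a A.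
Proof.
move=> gn01 g01 gng mA.
have d0 : stop_dist k z (gn n) g @[n --> \oo] --> (0 : R)%R.
  elim: k z {A mA} => [|k ih] z /=; first exact: cvg_cst.
  rewrite -[X in _ --> X](addr0 (0 : R)%R) -[X in _ --> (_ + X)%R](addr0 (0 : R)%R).
  apply: cvgD; last exact: cvgD.
  rewrite -(@normr0 _ R); apply: cvg_norm; rewrite -(subrr (g z)).
  apply: cvgD => //; exact: cvg_cst.
have mI : measurable_fun setT (fun q : branching R z m => (\1_A q)%:E : \bar R).
  by apply/measurable_EFinP; exact: measurable_indic.
have I01 (q : branching R z m) : 0%:E <= (\1_A q : R)%:E <= 1%:E.
  by rewrite !lee_fin indicE; case: (q \in A); rewrite ?lexx ?ler01.
have E h : tree_post k m z h a A = \int[tree_post k m z h a]_q (\1_A q)%:E.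
  by rewrite (@integral_indic _ _ _ (tree_post _ _ _ _ _) setT measurableT A mA) setIT.
have fin h : tree_post k m z h a A \is a fin_num := fin_num_measure _ _ mA.
rewrite -[X in _ --> X](fineK (fin g)); apply/fine_cvgP; split; first by apply: nearW => n; exact:
    fin.
apply/cvgrPdist_le => e e0.
have /cvgrPdist_le/(_ e e0) := d0; apply: filterS => n; rewrite sub0r normrN ger0_norm
    ?stop_dist_ge0// => de.
have h1 := tree_post_le_dist k a (gn01 n) g01 mI I01.
have h2 := tree_post_le_dist k a g01 (gn01 n) mI I01.
rewrite stop_distC in h2; rewrite -!E in h1 h2.
rewrite ler_norml; move: h1 h2.
rewrite -[X in X <= _ -> _](fineK (fin (gn n))) -[X in _ -> X <= _ -> _](fineK (fin g)).
rewrite -[X in _ <= X + _ -> _](fineK (fin g)) -[X in _ -> _ <= X + _ -> _](fineK (fin (gn n))).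
rewrite -!EFinD !lee_fin /= => h1 h2; apply/andP; split; lra.
Qed.

End tree_variation.

(** * Integrals of functions close to a constant *)

Section integral_near.
Context (R : realType).
Local Open Scope ereal_scope.

Lemma ptws_cvg (U : Type) (V : topologicalType) (F : set_system (U -> V)) (f : {ptws U -> V}) :
  Filter F -> (forall t, (fun g : U -> V => g t) @ F --> f t) -> F --> f.
Proof.
move=> FF Ff; apply/cvg_sup => t A; rewrite (@nbhsE (initial_topology (fun g : U -> V => g t))) =>
    -[B [[C oC <-] Bf] BA].
apply: filterS BA _; apply: Ff; exact: open_nbhs_nbhs.
Qed.

Lemma dist_max0 (x y : R) : (`|Num.max x 0 - Num.max y 0| <= `|x - y|)%R.
Proof.
rewrite ler_norml; have := ler_norm (x - y); have := ler_norm (y - x); rewrite (distrC y).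
by case: (lerP x 0%R) => h1; case: (lerP y 0%R) => h2 a b; apply/andP; split; lra.
Qed.

(* [f] need not be measurable: only the bound [H] is integrated. *)
Lemma integral_near d (T : measurableType d) (P : probability T R) (f : T -> R) (c eta : R)
    (H : T -> \bar R) :
  measurable_fun setT H -> (forall x, `|f x - c|%:E <= H x) -> \int[P]_x H x <= eta%:E ->
  (`|fine (\int[P]_x (f x)%:E) - c| <= 2 * eta)%R.
Proof.
move=> mH fH HE.
have H0 x : 0 <= H x by apply: le_trans (fH x); rewrite lee_fin.
have I0 : 0 <= \int[P]_x H x by exact: integral_ge0.
have eta0 : (0 <= eta)%R by rewrite -lee_fin (le_trans I0).
(* A nonnegative [h] lies between the measurable functions [max 0 (b - H)] and [b + H]. The positive
   and the negative part of [f] each cost [eta], hence the factor 2. *)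
have nonneg (h : T -> R) (b : R) : (0 <= b)%R -> (forall x, 0 <= h x)%R -> (forall x, `|h x - b|%:E
    <= H x) ->
    (b - eta)%:E <= \int[P]_x (h x)%:E <= (b + eta)%:E.
  move=> b0 h0 hH; apply/andP; split.
    pose L x := maxe 0 (b%:E - H x).
    have mL : measurable_fun setT L.
      by apply: measurable_maxe => //; apply: emeasurable_funB.
    have L0 x : 0 <= L x by rewrite le_max lexx.
    apply: (@le_trans _ _ (\int[P]_x L x)); last first.
      apply: le_integral_nonmeasurable => x; rewrite ge_max lee_fin h0/=.
      have := hH x; case: (H x) (H0 x) => [r| |] // r0; last by rewrite addeNy leNye.
      by rewrite lee_fin => hr; rewrite -EFinB lee_fin; have := ler_norm (b - h x); rewrite distrC;
          lra.
    have : b%:E <= \int[P]_x L x + \int[P]_x H x.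
      rewrite -[leLHS](@integral_probability_cst _ _ _ P) -ge0_integralD//.
      apply: ge0_le_integral => //.
      - by apply: emeasurable_funD.
      move=> x _; rewrite /L; case: (H x) (H0 x) => [r| |] // r0.
        by rewrite -EFinB -EFin_max -EFinD lee_fin -lerBlDr le_max lexx orbT.
      by rewrite addey ?leey// gt_eqF// (lt_le_trans (ltNyr 0))// le_max lexx.
    rewrite EFinB leeBlDr//; move/le_trans; apply; exact: leeD2l.
  apply: (@le_trans _ _ (\int[P]_x (b%:E + H x))).
    apply: le_integral_nonmeasurable => x; have := hH x; case: (H x) (H0 x) => [r| |] // r0.
      by rewrite lee_fin -EFinD lee_fin => hr; have := ler_norm (h x - b); lra.
    by move=> _; rewrite addey// leey.
  rewrite ge0_integralD//.
  by rewrite integral_probability_cst EFinD leeD2l.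
have [cp0 cn0] : (0 <= Num.max c 0 /\ 0 <= Num.max (- c) 0)%R by rewrite !le_max lexx !orbT.
have hp := nonneg (fun x => (Num.max (f x) 0)%R) _ cp0.
have hn := nonneg (fun x => (Num.max (- f x) 0)%R) _ cn0.
have /andP[p1 p2] : ((Num.max c 0 - eta)%:E <= \int[P]_x ((Num.max (f x) 0)%R)%:E <= (Num.max c 0 +
    eta)%:E).
  apply: hp => x; first by rewrite le_max lexx orbT.
  apply: le_trans (fH x); rewrite lee_fin.
  exact: dist_max0.
have /andP[n1 n2] : ((Num.max (- c) 0 - eta)%:E <= \int[P]_x ((Num.max (- f x) 0)%R)%:E <= (Num.max
    (- c) 0 + eta)%:E).
  apply: hn => x; first by rewrite le_max lexx orbT.
  apply: le_trans (fH x); rewrite lee_fin.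
  by apply: le_trans (dist_max0 _ _) _; rewrite -opprD normrN.
rewrite [X in fine X]integralE.
have -> : \int[P]_x (fun x => (f x)%:E)^\+ x = \int[P]_x ((Num.max (f x) 0)%R)%:E.
  by apply: eq_integral => x _; rewrite funeposE -EFin_max.
have -> : \int[P]_x (fun x => (f x)%:E)^\- x = \int[P]_x ((Num.max (- f x) 0)%R)%:E.
  by apply: eq_integral => x _; rewrite funenegE -EFinN -EFin_max.
move: p1 p2 n1 n2; case: (\int[P]_x _) => [x| |]//; case: (\int[P]_x _) => [y| |]//.
rewrite !lee_fin => p1 p2 n1 n2; rewrite /= ler_norml.
have e : (c = Num.max c 0 - Num.max (- c) 0)%R.
  by case: (lerP c 0%R) => h2; case: (lerP (- c) 0%R) => h3; lra.
by apply/andP; split; lra.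
Qed.

End integral_near.

(** * Evidence and posterior *)

Section bayes_tree.
Context (R : realType) d (T : measurableType d) (vol : probability T R) (G : seq bool -> set T).
Hypothesis hG : tree_partition vol G.
Variables (alpha u s : R).
Hypotheses (al0 : 0 < alpha) (u01 : 0 <= u <= 1) (s01 : 0 <= s <= 1) (us : u + s = 1).
Implicit Types (z w : seq bool).

(* [k = m - size z]. *)
Fixpoint ev (k : nat) z D : R :=
  if k is k'.+1 then
    u + s * (split_weight alpha (cnt G (rcons z false) D) (cnt G (rcons z true) D) *
             (ev k' (rcons z false) D * ev k' (rcons z true) D))
  else 1.

Let u0 : 0 <= u. Proof. by case/andP: u01. Qed.
Let s0 : 0 <= s. Proof. by case/andP: s01. Qed.

Lemma ev_gt0 k z D : 0 < ev k z D.
Proof.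
elim: k z => [|k ih] z //=.
have X0 : 0 < split_weight alpha (cnt G (rcons z false) D) (cnt G (rcons z true) D) *
             (ev k (rcons z false) D * ev k (rcons z true) D).
  by rewrite mulr_gt0 ?split_weight_gt0 ?mulr_gt0.
have := s0; rewrite le_eqVlt => /predU1P[e|sp].
  by move: us; rewrite -e mul0r => ->.
by rewrite ltr_wpDl// mulr_gt0.
Qed.

Lemma evS_ge_u k z D : u <= ev k.+1 z D.
Proof.
rewrite /= lerDl mulr_ge0// ltW// mulr_gt0 ?split_weight_gt0 ?mulr_gt0 ?ev_gt0//.
Qed.

Lemma ev_ge_u k z D : u <= ev k z D.
Proof. by case: k => [|k]; [case/andP: u01|exact: evS_ge_u]. Qed.

Definition stop_prob m D w : R := u / ev (m - size w) w D.
Definition beta_param D w : R := alpha + (cnt G w D)%:R.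

Lemma stop_prob01 m D w : 0 <= stop_prob m D w <= 1.
Proof.
rewrite /stop_prob divr_ge0 ?(ltW (ev_gt0 _ _ _))//=.
by rewrite ler_pdivrMr ?ev_gt0// mul1r ev_ge_u.
Qed.

Lemma beta_param_gt0 D w : 0 < beta_param D w.
Proof. by rewrite ltr_pwDl. Qed.

(** * Conjugacy: the posterior is again a tree law *)

Section step.
Variables (m : nat) (z : seq bool) (D : seq T).
Hypothesis zm : (size z < m)%N.
Variables (n0 : probability (branching R (rcons z false) m) R)
  (n1 : probability (branching R (rcons z true) m) R).
Variable (f : branching R z m -> \bar R).
Hypotheses (mf : measurable_fun setT f) (f0 : forall q, (0 <= f q)%E).
Local Open Scope ereal_scope.
Local Notation lik z := (likelihood G m z (sublist G z D)).

Let i := cnt G (rcons z false) D.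
Let j := cnt G (rcons z true) D.

(** [Phi] and [Psi] are the integrands of the nested integrals, uncurried, because measurability of
    partial integrals is a statement about functions on products. *)
Let Phi (x : (R * branching R (rcons z false) m) * branching R (rcons z true) m) :=
  `|lik (rcons z true) x.2|%:E * f (node ((x.1.1, 1 - x.1.1)%R, (x.1.2, x.2))).

Let mlik w : measurable_fun setT (fun q : branching R w m => `|lik w q|%:E).
Proof.
apply/measurable_EFinP; apply: measurableT_comp; first exact: normr_measurable.
exact: measurable_likelihood.
Qed.

Let mlik_comp d0 (Y : measurableType d0) w (h : Y -> branching R w m) :
  measurable_fun setT h -> measurable_fun setT (fun y => `|lik w (h y)|%:E).
Proof.
move=> mh; apply/measurable_EFinP; apply: measurableT_comp; first exact: normr_measurable.
exact: (measurableT_comp (@measurable_likelihood R _ _ G m w _) mh).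
Qed.

Let Phi0 y : 0 <= Phi y.
Proof. by rewrite mule_ge0// lee_fin. Qed.

Let mPhi : measurable_fun setT Phi.
Proof.
apply: emeasurable_funM.
  by apply: mlik_comp.
exact: measurable_node_triple.
Qed.

Let Psi (x : R * branching R (rcons z false) m) :=
  `|lik (rcons z false) x.2|%:E * \int[n1]_q1 Phi (x, q1).

Let mPsi : measurable_fun setT Psi.
Proof.
apply: emeasurable_funM.
  by apply: mlik_comp.
by apply: (@measurable_integral_snd _ _ _ _ R n1 Phi mPhi).
Qed.

Let Psi0 y : 0 <= Psi y.
Proof. by rewrite mule_ge0 ?lee_fin// integral_ge0. Qed.

(** A stopped tree has likelihood 1; otherwise the powers of [2 p] and [2 (1 - p)] are absorbed into
    the Beta law at the cost of the factor W. Absolute values make the integrand nonnegative also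
    for collections outside the unit cube. *)
Lemma integral_lik_step :
  \int[branch u alpha alpha n0 n1]_q (`|lik z q|%:E * f q) =
  u%:E * f half_tree + (s * split_weight alpha i j)%:E *
   \int[betaP (alpha + i%:R) (alpha + j%:R)]_p \int[n0]_q0 (`|lik (rcons z false) q0|%:E *
     \int[n1]_q1 (`|lik (rcons z true) q1|%:E * f (node ((p, 1 - p)%R, (q0, q1))))).
Proof.
have mF : measurable_fun setT (fun q => `|lik z q|%:E * f q).
  by apply: emeasurable_funM.
have F0 q : 0 <= `|lik z q|%:E * f q by rewrite mule_ge0// lee_fin.
rewrite integral_branch//; congr (_ + _).
  by rewrite (likelihood_half hG) normr1 mul1e.
have -> : (1 - u = s)%R by rewrite -us addrAC subrr add0r.
rewrite EFinM -muleA; congr (_ * _).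
have mI : measurable_fun setT (fun p : R => \int[n0]_q0 Psi (p, q0)).
  by apply: (@measurable_integral_snd _ _ _ _ R n0 Psi mPsi).
rewrite -integral_betaP_split//; last first.
  move=> p; apply: integral_ge0 => q0 _; apply: mule_ge0; first by rewrite lee_fin.
  by apply: integral_ge0 => q1 _; exact: (Phi0 ((p, q0), q1)).
apply: eq_integral => p _.
rewrite -ge0_integralZl//; last 2 first.
- exact: (measurableT_comp mPsi (pair1_measurable p)).
- by move=> q0 _; exact: (Psi0 (p, q0)).
apply: eq_integral => q0 _; rewrite /Psi muleA -EFinM.
rewrite -ge0_integralZl//; last 2 first.
- exact: (measurableT_comp mPhi (pair1_measurable (p, q0))).
- by move=> q1 _; exact: (Phi0 ((p, q0), q1)).
apply: eq_integral => q1 _; rewrite /Phi/= muleA -EFinM (likelihood_node hG)//=.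
by congr (_%:E * _); rewrite !normrM; ring.
Qed.

End step.

Section posterior_formula.
Local Open Scope ereal_scope.

(** The levels below [m'] are integrated out. All that they leave behind is their evidence, which
    enters the stopping probabilities of the tree of height [m']; this is the sole dependence of the
    marginal posterior on [m]. *)
Lemma integral_lik_restrict k m z m' D (f : branching R z m' -> \bar R) :
  (k + size z)%N = m -> (size z <= m' <= m)%N ->
  measurable_fun setT f -> (forall q, 0 <= f q) ->
  \int[tree_post k m z (fun=> u) (fun=> alpha)]_q
    (`|likelihood G m z (sublist G z D) q|%:E * f (restrict_tree m' q)) =
  (ev k z D)%:E * \int[tree_post (m' - size z) m' z (stop_prob m D) (beta_param D)]_q f q.
Proof.
elim: k z m' f => [|k ih] z m' f kz /andP[zm' mm'] mf f0.
  have e1 : m = size z by rewrite -kz add0n.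
  have e2 : m' = size z by apply/eqP; rewrite eqn_leq zm' -e1 mm'.
  have mF : measurable_fun setT (fun q : branching R z m => `|likelihood G m z (sublist G z D)
      q|%:E * f (restrict_tree m' q)).
    apply: emeasurable_funM.
      apply/measurable_EFinP; apply: measurableT_comp; first exact: normr_measurable.
      exact: measurable_likelihood.
    exact: (measurableT_comp mf (@measurable_restrict R z m m')).
  rewrite [LHS]integral_dirac// diracT mul1e (likelihood_half hG) normr1 mul1e /= mul1e.
  rewrite restrict_half// (_ : (m' - size z)%N = 0%N); last by rewrite e2 subnn.
  by rewrite [RHS]integral_dirac// diracT mul1e.
have zm : (size z < m)%N by rewrite -kz addSn ltnS leq_addl.
have kz' b : (k + size (rcons z b))%N = m by rewrite size_rcons addnS -addSn.
have mfr : measurable_fun setT (fun q : branching R z m => f (restrict_tree m' q)).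
  exact: (measurableT_comp mf (@measurable_restrict R z m m')).
rewrite [tree_post k.+1 _ _ _ _]/=.
rewrite (integral_lik_step _ zm)//.
rewrite restrict_half//.
set i := cnt _ _ _; set j := cnt _ _ _.
set W := split_weight alpha i j; set e0 := ev k (rcons z false) D; set e1 := ev k (rcons z true) D.
have e00 : 0 <= e0%:E by rewrite lee_fin ltW// ev_gt0.
have e10 : 0 <= e1%:E by rewrite lee_fin ltW// ev_gt0.
have evE : ev k.+1 z D = (u + s * (W * (e0 * e1)))%R by [].
(* If [m'] is the length of [z], the test function is constant and each subtree integrates to its
   evidence. *)
have [zm'2|] := ltnP (size z) m'; last first.
  move=> m'z; have e : m' = size z by apply/eqP; rewrite eqn_leq m'z zm'.
  have fE q : f q = f half_tree by subst m'; congr f; exact: branching_leaf.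
  have I b (c : \bar R) : 0 <= c -> \int[tree_post k m (rcons z b) (fun=> u) (fun=> alpha)]_q
      (`|likelihood G m (rcons z b) (sublist G (rcons z b) D) q|%:E * c) = (ev k (rcons z b) D)%:E
          * c.
    move=> c0; have := @ih (rcons z b) (size (rcons z b)) (cst c) (kz' b).
    rewrite leqnn size_rcons zm => /(_ isT (measurable_cst _) (fun=> c0)) ->.
    by rewrite integral_probability_cst.
  transitivity (u%:E * f half_tree + (s * W)%:E * (e0%:E * (e1%:E * f half_tree))).
    congr (_ + _ * _).
    transitivity (\int[betaP (alpha + i%:R) (alpha + j%:R)]_p (e0%:E * (e1%:E * f half_tree)));
        last exact: integral_probability_cst.
    apply: eq_integral => p _; rewrite -I; last by rewrite mule_ge0.
    apply: eq_integral => q0 _; congr (_ * _); rewrite -I//.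
    by apply: eq_integral => q1 _; rewrite fE.
  rewrite (_ : (m' - size z)%N = 0%N); last by rewrite e subnn.
  rewrite [X in _ = _ * X]integral_dirac// diracT mul1e evE EFinD ge0_muleDl ?lee_fin//; last first.
    by rewrite mulr_ge0// mulr_ge0 ?(ltW (split_weight_gt0 al0 _ _))// mulr_ge0.
  by congr (_ + _); rewrite !EFinM !muleA.
have zm'1 b : (size (rcons z b) <= m' <= m)%N by rewrite size_rcons zm'2.
have em : (m' - size z)%N = (m' - size (rcons z false)).+1 by rewrite size_rcons subnSK.
have em2 : (m' - size (rcons z true))%N = (m' - size (rcons z false))%N by rewrite !size_rcons.
pose P0 := tree_post (m' - size (rcons z false)) m' (rcons z false) (stop_prob m D) (beta_param D).
pose P1 := tree_post (m' - size (rcons z true)) m' (rcons z true) (stop_prob m D) (beta_param D).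
pose K (p : R) q0 := \int[P1]_q1 f (node ((p, 1 - p)%R, (q0, q1))).
have mn := measurable_node_pair mf.
have mK2 : measurable_fun setT (fun x : R * branching R (rcons z false) m' => K x.1 x.2).
  apply: (@measurable_integral_snd _ _ _ _ R P1 (fun x : (R * branching R (rcons z false) m') *
      branching R (rcons z true) m' => f (node ((x.1.1, 1 - x.1.1)%R, (x.1.2, x.2))))) => //.
  exact: measurable_node_triple.
have K0 p q0 : 0 <= K p q0 by apply: integral_ge0 => q1 _; exact: f0.
have mKI := @measurable_integral_snd _ _ _ _ R P0 (fun v => K v.1 v.2) mK2 (fun v => K0 v.1 v.2).
transitivity (u%:E * f half_tree + (s * W)%:E * \int[betaP (alpha + i%:R) (alpha + j%:R)]_p
    ((e0 * e1)%:E * \int[P0]_q0 K p q0)).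
  congr (_ + _ * _); apply: eq_integral => p _.
  have mKp : measurable_fun setT (K p) := measurableT_comp mK2 (pair1_measurable p).
  transitivity (\int[tree_post k m (rcons z false) (fun=> u) (fun=> alpha)]_q0
      (`|likelihood G m (rcons z false) (sublist G (rcons z false) D) q0|%:E * (e1%:E * K p
          (restrict_tree m' q0)))).
    apply: eq_integral => q0 _; congr (_ * _).
    rewrite -(ih (rcons z true) m' (fun q1 => f (node ((p, 1 - p)%R, (restrict_tree m' q0, q1)))))
        //.
      by apply: eq_integral => q1 _; rewrite restrict_node.
    exact: (measurableT_comp mn (measurableT_comp (pair1_measurable p) (pair1_measurable
        (restrict_tree m' q0)))).
  rewrite (ih (rcons z false) m' (fun q0 => e1%:E * K p q0))//; last 2 first.
  - exact: emeasurable_funM.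
  - by move=> q0; rewrite mule_ge0.
  by rewrite ge0_integralZl// muleA -EFinM.
rewrite ge0_integralZl//; last 2 first.
- by move=> p _; apply: integral_ge0 => q0 _; exact: K0.
- by rewrite EFinM mule_ge0.
rewrite em [tree_post _.+1 _ _ _ _]/= integral_branch ?stop_prob01//.
set B := \int[betaP _ _]_p \int[P0]_q0 K p q0.
rewrite [X in _ = _ * (_ + _ * X)](_ : _ = B); last by rewrite /B /K /P1 em2.
have B0 : 0 <= B by apply: integral_ge0 => p _; apply: integral_ge0.
clearbody B.
have evk : (k.+1 = m - size z)%N by rewrite -kz addnK.
have ev0 := ev_gt0 k.+1 z D.
(* Evidence times posterior stopping probability is the prior weight [u]; the rest of the evidence
   is exactly the split term of the recursion. *)
have es : (ev k.+1 z D * stop_prob m D z)%R = u by rewrite /stop_prob -evk mulrC divfK ?gt_eqF.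
rewrite ge0_muleDr; last 2 first.
- by rewrite mule_ge0// lee_fin; case/andP: (stop_prob01 m D z).
- by rewrite mule_ge0// lee_fin subr_ge0; case/andP: (stop_prob01 m D z).
rewrite [X in _ = X + _]muleA [X in _ = _ + X]muleA -!EFinM es mulrBr mulr1 es muleA -EFinM; congr
    (_ + _%:E * _).
by rewrite evE; ring.
Qed.

Lemma likelihood_ge0 m z D (q : branching R z m) :
  (forall w, is_index z m w -> 0 <= lookup q w <= 1)%R -> (0 <= likelihood G m z (sublist G z D)
      q)%R.
Proof.
move=> q01; rewrite /likelihood big_filter; apply: prodr_ge0 => x /set_mem gx.
rewrite /likelihood1 big_nat; apply: prodr_ge0 => i /andP[zi im].
have [s1 g1] := addressP hG x i.
rewrite mulr_ge0//; suff iw : is_index z m (address G x i) by case/andP: (q01 _ iw).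
by rewrite /is_index s1 zi -ltnS im (address_prefix hG)// ltnW.
Qed.

Lemma integral_prior_likelihood m m' z D (A : set (branching R z m')) :
  (size z <= m' <= m)%N -> measurable A ->
  \int[prior alpha u s m z]_(q in restrict_tree m' @^-1` A) (likelihood G m z (sublist G z D) q)%:E
      =
  (ev (m - size z) z D)%:E * tree_post (m' - size z) m' z (stop_prob m D) (beta_param D) A.
Proof.
move=> /andP[zm' m'm] mA; have zm := leq_trans zm' m'm.
have kz : (m - size z + size z)%N = m by rewrite subnK.
rewrite /prior (@eq_set_integral _ _ _ _ (tree_post (m - size z) m z (fun=> u) (fun=> alpha)));
    last first.
  by move=> B mB; exact: prior_rec_post.
have mrA : measurable (restrict_tree m' @^-1` A : set (branching R z m)).
  by rewrite -[X in measurable X]setTI; exact: measurable_restrict.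
have ml : measurable_fun [set: branching R z m] (fun q : branching R z m => (likelihood G m z
    (sublist G z D) q)%:E).
  by apply/measurable_EFinP; exact: measurable_likelihood.
rewrite integral_mkcond epatch_indic.
have m1 : measurable_fun [set: branching R z m'] (fun q => (\1_A q)%:E : \bar R).
  by apply/measurable_EFinP; exact: measurable_indic.
(* The prior lives on the unit cube, where the likelihood equals its absolute value. *)
transitivity (\int[tree_post (m - size z) m z (fun=> u) (fun=> alpha)]_q
   (`|likelihood G m z (sublist G z D) q|%:E * (\1_A (restrict_tree m' q : branching R z m'))%:E)).
  have m1r : measurable_fun [set: branching R z m] (fun q : branching R z m => (\1_A (restrict_tree
      m' q : branching R z m'))%:E : \bar R).
    exact: (measurableT_comp m1 (@measurable_restrict R z m m')).
  apply: ae_eq_integral => //.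
  - by apply: emeasurable_funM.
  - apply: emeasurable_funM => //; apply/measurable_EFinP; apply: measurableT_comp; first exact:
      normr_measurable.
    exact: measurable_likelihood.
  - have h01 := @tree_post_ae01 R (m - size z) m z (fun=> u) (fun=> alpha) (fun=> u01) (fun=> al0)
      kz.
    case: h01 => N [mN N0 h]; exists N; split=> // q /= hq; apply: h => /= q01; apply: hq => _.
    by rewrite (ger0_norm (likelihood_ge0 D q01)) /patch indicE muleC.
rewrite (@integral_lik_restrict (m - size z) m z m' D (fun q => (\1_A q)%:E))//; last by rewrite
    zm' m'm.
congr (_ * _).
by rewrite (@integral_indic _ _ _ (tree_post _ _ _ _ _) setT measurableT A mA) setIT.
Qed.

Lemma evidenceE m z D : (size z <= m)%N ->
  evidence G alpha u s m z (sublist G z D) = (ev (m - size z) z D)%:E.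
Proof.
move=> zm; have := @integral_prior_likelihood m m z D setT.
by rewrite preimage_setT zm leqnn => /(_ isT measurableT); rewrite /evidence probability_setT mule1.
Qed.

Lemma marg_posteriorE m m' z D (A : set (branching R z m')) :
  (size z <= m' <= m)%N -> measurable A ->
  marg_posterior G alpha u s m z m' (sublist G z D) A =
  tree_post (m' - size z) m' z (stop_prob m D) (beta_param D) A.
Proof.
move=> /andP[zm' m'm] mA; have zm := leq_trans zm' m'm.
rewrite /marg_posterior /pushforward /posterior integral_prior_likelihood ?zm'//.
have ev0 := ev_gt0 (m - size z) z D.
rewrite evidenceE// muleAC divee ?mul1e//.
by rewrite eqe gt_eqF.
Qed.

(** The prior is the posterior for empty data. *)
Lemma marg_priorE m m' z (A : set (branching R z m')) :
  (size z <= m' <= m)%N -> measurable A ->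
  marg_prior alpha u s m z m' A = tree_post (m' - size z) m' z (stop_prob m [::]) (beta_param [::])
      A.
Proof.
move=> h mA; rewrite -(marg_posteriorE [::] h mA) /marg_prior /marg_posterior /pushforward.
have /andP[zm' m'm] := h; have zm := leq_trans zm' m'm.
have mrA : measurable (restrict_tree m' @^-1` A : set (branching R z m)).
  by rewrite -[X in measurable X]setTI; exact: measurable_restrict.
have I (B : set (branching R z m)) : measurable B ->
   \int[prior alpha u s m z]_(q in B) (likelihood G m z (sublist G z [::]) q)%:E = prior alpha u s
       m z B.
  move=> mB; rewrite /prior (@eq_set_integral _ _ _ _ (tree_post (m - size z) m z (fun=> u) (fun=>
      alpha))); last first.
    by move=> C mC; exact: prior_rec_post.
  under eq_integral do rewrite /likelihood big_nil.
  by rewrite integral_cst// mul1e prior_rec_post.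
rewrite /posterior /evidence !I// /prior [X in _ = _ / X]prior_rec_post//.
by rewrite probability_setT inve1 mule1.
Qed.

Lemma ev_nil k z : ev k z [::] = 1%R.
Proof.
elim: k z => [//|k ih] z /=.
rewrite !ih /split_weight /cnt /sublist /= add0n expr0 mul1r !mulr1 -[RHS]us; congr (_ + _)%R.
by rewrite -[RHS]mulr1; congr (_ * _)%R; rewrite /beta_weight !addr0 divff// gt_eqF//
    beta_const_gt0.
Qed.

(** Without data every evidence is 1, so the stopping probability is [u] whatever the height. *)
Lemma marg_prior_indep m1 m2 m' z (A : set (branching R z m')) :
  (size z <= m')%N -> (m' <= m1)%N -> (m' <= m2)%N -> measurable A ->
  marg_prior alpha u s m1 z m' A = marg_prior alpha u s m2 z m' A.
Proof.
move=> zm' h1 h2 mA; rewrite !marg_priorE ?zm'//.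
rewrite (_ : stop_prob m1 [::] = stop_prob m2 [::])//.
by apply/funext => w; rewrite /stop_prob !ev_nil.
Qed.

End posterior_formula.

(** * Trees of infinite height *)

Lemma cnt_prefix z w D : prefix z w -> (cnt G w D <= cnt G z D)%N.
Proof.
move=> zw; elim: D => [//|x D ih]; rewrite !cnt_cons leq_add//.
have [xw|//] := boolP (x \in G w).
by rewrite (mem_set (cell_prefix hG zw (set_mem xw))).
Qed.

(** If some node beyond the level for [D] still splits [x :: D], then [x] is alone in one of its
    children and meets no point of [D] further down. Repeated points, and points that no cell
    separates, do no harm: they always fall into the same child. *)
Lemma eventually_separated D : exists L, forall z, (L <= size z)%N ->
  cnt G (rcons z false) D = 0%N \/ cnt G (rcons z true) D = 0%N.
Proof.
elim: D => [|x D [L hL]]; first by exists 0%N => z _; left.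
have [[z [Lz [nz0 nz1]]]|H] := pselect (exists z, (L <= size z)%N /\
  cnt G (rcons z false) (x :: D) <> 0%N /\ cnt G (rcons z true) (x :: D) <> 0%N); last first.
  exists L => z Lz; apply: contrapT => /not_orP[h0 h1]; apply: H; by exists z.
have [c [xc Dc]] : exists c, x \in G (rcons z c) /\ cnt G (rcons z c) D = 0%N.
  move: nz0 nz1; rewrite !cnt_cons; case: (hL z Lz) => e; rewrite e addn0.
    by exists false; split=> //; case: (x \in _) nz0.
  by exists true; split=> //; case: (x \in _) nz1.
exists (size z).+1 => z' zz'.
have [xz'|xz'] := boolP (x \in G z'); last first.
  have := cnt_split hG z' (x :: D); rewrite cnt_cons (negbTE xz') add0n.
  have [] := hL z' (leq_trans Lz (ltnW zz')) => e _; [left|right]; rewrite cnt_cons e addn0;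
      apply/eqP;
  rewrite eqb0; apply: contra xz' => /set_mem xz'; exact: mem_set (cell_rcons hG xz').
have pz' : prefix (rcons z c) z'.
  have tz : prefix (take (size z).+1 z') z' := prefix_take _ _.
  rewrite (cell_inj hG _ (set_mem xc) (cell_prefix hG tz (set_mem xz')))//.
  by rewrite size_rcons size_takel.
have D0 : cnt G z' D = 0%N by apply/eqP; rewrite -leqn0 -Dc; exact: cnt_prefix.
have := cnt_split hG z' D; rewrite D0 => /esym/eqP; rewrite addn_eq0 => /andP[/eqP e0 /eqP e1].
rewrite !cnt_cons e0 e1 !addn0.
have := mem_cell_disj hG z' x; case: (x \in _) => /= h; [right|left] => //; by rewrite h.
Qed.

(** Beyond level [L] one child is empty, so an additional level turns a leaf evidence 1 into
    [u + s W] with [W >= 1]; the recursion is monotone and carries this upwards. The condition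
    [j <= k] ensures that the tree reaches level [L]. *)
Lemma ev_separated L D : (forall z, (L <= size z)%N ->
    cnt G (rcons z false) D = 0%N \/ cnt G (rcons z true) D = 0%N) ->
  forall j k z, (L <= size z + j)%N -> (j <= k)%N -> ev k z D <= ev k.+1 z D.
Proof.
move=> hL; have step k z : ev k (rcons z false) D <= ev k.+1 (rcons z false) D ->
    ev k (rcons z true) D <= ev k.+1 (rcons z true) D -> ev k.+1 z D <= ev k.+2 z D.
  move=> h0 h1; rewrite [leLHS]/= [leRHS]/= lerD2l ler_wpM2l// ler_wpM2l ?(ltW (split_weight_gt0
      al0 _ _))//.
  by apply: ler_pM => //; exact/ltW/ev_gt0.
elim=> [|j ih] k z Lz; last first.
  case: k => [//|k]; rewrite ltnS => jk; apply: step; apply: ih => //; by rewrite size_rcons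
      addSnnS.
move=> _; elim: k z Lz => [|k ih] z; rewrite addn0 => Lz.
  rewrite /= !mulr1 -[leLHS]us lerD2l -[leLHS]mulr1 ler_wpM2l//.
  by case: (hL z Lz) => ->; [exact: split_weight_ge1r|exact: split_weight_ge1].
by apply: step; apply: ih; rewrite addn0 size_rcons ltnW.
Qed.

Lemma ev_eventually_nondecreasing z D : exists N, {homo (fun k => ev (k + N) z D) : m n / (m <=
    n)%N >-> m <= n}.
Proof.
have [L hL] := eventually_separated D; exists L.
have nd : nondecreasing_seq (fun k => ev (k + L) z D).
  apply/nondecreasing_seqP => k; rewrite addSn; apply: (ev_separated hL (j := L)); exact: leq_addl.
by move=> m n mn; exact: nd.
Qed.

Lemma cvg_ev z D : cvgn (fun k => (ev k z D)%:E).
Proof.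
have [N nd] := ev_eventually_nondecreasing z D.
have : cvgn (fun k => (ev (k + N) z D)%:E).
  by apply: ereal_nondecreasing_is_cvgn => m n mn; rewrite lee_fin nd.
by move=> /cvg_ex[l h]; apply/cvg_ex; exists l; rewrite -(cvg_shiftn N).
Qed.

Lemma cvg_evidence z D : cvg (evidence G alpha u s m z (sublist G z D) @[m --> \oo]).
Proof.
have /cvg_ex[l h] := @cvg_ev z D; apply/cvg_ex; exists l; rewrite -(cvg_shiftn (size z)).
by apply: cvg_trans h; apply: near_eq_cvg; apply: nearW => k /=; rewrite evidenceE ?leq_addl//
    addnK.
Qed.

Lemma cvg_stop_prob D w : cvgn (fun m => stop_prob m D w).
Proof.
have [N nd] := ev_eventually_nondecreasing w D.
have : cvgn (fun k => stop_prob (k + (N + size w)) D w).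
  apply: nonincreasing_is_cvgn => [m n mn|]; last first.
    by exists 0 => _ [n _ <-]; case/andP: (stop_prob01 (n + (N + size w)) D w).
  rewrite /stop_prob !addnA !addnK ler_wpM2l// lef_pV2 ?posrE ?ev_gt0//; exact: nd.
by move=> /cvg_ex[l h]; apply/cvg_ex; exists l; rewrite -(cvg_shiftn (N + size w)).
Qed.

(** A limit of quotients rather than [u] over the limit, because the evidence may tend to
    infinity. *)
Definition stop_prob_h (m : option nat) D w : R :=
  if m is Some m0 then stop_prob m0 D w else lim (stop_prob k D w @[k --> \oo]).

Lemma stop_prob_h01 m D w : 0 <= stop_prob_h m D w <= 1.
Proof.
case: m => [m|] /=; first exact: stop_prob01.
apply/andP; split.
  by apply: limr_ge; [exact: cvg_stop_prob|apply: nearW => n; case/andP: (stop_prob01 n D w)].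
by apply: limr_le; [exact: cvg_stop_prob|apply: nearW => n; case/andP: (stop_prob01 n D w)].
Qed.

Lemma cvg_marg_posterior m' z D (A : set (branching R z m')) : (size z <= m')%N -> measurable A ->
  marg_posterior G alpha u s m z m' (sublist G z D) A @[m --> \oo] -->
  tree_post (m' - size z) m' z (stop_prob_h None D) (beta_param D) A.
Proof.
move=> zm' mA.
have h := @tree_post_cvg R (fun n => stop_prob n D) (stop_prob_h None D) (beta_param D) (m' - size
    z) m' z A (fun n => stop_prob01 n D)
  (stop_prob_h01 None D) (@cvg_stop_prob D) mA.
apply: cvg_trans h; apply: near_eq_cvg; exists m' => // m /= m'm.
by rewrite marg_posteriorE// zm'.
Qed.

Lemma marg_posterior_hE m m' z D (A : set (branching R z m')) : (size z <= m')%N ->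
  le_height m' m -> measurable A ->
  marg_posterior_h G alpha u s m z m' (sublist G z D) A =
  tree_post (m' - size z) m' z (stop_prob_h m D) (beta_param D) A.
Proof.
move=> zm'; case: m => [m|_] /=; first by move=> m'm mA; rewrite marg_posteriorE// zm'.
by move=> mA; apply/cvg_lim => //; exact: cvg_marg_posterior.
Qed.

Lemma cvg_marg_prior m' z (A : set (branching R z m')) : (size z <= m')%N -> measurable A ->
  marg_prior alpha u s m z m' A @[m --> \oo] --> marg_prior alpha u s m' z m' A.
Proof.
move=> zm' mA; apply: (@cvg_trans _ (marg_prior alpha u s m' z m' A @[m --> \oo])); last exact:
    cvg_cst.
apply: near_eq_cvg; exists m' => // m /= m'm; exact: marg_prior_indep.
Qed.

Lemma marg_prior_hE m m' z (A : set (branching R z m')) : (size z <= m')%N ->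
  le_height m' m -> measurable A ->
  marg_prior_h alpha u s m z m' A = marg_prior alpha u s m' z m' A.
Proof.
move=> zm'; case: m => [m|_] /=; first by move=> m'm mA; exact: marg_prior_indep.
by move=> mA; apply/cvg_lim => //; exact: cvg_marg_prior.
Qed.

(** * Exponential growth of the evidence *)

Lemma ev_step_ge k z b D : s * u * (split_weight alpha (cnt G (rcons z false) D) (cnt G (rcons z
    true) D) *
  ev k (rcons z b) D) <= ev k.+1 z D.
Proof.
rewrite [leRHS]/= ler_wpDl// -mulrA ler_wpM2l// mulrCA ler_wpM2l ?(ltW (split_weight_gt0 al0 _
    _))//.
by case: b; [|rewrite [leRHS]mulrC]; rewrite ler_wpM2r ?(ltW (ev_gt0 _ _ _)) ?ev_ge_u.
Qed.

(** At every node of the path only the split term is kept, and the child off the path is bounded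
    below by [u]. The constant [K] depends neither on the data nor on the number [j] of further
    levels, which makes the growth uniform in the height. *)
Lemma ev_path_ge (k : R) y : 0 < u * s -> 0 < k -> exists2 K, 0 < K & forall D z j,
  K * (expR (- (k * (size y * cnt G z D)%:R)) * ev j (z ++ y) D) <= ev (size y + j) z D.
Proof.
move=> us0 k0; have su0 : 0 < s * u by rewrite mulrC.
have [C C0 hC] := split_weight_ge_half al0 k0.
elim: y => [|b y [K K0 ih]].
  by exists 1 => // D z j; rewrite mul1r mul0n mulr0 oppr0 expR0 mul1r cats0.
exists (s * u * (C * K)); first by rewrite (mulr_gt0 su0)// mulr_gt0.
move=> D z j; apply: le_trans (ev_step_ge _ _ b _); rewrite -[leLHS]mulrA.
apply: ler_wpM2l; first exact: ltW.
have := ih D (rcons z b) j; rewrite cat_rcons => {}ih.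
have cz : (cnt G (rcons z b) D <= cnt G z D)%N by rewrite (cnt_split hG z D); case: b {ih}; rewrite
    ?leq_addl ?leq_addr.
apply: (@le_trans _ _ (C * expR (- (k * (cnt G z D)%:R)) * (K * (expR (- (k * (size y * cnt G
    (rcons z b) D)%:R)) * ev j (z ++ b :: y) D)))).
  have -> : C * expR (- (k * (cnt G z D)%:R)) * (K * (expR (- (k * (size y * cnt G (rcons z b)
      D)%:R)) * ev j (z ++ b :: y) D)) =
     C * K * (expR (- (k * (cnt G z D)%:R)) * expR (- (k * (size y * cnt G (rcons z b) D)%:R)) * ev
         j (z ++ b :: y) D) by ring.
  rewrite ler_wpM2l ?mulr_ge0 ?(ltW C0) ?(ltW K0)// ler_wpM2r ?(ltW (ev_gt0 _ _ _))//.
  rewrite -expRD ler_expR -opprD lerN2 -mulrDr ler_wpM2l ?(ltW k0)// -natrD ler_nat /= mulSn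
      leq_add2l.
  by rewrite leq_mul2l cz orbT.
apply: ler_pM => //.
- by rewrite mulr_ge0 ?expR_ge0 ?(ltW C0).
- by rewrite !mulr_ge0 ?expR_ge0 ?(ltW K0) ?(ltW (ev_gt0 _ _ _)).
- by rewrite (cnt_split hG z D); exact: hC.
Qed.

Section sample.
Variables (p qdot : seq bool -> R).
Hypotheses (q0 : forall w, 0 <= qdot w)
  (q1 : forall w, qdot (rcons w false) + qdot (rcons w true) = 1)
  (pq : forall w b, p (rcons w b) = qdot (rcons w b) * p w).

(** What almost every sample satisfies. The estimates that follow concern one fixed sequence of data
    with this property and involve no probability on the sample. *)
Definition sample_freq (D : nat -> seq T) : Prop :=
  (forall n, (size (D n) <= n)%N) /\
  forall w (e : R), 0 < e -> exists N, forall n, (N <= n)%N -> `|(cnt G w (D n))%:R - p w * n%:R|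
      <= e * n%:R.

Lemma sample_cnt_ge D w : sample_freq D -> 0 < p w ->
  exists N, forall n, (N <= n)%N -> p w / 2 * n%:R <= (cnt G w (D n))%:R.
Proof.
move=> [_ hD] pw; have [|N hN] := hD w (p w / 2); first by rewrite divr_gt0.
by exists N => n /hN; rewrite ler_distl => /andP[+ _]; lra.
Qed.

Lemma sample_child D w b (e : R) : sample_freq D -> 0 < p w -> 0 < e ->
  exists N, forall n, (N <= n)%N ->
  `|(cnt G (rcons w b) (D n))%:R - qdot (rcons w b) * (cnt G w (D n))%:R| <= e * (cnt G w (D n))%:R.
Proof.
move=> hD pw e0; have [N1 h1] := sample_cnt_ge hD pw; have [_ {}hD] := hD.
(* Two frequency errors of this size add up to [e (p w / 2) n], and [w] eventually holds at least
   [(p w / 2) n] points. *)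
have e'0 : 0 < e * p w / 4 by rewrite divr_gt0// mulr_gt0.
have [N2 h2] := hD w _ e'0; have [N3 h3] := hD (rcons w b) _ e'0.
exists (maxn N1 (maxn N2 N3)) => n; rewrite !geq_max => /and3P[/h1 a1 /h2 a2 /h3 a3].
have qle : qdot (rcons w b) <= 1.
  by rewrite -(q1 w); case: b {h3 a3}; rewrite ?lerDl ?lerDr.
rewrite (_ : _ - _ = (cnt G (rcons w b) (D n))%:R - p (rcons w b) * n%:R - qdot (rcons w b) * ((cnt
    G w (D n))%:R - p w * n%:R)); last first.
  by rewrite pq; ring.
apply: le_trans (ler_normB _ _) _; rewrite normrM (ger0_norm (q0 _)).
have : qdot (rcons w b) * `|(cnt G w (D n))%:R - p w * n%:R| <= e * p w / 4 * n%:R.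
  by apply: le_trans a2; rewrite ler_piMl.
have : e * (p w / 2 * n%:R) <= e * (cnt G w (D n))%:R by rewrite ler_wpM2l// ltW.
lra.
Qed.

Lemma expR_natM_unbounded (K c : R) : 0 < K -> 0 < c ->
  exists N, forall n, (N <= n)%N -> 1 <= K * expR (c * n%:R).
Proof.
move=> K0 c0; exists (Num.bound (K^-1 / c)) => n hn.
have : K^-1 / c < n%:R.
  apply: lt_le_trans (archi_boundP _) _; first by apply: divr_ge0; [rewrite invr_ge0|]; exact: ltW.
  by rewrite ler_nat.
rewrite ltr_pdivrMr// => h; have := expR_ge1Dx (c * n%:R) => h2.
rewrite -[leLHS](divff (lt0r_neq0 K0)) ler_wpM2l ?(ltW K0)//; move: h; move: K^-1 => x h; lra.
Qed.

Lemma ev_growth z y : 0 < u * s -> 0 < p (z ++ y) -> qdot (rcons (z ++ y) false) != 2^-1 ->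
  exists2 c, 0 < c & forall D, sample_freq D -> exists N, forall n, (N <= n)%N -> forall k, (size y
      < k)%N ->
    expR (c * n%:R) <= ev k z (D n).
Proof.
move=> us0; set w := z ++ y => pw qw.
have u1 : 0 < u by rewrite lt_neqAle u0 andbT; apply: contraTneq us0 => <-; rewrite mul0r ltxx.
have t01 : 0 <= qdot (rcons w false) <= 1 by rewrite q0/= -(q1 w) lerDl.
have [c [e [C [c0 e0 C0 hW]]]] := split_weight_ge_biased al0 t01 qw.
(* The unfair split gains at least the rate [c p w / 2], and the path loses at most [c p w / 4].
   Half of the difference absorbs the constant factors, which leaves [c p w / 8]. The successor
   avoids a division by 0 for empty [y]. *)
pose k := c * p w / (4 * (size y).+1%:R).
have k0 : 0 < k by rewrite divr_gt0 ?mulr_gt0.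
have [K K0 hK] := ev_path_ge y us0 k0.
have c'0 : 0 < c * p w / 8 by rewrite divr_gt0// mulr_gt0.
exists (c * p w / 8) => // D hD.
have [N1 h1] := sample_child false hD pw e0.
have [N2 h2] := sample_cnt_ge hD pw.
have su0 : 0 < s * u by rewrite mulrC.
have K'0 : 0 < K * (s * u * (C * u)) by rewrite (mulr_gt0 K0)// (mulr_gt0 su0)// mulr_gt0.
have [N3 h3] := expR_natM_unbounded K'0 c'0.
exists (maxn N1 (maxn N2 N3)) => n; rewrite !geq_max => /and3P[/h1 a1 /h2 a2 /h3 a3] j yj.
(* At least one level remains below [w], so that its unfair split takes part in the evidence. *)
have -> : j = (size y + (j - (size y).+1).+1)%N by rewrite -addSnnS subnKC.
apply: le_trans (hK (D n) z _).
set i := (j - _)%N.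
have b1 : s * u * (C * u) * expR (c * (p w / 2 * n%:R)) <= ev i.+1 w (D n).
  apply: le_trans (ev_step_ge _ _ false _).
  rewrite -[leLHS]mulrA; apply: ler_wpM2l; first exact: ltW.
  rewrite mulrAC; apply: ler_pM; rewrite ?mulr_ge0 ?expR_ge0 ?(ltW C0) ?ev_ge_u//.
  have hWw := hW (cnt G (rcons w false) (D n)) (cnt G (rcons w true) (D n)).
  rewrite -(cnt_split hG) in hWw; apply: le_trans (hWw a1).
  by rewrite ler_wpM2l ?(ltW C0)// ler_expR ler_wpM2l// ltW.
have b2 : expR (- (c * p w / 4 * n%:R)) <= expR (- (k * (size y * cnt G z (D n))%:R)).
  have kE : k * (size y).+1%:R = c * p w / 4 by rewrite /k; field.
  have kc : k * (size y)%:R <= c * p w / 4 by rewrite -kE ler_wpM2l ?(ltW k0)// ler_nat.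
  have cn : (cnt G z (D n))%:R <= n%:R :> R.
    by rewrite ler_nat; apply: leq_trans (proj1 hD n); rewrite /cnt size_filter count_size.
  by rewrite ler_expR lerN2 natrM mulrA; apply: ler_pM => //; rewrite mulr_ge0// ltW.
apply: (@le_trans _ _ (K * (expR (- (c * p w / 4 * n%:R)) * (s * u * (C * u) * expR (c * (p w / 2 *
    n%:R)))))); last first.
  rewrite ler_wpM2l ?(ltW K0)//; apply: ler_pM => //; rewrite ?expR_ge0//.
  by rewrite mulr_ge0 ?expR_ge0// !mulr_ge0// ltW.
have -> : K * (expR (- (c * p w / 4 * n%:R)) * (s * u * (C * u) * expR (c * (p w / 2 * n%:R)))) =
  K * (s * u * (C * u)) * (expR (- (c * p w / 4 * n%:R)) * expR (c * (p w / 2 * n%:R))) by ring.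
rewrite -expRD.
have -> : - (c * p w / 4 * n%:R) + c * (p w / 2 * n%:R) = c * p w / 8 * n%:R + c * p w / 8 * n%:R
    by field.
by rewrite expRD [leRHS]mulrA ler_peMl// expR_ge0.
Qed.

(** For [u = 0] the tree never stops inside; otherwise the evidence explodes. The bound is uniform
    over finite heights and therefore passes to the infinite one. *)
Lemma stop_prob_cvg0 D z y (e : R) : sample_freq D -> 0 < s -> 0 < p (z ++ y) ->
  qdot (rcons (z ++ y) false) != 2^-1 -> 0 < e ->
  exists N, forall n, (N <= n)%N -> forall m, le_height (size (z ++ y)).+1 m -> stop_prob_h m (D n)
      z <= e.
Proof.
move=> hD s1 pw qw e0.
have H : exists N, forall n, (N <= n)%N -> forall m, (size (z ++ y) < m)%N -> stop_prob m (D n) z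
    <= e.
  have [u1|u1] := ltP 0 u; last first.
    exists 0%N => n _ m _; rewrite /stop_prob (_ : u = 0) ?mul0r ?ltW//.
    by apply/eqP; rewrite eq_le u1 u0.
  have [c c0 h] := @ev_growth z y (mulr_gt0 u1 s1) pw qw.
  have [N1 h1] := h D hD; have [N2 h2] := expR_natM_unbounded e0 c0.
  exists (maxn N1 N2) => n; rewrite geq_max => /andP[/h1 a1 /h2 a2] m wm.
  rewrite /stop_prob ler_pdivrMr ?ev_gt0//.
  apply: (@le_trans _ _ (e * expR (c * n%:R))).
    by apply: le_trans a2; case/andP: u01.
  by rewrite ler_wpM2l ?(ltW e0)// a1// ltn_subRL -size_cat.
have [N hN] := H; exists N => n Nn [m|_] /=; first exact: hN.
apply: limr_le; first exact: cvg_stop_prob.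
by exists (size (z ++ y)).+1 => // m /= wm; exact: hN.
Qed.

(** * Concentration of the posterior *)

Variable D : nat -> seq T.
Hypothesis hD : sample_freq D.

Definition sqdist w (x : R) : \bar R := ((x - qdot w) ^+ 2)%:E.

Lemma measurable_sqdist w : measurable_fun setT (sqdist w).
Proof. by apply/measurable_EFinP; apply: measurable_funX; exact: measurable_funB. Qed.

Lemma sqdist_ge0 w x : (0 <= sqdist w x)%E.
Proof. by rewrite lee_fin sqr_ge0. Qed.

Lemma qdot01 w b : 0 <= qdot (rcons w b) <= 1.
Proof. by rewrite q0/= -(q1 w); case: b; rewrite ?lerDl ?lerDr. Qed.

Lemma qdot_half w b : (qdot (rcons w b) == 2^-1) = (qdot (rcons w false) == 2^-1).
Proof.
case: b => //; have := q1 w => h.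
by apply/eqP/eqP; lra.
Qed.

(** Stopping at [z] sets the coordinate to 1/2. Either this is its true value, or the node above it
    is unfair and stopping becomes improbable. *)
Lemma stop_sqdist_cvg0 z y b (e : R) : 0 < p (z ++ y) -> 0 < s \/ qdot (rcons (z ++ y) b) = 2^-1 ->
    0 < e ->
  exists N, forall n, (N <= n)%N -> forall m, le_height (size (z ++ y)).+1 m ->
    ((stop_prob_h m (D n) z)%:E * sqdist (rcons (z ++ y) b) 2^-1 <= e%:E)%E.
Proof.
move=> pw hs e0.
have [qw|qw] := eqVneq (qdot (rcons (z ++ y) b)) 2^-1.
  by exists 0%N => n _ m _; rewrite /sqdist qw subrr expr0n/= mule0 lee_fin ltW.
have s1 : 0 < s by case: hs => // h; rewrite h eqxx in qw.
rewrite qdot_half in qw.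
have [N hN] := stop_prob_cvg0 hD s1 pw qw e0.
exists N => n /hN h m /h {}h; rewrite -EFinM lee_fin.
apply: le_trans h; rewrite ler_piMr//; first by case/andP: (stop_prob_h01 m (D n) z).
have /andP[a0 a1] := qdot01 (z ++ y) b.
by rewrite expr2; nra.
Qed.

Lemma beta_sqdist_cvg0 w b (e : R) : 0 < p w -> 0 < e ->
  exists N, forall n, (N <= n)%N ->
   (\int[betaP (beta_param (D n) (rcons w false)) (beta_param (D n) (rcons w true))]_x
     sqdist (rcons w b) (if b then 1 - x else x)%R <= e%:E)%E.
Proof.
move=> pw e0.
pose t := qdot (rcons w false).
(* With the tolerance capped at 1, the squared bias is at most the absolute bias. *)
have e4 : 0 < Num.min e 1 / 4 by rewrite divr_gt0// lt_min e0/=.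
have [N1 h1] := sample_child false hD pw e4.
have [N2 h2] := sample_cnt_ge hD pw.
(* With [M] points in the cell, both the variance bound [1 / (a + c)] and the share of the
   pseudocount [alpha] in [a + c] are at most a quarter of the tolerance. *)
pose M := (2 * alpha + 1) * 4 / Num.min e 1.
have e1 : 0 < Num.min e 1 by rewrite lt_min e0/=.
have M0 : 0 < M by rewrite divr_gt0// mulr_gt0// ltr_wpDl// mulr_ge0// ltW.
have x0 : 0 <= M / (p w / 2) by rewrite divr_ge0 ?(ltW M0)// divr_ge0// ltW.
exists (maxn N1 (maxn N2 (Num.bound (M / (p w / 2))))) => n; rewrite !geq_max => /and3P[/h1 a1 /h2
    a2 a3].
have bE v : beta_param (D n) v = alpha + (cnt G v (D n))%:R by [].
set a := beta_param _ _; set c := beta_param _ _.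
have aE : a + c = 2 * alpha + (cnt G w (D n))%:R.
  by rewrite /a /c !bE (cnt_split hG w) natrD; ring.
have -> : (\int[betaP a c]_x sqdist (rcons w b) (if b then 1 - x else x)%R = \int[betaP a c]_x ((x
    - t) ^+ 2)%:E)%E.
  apply: eq_integral => x _; rewrite /sqdist; congr (_%:E); case: b => //.
  by rewrite /t -(sqrrN (x - _)); congr (_ ^+ 2); rewrite -(q1 w); ring.
apply: le_trans (integral_betaP_sqr _ _ _) _; rewrite ?beta_param_gt0 ?q0//.
set N := (cnt G w (D n))%:R : R.
have NM : M <= N.
  apply: le_trans a2; rewrite mulrC -ler_pdivrMr ?divr_gt0//.
  apply: le_trans (ltW (archi_boundP x0)) _; by rewrite ler_nat.
have M4 : 4 <= M.
  rewrite /M ler_pdivlMr// mulrC ler_pM2r//; have : Num.min e 1 <= 1 by rewrite ge_min lexx orbT.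
  by have := al0; lra.
have N0 : 0 < N by lra.
have ac0 : 0 < a + c by rewrite aE; have := al0; lra.
have K1 : (a + c)^-1 <= Num.min e 1 / 4.
  rewrite -[leRHS]invrK invf_div lef_pV2 ?posrE// ?divr_gt0//.
  apply: (@le_trans _ _ M); last by rewrite aE; have := al0; lra.
  by rewrite /M ler_pM2r ?invr_gt0//; have := al0; lra.
have K2 : `|a / (a + c) - t| <= Num.min e 1 / 2.
  have -> : a / (a + c) - t = (alpha * (1 - 2 * t) + ((cnt G (rcons w false) (D n))%:R - t * N)) /
      (a + c).
    rewrite -[X in _ - X](mulfK (lt0r_neq0 ac0)) -mulrBl; congr (_ / _).
    by rewrite aE /a bE; ring.
  rewrite normrM normfV (gtr0_norm ac0) ler_pdivrMr//.
  apply: le_trans (ler_normD _ _) _; rewrite normrM (gtr0_norm al0).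
  have t1 : `|1 - 2 * t| <= 1.
    have /andP[a0' a1'] := qdot01 w false; rewrite ler_norml; apply/andP; split; rewrite /t; lra.
  have b1 : alpha * `|1 - 2 * t| <= alpha by rewrite ler_piMr// ltW.
  have b2 : alpha <= Num.min e 1 / 4 * (a + c).
    apply: (@le_trans _ _ (Num.min e 1 / 4 * M)).
      by rewrite /M [leRHS](_ : _ = 2 * alpha + 1); [have := al0; lra|field; rewrite gt_eqF].
    by rewrite ler_wpM2l ?(ltW e4)// aE; have := al0; lra.
  have b3 : Num.min e 1 / 4 * N <= Num.min e 1 / 4 * (a + c).
    by rewrite ler_wpM2l ?(ltW e4)// aE; have := al0; lra.
  move: a1; rewrite -/N -/t => a1; lra.
have K3 : (a / (a + c) - t) ^+ 2 <= Num.min e 1 / 2.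
  rewrite -real_normK ?num_real// expr2; apply: (@le_trans _ _ (1 * `|a / (a + c) - t|)); last by
      rewrite mul1r.
  rewrite ler_wpM2r//; apply: le_trans K2 _; have : Num.min e 1 <= 1 by rewrite ge_min lexx orbT.
  lra.
rewrite lee_fin; have : Num.min e 1 <= e by rewrite ge_min lexx.
move: K1 K3; move: ((a + c)^-1) ((_ - _) ^+ 2) => *; lra.
Qed.

(** Induction along the path: at each node half of the tolerance pays for stopping there, the other
    half for the subtree, and at the end for the Beta law. *)
Lemma tree_post_sqdist_cvg0 m' y b z k (e : R) : (k + size z)%N = m' -> (size (z ++ y) < m')%N ->
  0 < p (z ++ y) -> 0 < s \/ qdot (rcons (z ++ y) b) = 2^-1 -> 0 < e ->
  exists N, forall n, (N <= n)%N -> forall m, le_height m' m ->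
   (\int[tree_post k m' z (stop_prob_h m (D n)) (beta_param (D n))]_q
      sqdist (rcons (z ++ y) b) (lookup q (rcons (z ++ y) b)) <= e%:E)%E.
Proof.
move=> kz ym pw hs e0; elim: y z k e kz ym pw hs e0 => [|c y ih] z k e kz ym pw hs e0.
  rewrite cats0 in ym pw hs *.
  have e2 : 0 < e / 2 by rewrite divr_gt0.
  have [] := @stop_sqdist_cvg0 z [::] b (e / 2); rewrite ?cats0// => N1 h1.
  have [N2 h2] := beta_sqdist_cvg0 b pw e2.
  exists (maxn N1 N2) => n; rewrite geq_max => /andP[/h1 {}h1 /h2 {}h2] m hm.
  have {}h1 := h1 m _.
  have km : k = (k.-1).+1 by rewrite prednK// -(ltn_add2r (size z)) kz add0n.
  rewrite km /= (@integral_branch_child R z m' _ _ _ _ _ (sqdist (rcons z b)) b (stop_prob_h01 m (D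
      n) z) ym (@measurable_sqdist _) (@sqdist_ge0 _)).
  have /andP[g0 g1] := stop_prob_h01 m (D n) z.
  rewrite [leRHS](_ : _ = (e / 2)%:E + (e / 2)%:E)%E; last by rewrite -EFinD -splitr.
  apply: leeD.
    by apply: h1; case: m hm {g0 g1} => //= m; exact: leq_trans.
  apply: le_trans h2; apply: gee_pMl.
  - by rewrite fin_numE.
  - by apply: integral_ge0 => x _; exact: sqdist_ge0.
  - by rewrite lee_fin; lra.
rewrite -cat_rcons in ym pw hs *.
have e2 : 0 < e / 2 by rewrite divr_gt0.
have km : k = (k.-1).+1.
  rewrite prednK// -(ltn_add2r (size z)) kz add0n; apply: leq_ltn_trans ym.
  by rewrite cat_rcons size_cat leq_addr.
have kz' : (k.-1 + size (rcons z c))%N = m' by rewrite size_rcons addnS -addSn -km.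
have [N2 h2] := ih (rcons z c) k.-1 _ kz' ym pw hs e2.
have [] := @stop_sqdist_cvg0 z (c :: y) b (e / 2); rewrite -?cat_rcons// => N1 h1.
exists (maxn N1 N2) => n; rewrite geq_max => /andP[/h1 {}h1 /h2 {}h2] m hm.
have {}h1 := h1 m _; have {}h2 := h2 m hm.
have /andP[g0 g1] := stop_prob_h01 m (D n) z.
have pw' := prefix_trans (prefix_prefix (rcons z c) y) (prefix_rcons (rcons z c ++ y) b).
have sw : (size (rcons z c) < size (rcons (rcons z c ++ y) b) <= m')%N.
  by rewrite (size_rcons _ b) ym andbT ltnS size_cat leq_addr.
rewrite km /= (@integral_branch_desc R z m' _ _ _ _ _ (sqdist (rcons (rcons z c ++ y) b)) c _
    (stop_prob_h01 m (D n) z)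
  pw' sw (@measurable_sqdist _) (@sqdist_ge0 _)).
rewrite [leRHS](_ : _ = (e / 2)%:E + (e / 2)%:E)%E; last by rewrite -EFinD -splitr.
apply: leeD.
  by apply: h1; case: m hm {h2 g0 g1} => //= m; exact: leq_trans.
have {}h2 : ((if c then \int[tree_post k.-1 m' (rcons z true) (stop_prob_h m (D n)) (beta_param (D
    n))]_q
      sqdist (rcons (rcons z c ++ y) b) (lookup q (rcons (rcons z c ++ y) b)) else
     \int[tree_post k.-1 m' (rcons z false) (stop_prob_h m (D n)) (beta_param (D n))]_q
      sqdist (rcons (rcons z c ++ y) b) (lookup q (rcons (rcons z c ++ y) b))) <= (e / 2)%:E)%E.
  by case: c {ym pw hs kz' ih h1 pw' sw} h2.
apply: le_trans h2; apply: gee_pMl.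
- by rewrite fin_numE.
- by case: (c); apply: integral_ge0 => x _; exact: sqdist_ge0.
- by rewrite lee_fin; lra.
Qed.

Section posterior_near.
Variables (z : seq bool) (m' : nat).
Hypothesis zm' : (size z <= m')%N.
Hypothesis hs : 0 < s \/ forall w, is_index z m' w -> qdot w = 2^-1.

(* The data determine [q_w] asymptotically only if the parent cell of [w] has positive mass. *)
Definition observable w : bool := is_index z m' w && (0 < p (take (size w).-1 w)).

Definition in_cube (q : branching R z m') : Prop :=
  forall w, is_index z m' w -> 0 <= lookup q w <= 1.

Definition close_to (e : R) : set (branching R z m') :=
  [set q | in_cube q /\ forall w, observable w -> `|lookup q w - qdot w| < e].

(** Closeness to the true tree in the observable coordinates only; all other coordinates range
    freely over the unit interval. *)
Definition observable_nbhs : set_system (branching R z m') :=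
  filter_from [set e : R | 0 < e] close_to.

Global Instance observable_nbhs_filter : Filter observable_nbhs.
Proof.
apply: filter_from_filter; first by exists 1 => /=.
move=> i j /= i0 j0; exists (Num.min i j); first by rewrite /= lt_min i0.
by move=> q [cq hq]; split; split=> // w /hq; rewrite lt_min => /andP[].
Qed.

Lemma half_tree_in_cube : in_cube half_tree.
Proof. by move=> w iw; rewrite lookup_half//; apply/andP; split; lra. Qed.

Lemma tree_post_sqdist_observable w (e : R) : observable w -> 0 < e ->
  exists N, forall n, (N <= n)%N -> forall m, le_height m' m ->
   (\int[tree_post (m' - size z) m' z (stop_prob_h m (D n)) (beta_param (D n))]_q
      sqdist w (lookup q w) <= e%:E)%E.
Proof.
move=> /andP[iw pw] e0; have /and3P[/prefixP[y wE] zw wm] := iw.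
case/lastP: y => [|y b] in wE *; first by rewrite wE cats0 ltnn in zw.
rewrite -rcons_cat in wE; subst w; rewrite size_rcons /= in wm pw.
rewrite -cats1 take_cat ltnn subnn take0 cats0 in pw.
apply: tree_post_sqdist_cvg0 => //; first by rewrite subnK.
by case: hs => [|/(_ _ iw)]; [left|right].
Qed.

(** An infinite penalty off the unit interval: it makes a majorant valid for trees outside the cube
    and costs nothing under laws that live on the cube. *)
Let out (x : R) : \bar R := if 0 <= x <= 1 then 0%E else +oo%E.

Let mout : measurable_fun setT out.
Proof.
apply: measurable_fun_ifT => //.
by apply: measurable_and; apply: measurable_fun_ler => //; exact: measurable_cst.
Qed.

Let out0 x : (0 <= out x)%E. Proof. by rewrite /out; case: ifP. Qed.

(** Chebyshev's argument. Within distance [dl] of the limit [|f - c|] is small; farther away inside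
    the cube it is at most [M], hence at most [M / dl^2] times the squared distance of some
    observable coordinate; outside the cube a penalty takes over. *)
Lemma integral_close_to (f : branching R z m' -> R) (c M e : R) :
  f q @[q --> observable_nbhs] --> c -> (forall q, in_cube q -> `|f q - c| <= M) -> 0 < e ->
  exists2 eta : R, 0 < eta & forall P : probability (branching R z m') R,
    (forall w, observable w -> (\int[P]_q sqdist w (lookup q w) <= eta%:E)%E) ->
    (forall w, is_index z m' w -> (\int[P]_q out (lookup q w) = 0)%E) ->
    `|fine (\int[P]_q (f q)%:E)%E - c| < e.
Proof.
move=> fc fM e0.
have M0 : 0 <= M := le_trans (normr_ge0 _) (fM _ half_tree_in_cube).
have e8 : 0 < e / 8 by rewrite divr_gt0.
have /cvgrPdist_lt/(_ _ e8)[dl /= d0 hd] := fc.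
(* Bounded strings form a finite type over which the coordinates can be summed; it contains all
   indices. *)
pose I := {bseq m' of bool}.
pose K := M / dl ^+ 2.
have K0 : 0 <= K by rewrite divr_ge0// sqr_ge0.
(* All the moment terms together contribute at most [e / 8], so the majorant integrates to at most
   [e / 4], and the factor 2 of [integral_near] still leaves less than [e]. *)
pose eta := e / 8 / (K * #|I|%:R + 1).
have K1 : 0 < K * #|I|%:R + 1 by rewrite ltr_wpDl// mulr_ge0.
have eta0 : 0 < eta by rewrite divr_gt0.
exists eta => // P hobs hout.
pose A (w : I) (q : branching R z m') : \bar R := if observable w then (K%:E * sqdist w (lookup q
    w))%E else 0%E.
pose B (w : I) (q : branching R z m') : \bar R := if is_index z m' w then out (lookup q w) else 0%E.
pose H q := ((e / 8)%:E + (\sum_w A w q + \sum_w B w q))%E.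
have mA (w : I) : measurable_fun setT (A w).
  rewrite /A; case: (observable w) => //; apply: emeasurable_funM => //.
  exact: (measurable_phi_lookup _ (@measurable_sqdist w)).
have mB (w : I) : measurable_fun setT (B w).
  by rewrite /B; case: (is_index z m' w) => //; exact: (measurable_phi_lookup _ mout).
have A0 (w : I) q : (0 <= A w q)%E by rewrite /A; case: ifP => // _; exact: mule_ge0 (sqdist_ge0 _
    _).
have B0 (w : I) q : (0 <= B w q)%E by rewrite /B; case: ifP.
have mSA : measurable_fun setT (fun q => \sum_w A w q)%E by exact: emeasurable_sum.
have mSB : measurable_fun setT (fun q => \sum_w B w q)%E by exact: emeasurable_sum.
have SA0 q : (0 <= \sum_w A w q)%E by exact: sume_ge0.
have SB0 q : (0 <= \sum_w B w q)%E by exact: sume_ge0.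
have mH : measurable_fun setT H by apply: emeasurable_funD => //; exact: emeasurable_funD.
have toI w : is_index z m' w -> exists w' : I, w' = w :> seq bool.
  by move=> /and3P[_ _ wm]; exists (Bseq wm).
have fH q : (`|f q - c|%:E <= H q)%E.
  have [cq|ncq] := pselect (in_cube q); last first.
    have /existsNP[w /not_implyP[iw nw]] := ncq; have [w' w'E] := toI w iw.
    rewrite /H [X in (_ + (_ + X))%E](bigD1 w')//= [X in (_ + (_ + (X + _)))%E](_ : _ = +oo%E);
        last first.
      by rewrite /B w'E iw /out; move/negP/negbTE: nw => ->.
    have S' : (0 <= \sum_(i < #|I| | false) (0 : \bar R))%E by rewrite big_pred0.
    rewrite addye; last by rewrite gt_eqF// (lt_le_trans (ltNyr 0))// sume_ge0.
    rewrite addey; last by rewrite gt_eqF// (lt_le_trans (ltNyr 0)).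
    by rewrite addey// leey.
  have [hc|nc] := pselect (forall w, observable w -> `|lookup q w - qdot w| < dl).
    have := hd q (conj cq hc); rewrite /= distrC => h.
    by apply: (@le_trans _ _ (e / 8)%:E); [rewrite lee_fin ltW|rewrite leeDl// adde_ge0].
  have /existsNP[w /not_implyP[ow /negP]] := nc; rewrite -leNgt => hw.
  have /andP[iw _] := ow; have [w' w'E] := toI w iw.
  apply: (@le_trans _ _ (A w' q)); last first.
    apply: (@le_trans _ _ (\sum_w A w q)%E); first by rewrite (bigD1 w')//= leeDl// sume_ge0.
    apply: (@le_trans _ _ (\sum_w A w q + \sum_w B w q)%E); first by rewrite leeDl.
    by rewrite /H leeDr// lee_fin ltW.
  rewrite /A w'E ow -EFinM lee_fin; apply: le_trans (fM q cq) _.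
  rewrite /K mulrAC ler_pdivlMr ?exprn_gt0// ler_wpM2l//.
  by rewrite -[leRHS]real_normK ?num_real// lerXn2r// nnegrE ?(ltW d0).
have HE : (\int[P]_q H q <= (e / 4)%:E)%E.
  rewrite ge0_integralD//; last 2 first.
  - by move=> q _; rewrite adde_ge0.
  - exact: emeasurable_funD.
  rewrite ge0_integralD// integral_probability_cst.
  have -> : (\int[P]_q (\sum_w B w q) = 0)%E.
    rewrite ge0_integral_sum// big1// => w _; rewrite /B; have [iw|_] := boolP (is_index z m' w);
        last first.
      exact: integral0.
    exact: hout.
  rewrite adde0 [leRHS](_ : _ = (e / 8)%:E + (e / 8)%:E)%E; last by rewrite -EFinD; congr EFin;
      field.
  apply: leeD => //; rewrite ge0_integral_sum//.
  apply: (@le_trans _ _ (\sum_(w : I) (K * eta)%:E)%E).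
    apply: lee_sum => w _; rewrite /A; have [ow|_] := boolP (observable w); last first.
      by rewrite integral0 lee_fin mulr_ge0// ltW.
    rewrite ge0_integralZl//; last 2 first.
    - exact: (measurable_phi_lookup _ (@measurable_sqdist w)).
    - by move=> q _; exact: sqdist_ge0.
    rewrite [leRHS](EFinM K eta); apply: lee_wpmul2l; rewrite ?lee_fin//.
    exact: hobs.
  have etaE : eta * (K * #|I|%:R + 1) = e / 8 by rewrite /eta divfK ?gt_eqF.
  rewrite sumEFin lee_fin sumr_const -etaE -[leLHS]mulr_natr mulrDr mulr1.
  have -> : K * eta * #|I|%:R = eta * (K * #|I|%:R) by ring.
  by rewrite lerDl ltW.
  by move=> q _; rewrite lee_fin ltW.
have := @integral_near R _ _ P f c (e / 4) H mH fH HE.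
by move=> h; apply: le_lt_trans h _; lra.
Qed.

Lemma posterior_near (f : branching R z m' -> R) (c M e : R) :
  f q @[q --> observable_nbhs] --> c -> (forall q, in_cube q -> `|f q - c| <= M) -> 0 < e ->
  exists N, forall n, (N <= n)%N -> forall m, le_height m' m ->
    `|fine (\int[marg_posterior_h G alpha u s m z m' (sublist G z (D n))]_q (f q)%:E)%E - c| < e.
Proof.
move=> fc fM e0; have [eta eta0 h] := integral_close_to fc fM e0.
have /choice[Nf hN] : forall w : {bseq m' of bool}, exists N, observable w ->
    forall n, (N <= n)%N -> forall m, le_height m' m ->
   (\int[tree_post (m' - size z) m' z (stop_prob_h m (D n)) (beta_param (D n))]_q
      sqdist w (lookup q w) <= eta%:E)%E.
  move=> w; have [ow|] := boolP (observable w); last by exists 0%N.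
  by have [N hw] := tree_post_sqdist_observable ow eta0; exists N.
exists (\max_w Nf w)%N => n hn m hm.
rewrite (@eq_set_integral _ _ _ _ (tree_post (m' - size z) m' z (stop_prob_h m (D n)) (beta_param
    (D n)))); last first.
  by move=> A mA; exact: marg_posterior_hE.
apply: h => w.
  move=> ow; have /andP[/and3P[_ _ wm] _] := ow.
  by apply: (hN (Bseq wm)) => //; apply: leq_trans hn; exact: (leq_bigmax (Bseq wm)).
move=> iw; apply: tree_post_support => //.
- by move=> v; exact: stop_prob_h01.
- by move=> v; exact: beta_param_gt0.
- by move=> v v01; rewrite /out v01.
- by rewrite subnK.
Qed.

Let limit_tree : branching R z m' := fun v => qdot (val v).

Let lookup_limit w : is_index z m' w -> lookup limit_tree w = qdot w.
Proof. by move=> iw; rewrite /lookup insubT. Qed.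

Let qdot_index01 w : is_index z m' w -> 0 <= qdot w <= 1.
Proof.
move=> /and3P[_ zw _]; case/lastP: w zw => [|w b] zw; first by rewrite ltn0 in zw.
exact: qdot01.
Qed.

(** As [f] need not be measurable, the integral is not evaluated at the point directly: the point
    mass satisfies the moment conditions for every tolerance. *)
Lemma integral_dirac_near (f : branching R z m' -> R) (c M : R) :
  f q @[q --> observable_nbhs] --> c -> (forall q, in_cube q -> `|f q - c| <= M) ->
  fine (\int[\d_limit_tree]_q (f q)%:E)%E = c.
Proof.
move=> fc fM; apply/eqP; rewrite -subr_eq0 -normr_eq0 eq_le normr_ge0 andbT.
apply/ler_addgt0Pr => e e0; rewrite add0r ltW//.
have [eta eta0 h] := integral_close_to fc fM e0.
apply: h => w.
  move=> /andP[iw _].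
  rewrite integral_dirac//; last exact: (measurable_phi_lookup _ (@measurable_sqdist w)).
  by rewrite diracT mul1e lookup_limit// /sqdist subrr expr0n lee_fin ltW.
move=> iw; rewrite integral_dirac//; last exact: (measurable_phi_lookup _ mout).
by rewrite diracT mul1e lookup_limit// /out qdot_index01.
Qed.

Lemma lookup_cvg w : observable w -> lookup q w @[q --> observable_nbhs] --> qdot w.
Proof.
move=> ow; apply/cvgrPdist_lt => e e0; exists e => // q [_ /(_ _ ow)].
by rewrite /= distrC.
Qed.

Lemma limit_tree_cvg (f : {ptws tree_index z m' -> R} -> R) :
  (forall w, is_index z m' w -> observable w) -> continuous f ->
  f q @[q --> observable_nbhs] --> f limit_tree.
Proof.
move=> hobs cf; apply: (@cvg_comp _ _ _ id f _ _ _ _ (cf limit_tree)).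
apply: ptws_cvg => v; rewrite [X in X @ _](_ : _ = (fun q : branching R z m' => lookup q (val v))).
  by apply: lookup_cvg; apply: hobs; exact: (valP v).
by apply/funext => q; rewrite lookupE.
Qed.

Lemma posterior_weak_cvg (f : {ptws tree_index z m' -> R} -> R) (e : R) :
  (forall w, is_index z m' w -> observable w) -> continuous f ->
  (exists M, forall q, `|f q| <= M) -> 0 < e ->
  exists N, forall n, (N <= n)%N -> forall m, le_height m' m ->
    `|fine (\int[marg_posterior_h G alpha u s m z m' (sublist G z (D n))]_q (f q)%:E)%E
      - fine (\int[\d_limit_tree]_q (f q)%:E)%E| < e.
Proof.
move=> hobs cf [M hM] e0; have fc := limit_tree_cvg hobs cf.
have fM q : in_cube q -> `|f q - f limit_tree| <= M + M.
  by move=> _; apply: le_trans (ler_normB _ _) _; exact: lerD.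
by rewrite (integral_dirac_near fc fM); exact: posterior_near fc fM e0.
Qed.

End posterior_near.

(** * Products of cell masses *)

Section cells.

Lemma cond_prob_nil (q : seq bool -> R) z : cond_prob q z (z ++ [::]) = 1.
Proof. by rewrite /cond_prob cats0 prefix_refl big_geq. Qed.

Lemma cond_prob_rcons (q : seq bool -> R) z t b :
  cond_prob q z (z ++ rcons t b) = cond_prob q z (z ++ t) * q (z ++ rcons t b).
Proof.
rewrite /cond_prob !prefix_prefix !size_cat size_rcons addnS big_nat_recr ?leq_addr//=.
congr (_ * _); last by rewrite take_oversize// size_cat size_rcons addnS.
rewrite big_nat [RHS]big_nat; apply: eq_bigr => i /andP[_ it]; congr q.
by rewrite -rcons_cat -cats1 takel_cat// size_cat.
Qed.

Lemma cond_prob_mass z t : cond_prob qdot z (z ++ t) * p z = p (z ++ t).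
Proof.
elim/last_ind: t => [|t b ih]; first by rewrite cond_prob_nil cats0 mul1r.
by rewrite cond_prob_rcons mulrAC ih -rcons_cat pq mulrC.
Qed.

Variables (z : seq bool) (m' : nat).
Hypothesis zm' : (size z <= m')%N.
Hypothesis pz : 0 < p z.

Lemma index_cat t b : (size (z ++ rcons t b) <= m')%N -> is_index z m' (z ++ rcons t b).
Proof.
by move=> tm; rewrite /is_index prefix_prefix tm andbT/= size_cat size_rcons addnS ltnS leq_addr.
Qed.

Lemma cond_prob_in_cube (q : branching R z m') y : in_cube q -> (size y <= m')%N ->
  0 <= cond_prob (lookup q) z y <= 1.
Proof.
move=> cq ym; have [/prefixP[t yt]|npy] := boolP (prefix z y); last first.
  by rewrite /cond_prob (negbTE npy) ler0n; case: (prefix y z) => /=; rewrite ?ler01 ?lexx.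
subst y; elim/last_ind: t ym => [|t b ih] ym; first by rewrite cond_prob_nil ler01 lexx.
rewrite cond_prob_rcons; have /andP[a0 a1] := cq _ (index_cat ym).
have /andP[b0 b1] : 0 <= cond_prob (lookup q) z (z ++ t) <= 1.
  by apply: ih; apply: leq_trans ym; rewrite !size_cat size_rcons addnS.
by rewrite mulr_ge0// mulr_ile1.
Qed.

Lemma cond_prob_cvg y : (size y <= m')%N ->
  cond_prob (lookup q) z y @[q --> @observable_nbhs z m'] --> cond_prob qdot z y.
Proof.
move=> ym; have [/prefixP[t yt]|npy] := boolP (prefix z y); last first.
  by rewrite /cond_prob (negbTE npy); exact: cvg_cst.
subst y; elim/last_ind: t ym => [|t b ih] ym.
  under eq_fun do rewrite cond_prob_nil.
  by rewrite cond_prob_nil; exact: cvg_cst.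
have tm : (size (z ++ t) <= m')%N by apply: leq_trans ym; rewrite !size_cat size_rcons addnS.
have {}ih := ih tm.
under eq_fun do rewrite cond_prob_rcons.
rewrite cond_prob_rcons.
have [pt|pt] := ltP 0 (p (z ++ t)).
  apply: cvgM => //; apply: lookup_cvg; rewrite /observable index_cat//=.
  by rewrite -rcons_cat size_rcons/= -cats1 take_cat ltnn subnn take0 cats0.
(* The mass of the null cell is this conditional probability times [p z], and [p z > 0]. The
   remaining factor [q_w] is unobservable but bounded by 1 in the cube. *)
have c0 : cond_prob qdot z (z ++ t) = 0.
  have h : cond_prob qdot z (z ++ t) * p z <= 0 by rewrite cond_prob_mass.
  apply/eqP; rewrite eq_le -(pmulr_lle0 _ pz) h/=.
  by rewrite /cond_prob prefix_prefix; apply: prodr_ge0.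
rewrite c0 mul0r; rewrite c0 in ih.
apply/cvgrPdist_lt => e e0; have /cvgrPdist_lt/(_ e e0)[dl /= dl0 hd] := ih.
exists dl => // q cq; have := hd q cq; rewrite /= !sub0r !normrN; apply: le_lt_trans.
case: cq => cq _; rewrite normrM ler_piMr//.
have /andP[a0 a1] := cq _ (index_cat ym); by rewrite ger0_norm.
Qed.

Lemma cells_in_cube (q : branching R z m') ys : in_cube q -> (forall y, y \in ys -> (size y <=
    m')%N) ->
  0 <= \prod_(y <- ys) cell (lookup q) z y <= 1.
Proof.
move=> cq hys; rewrite big_seq; apply: (big_ind (fun x : R => 0 <= x <= 1)).
- by rewrite ler01 lexx.
- by move=> x y /andP[x0 x1] /andP[y0 y1]; rewrite mulr_ge0// mulr_ile1.
- move=> y /hys /(cond_prob_in_cube cq) /andP[c0 c1]; rewrite /cell.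
  have h : 0 <= (2^-1 : R) ^+ size z <= 1 by rewrite exprn_ge0//= exprn_ile1//; lra.
  by case/andP: h => h0 h1; rewrite mulr_ge0// mulr_ile1.
Qed.

Lemma cells_cvg ys : (forall y, y \in ys -> (size y <= m')%N) ->
  \prod_(y <- ys) cell (lookup q) z y @[q --> @observable_nbhs z m'] --> \prod_(y <- ys) cell qdot
      z y.
Proof.
elim: ys => [|y ys ih] hys.
  by rewrite big_nil; under eq_fun do rewrite big_nil; exact: cvg_cst.
rewrite big_cons; under eq_fun do rewrite big_cons.
apply: cvgM; last by apply: ih => v vys; apply: hys; rewrite in_cons vys orbT.
by apply: cvgM; [exact: cvg_cst|apply: cond_prob_cvg; apply: hys; rewrite mem_head].
Qed.

Lemma cells_posterior_cvg ys (e : R) :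
  0 < s \/ (forall w, is_index z m' w -> qdot w = 2^-1) ->
  (forall y, y \in ys -> (size y <= m')%N) -> 0 < e ->
  exists N, forall n, (N <= n)%N -> forall m, le_height m' m ->
    `|cells_posterior G alpha u s m z m' ys (sublist G z (D n)) - \prod_(y <- ys) cell qdot z y| <
        e.
Proof.
move=> hs hys e0; apply: (posterior_near zm' hs (cells_cvg hys) _ e0 (M := 1 + `|\prod_(y <- ys)
    cell qdot z y|)).
move=> q cq; apply: le_trans (ler_normB _ _) _; rewrite lerD2r.
by have /andP[c0 c1] := cells_in_cube cq hys; rewrite ger0_norm.
Qed.

End cells.

End sample.

(** * Almost sure statements for sampled data *)

Variables (Q : probability T R) (qdot : seq bool -> R).
Hypothesis hQ : branching_of G Q qdot.
Context d' (Omega : measurableType d') (P : probability Omega R) (X : nat -> {RV P >-> T}).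
Hypothesis hX : iid Q X.

Definition mass (w : seq bool) : R := fine (Q (G w)).

Lemma mass_rcons w b : mass (rcons w b) = qdot (rcons w b) * mass w.
Proof.
have [_ _ h] := hQ; rewrite /mass h fineM//.
by apply: fin_num_measure; exact: (measurable_cell hG).
Qed.

Lemma mass_gt0 w : (0 < mass w) = (0 < Q (G w))%E.
Proof.
have fQ : Q (G w) \is a fin_num by apply: fin_num_measure; exact: (measurable_cell hG).
by rewrite -[in RHS](fineK fQ) lte_fin.
Qed.

Lemma ae_sample_freq : {ae P, forall omega, sample_freq mass (fun n => data X n omega)}.
Proof.
have H w : {ae P, forall omega, forall e : R, 0 < e -> exists N, forall n, (N <= n)%N ->
    `|(cnt G w (data X n omega))%:R - mass w * n%:R| <= e * n%:R}.
  have := ae_frequency hX (measurable_cell hG w); apply: filterS => omega h e /h[N hN].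
  by exists N => n /hN; rewrite /cnt /sublist size_filter.
have := ae_forall_countable H; apply: filterS => omega h; split=> // n.
by rewrite /data size_map size_iota.
Qed.

(** If the cell of [z] is null, [n_z] almost surely never reaches 1, and statements about large
    [n_z] hold vacuously. *)
Lemma ae_null_cell w : Q (G w) = 0%E -> {ae P, forall omega, forall n, cnt G w (data X n omega) =
    0%N}.
Proof.
move=> Q0; have mG := measurable_cell hG w.
have H i : {ae P, forall omega, ~ G w (X i omega)}.
  exists (X i @^-1` G w); split.
  - by rewrite -[X in measurable X]setTI; exact: (measurable_funP (X i)).
  - by have [h _] := hX; have := h i (G w) mG; rewrite Q0.
  - by move=> omega /= /contrapT.
have := ae_forall_countable H; apply: filterS => omega h n.
apply/eqP; rewrite /cnt /sublist size_filter eqn0Ngt -has_count -all_predC.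
by apply/allP => x /mapP[i _ ->] /=; rewrite notin_setE.
Qed.

Variables (z : seq bool) (m' : nat).
Hypothesis hz : (size z <= m')%N.

Let q0 w : 0 <= qdot w. Proof. by have [h _ _] := hQ; exact: h. Qed.
Let q1 w : qdot (rcons w false) + qdot (rcons w true) = 1.
Proof. by have [_ h _] := hQ; exact: h. Qed.
Let pq := mass_rcons.

Lemma uniform_index : 0 < s \/ ~ nonuniform qdot (Some m') z ->
  0 < s \/ forall w, is_index z m' w -> qdot w = 2^-1.
Proof.
move=> [|nu]; [by left|right] => w /index_catP[t [b [-> tm _]]].
apply/eqP; rewrite -rcons_cat (qdot_half q1).
by apply: contrapT => /negP h; apply: nu; exists t.
Qed.

Lemma is_probability_marg_prior_h m : le_height m' m ->
  is_probability (marg_prior_h alpha u s m z m').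
Proof.
move=> hm; exists (tree_post (m' - size z) m' z (stop_prob m' [::]) (beta_param [::])) => A mA.
by rewrite marg_prior_hE// marg_priorE// hz leqnn.
Qed.

Lemma is_probability_marg_posterior_h m D : le_height m' m ->
  is_probability (marg_posterior_h G alpha u s m z m' (sublist G z D)).
Proof.
move=> hm; exists (tree_post (m' - size z) m' z (stop_prob_h m D) (beta_param D)) => A mA.
by rewrite marg_posterior_hE.
Qed.

Lemma nonuniform_None m : nonuniform qdot m z -> nonuniform qdot None z.
Proof. by move=> [y [_ h]]; exists y. Qed.

(* Above the first node that is not fair, cells are halved, so its mass is positive. *)
Lemma first_nonuniform : nonuniform qdot None z -> (0 < Q (G z))%E -> exists y,
  [/\ 0 < mass (z ++ y), qdot (rcons (z ++ y) false) != 2^-1 &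
      forall m, nonuniform qdot m z -> lt_height (size (z ++ y)) m].
Proof.
move=> [y0 [_ hy0]]; rewrite -mass_gt0 => pz.
pose A k := `[< exists y, size y = k /\ qdot (rcons (z ++ y) false) != 2^-1 >].
have exA : exists k, A k by exists (size y0); apply/asboolP; exists y0.
case: (ex_minnP exA) => k /asboolP[y [yk hy]] kmin; exists y; split=> //; last first.
  move=> [m|//] [y' [/= ym hy']]; apply: leq_ltn_trans ym.
  by rewrite !size_cat leq_add2l yk; apply: kmin; apply/asboolP; exists y'.
have : (size y <= k)%N by rewrite yk.
elim/last_ind: y {yk hy} => [|y b ih]; first by rewrite cats0.
rewrite size_rcons => yk; rewrite -rcons_cat pq mulr_gt0 ?ih ?(ltnW yk)//.
have /eqP -> : qdot (rcons (z ++ y) b) == 2^-1; last by rewrite invr_gt0.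
rewrite (qdot_half q1); apply: contrapT => /negP h.
have : (k <= size y)%N by apply: kmin; apply/asboolP; exists y.
by rewrite leqNgt yk.
Qed.

Lemma cnt_data_le D n : sample_freq mass D -> (cnt G z (D n) <= n)%N.
Proof. by move=> [h _]; apply: leq_trans (h n); rewrite /cnt size_filter count_size. Qed.

(** The first unfair node belongs to every tree that is nonuniform, so its rate serves all heights
    at once. Since [n_z <= n], a threshold for [n] is also one for [n_z], and growth in [n] implies
    growth in [n_z]. *)
Lemma evidence_h_growth : 0 < u * s -> exists2 c : R, 0 < c &
  {ae P, forall omega, exists N0, forall n, (N0 <= cnt G z (data X n omega))%N ->
     forall m, le_height m' m -> nonuniform qdot m z ->
       ((expR (c * (cnt G z (data X n omega))%:R))%:E
          <= evidence_h G alpha u s m z (sublist G z (data X n omega)))%E}.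
Proof.
move=> us0.
have [nu|nu] := pselect (nonuniform qdot None z); last first.
  by exists 1 => //; apply: nearW => omega; exists 0%N => n _ m _ /nonuniform_None.
have [Qz|Qz] := ltP 0%E (Q (G z)); last first.
  have Q0 : Q (G z) = 0%E by apply/eqP; rewrite eq_le Qz measure_ge0.
  exists 1 => //; have := ae_null_cell Q0; apply: filterS => omega h.
  by exists 1%N => n; rewrite h.
have [y [py qy hy]] := first_nonuniform nu Qz.
have [c c0 hc] := ev_growth q0 q1 pq us0 py qy.
exists c => //; have := ae_sample_freq; apply: filterS => omega hD.
have [N hN] := hc _ hD; exists N => n Nn m hm num.
have nn := cnt_data_le n hD.
have bound k : (size y < k)%N ->
    ((expR (c * (cnt G z (data X n omega))%:R))%:E <= (ev k z (data X n omega))%:E)%E.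
  move=> yk; rewrite lee_fin; apply: le_trans (hN n (leq_trans Nn nn) k yk).
  by rewrite ler_expR ler_wpM2l ?(ltW c0)// ler_nat.
case: m hm num => [m|] /= hm num.
  rewrite evidenceE//; last exact: leq_trans hz hm.
  by apply: bound; have := hy _ num; rewrite /= size_cat ltn_subRL.
apply: lime_ge; first exact: cvg_evidence.
exists (size z + (size y).+1)%N => // k /= hk.
rewrite evidenceE//; last by apply: leq_trans hk; exact: leq_addr.
by apply: bound; rewrite ltn_subRL -addnS.
Qed.

Lemma posterior_h_weak_cvg : 0 < s \/ ~ nonuniform qdot (Some m') z ->
  (forall y, (size (z ++ y) < m')%N -> (0 < Q (G (z ++ y)))%E) ->
  {ae P, forall omega, unif_weak_cvg (fun n => cnt G z (data X n omega)) m'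
     (fun n m => marg_posterior_h G alpha u s m z m' (sublist G z (data X n omega)))
     (\d_((fun v => qdot (val v)) : branching R z m'))}.
Proof.
move=> /uniform_index hs' hp; have := ae_sample_freq; apply: filterS => omega hD f cf bf e e0.
have obs w : is_index z m' w -> observable (mass) z m' w.
  move=> iw; rewrite /observable iw; have [t [b [_ tm ->]]] := index_catP iw.
  by rewrite mass_gt0 hp.
have [N hN] := posterior_weak_cvg q0 q1 pq hD hz hs' obs cf bf e0.
by exists N => n Nn m hm; apply: hN => //; apply: leq_trans Nn (cnt_data_le n hD).
Qed.

Lemma cells_posterior_h_cvg : 0 < s \/ ~ nonuniform qdot (Some m') z ->
  {ae P, forall omega, forall ys : seq (seq bool),
     (forall y, y \in ys -> (size y <= m')%N) ->
     unif_cvg (fun n => cnt G z (data X n omega)) m'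
       (fun n m => cells_posterior G alpha u s m z m' ys (sublist G z (data X n omega)))
       (\prod_(y <- ys) cell qdot z y)}.
Proof.
move=> /uniform_index hs'; have [Qz|Qz] := ltP 0%E (Q (G z)); last first.
  have Q0 : Q (G z) = 0%E by apply/eqP; rewrite eq_le Qz measure_ge0.
  have := ae_null_cell Q0; apply: filterS => omega h ys _ e e0.
  by exists 1%N => n; rewrite h.
have := ae_sample_freq; apply: filterS => omega hD ys hys e e0.
have pz : 0 < mass z by rewrite mass_gt0.
have [N hN] := cells_posterior_cvg q0 q1 pq hD hz pz hs' hys e0.
by exists N => n Nn m hm; apply: hN => //; apply: leq_trans Nn (cnt_data_le n hD).
Qed.

End bayes_tree.

Unset Implicit Arguments.
Set Strict Implicit.
Set Printing Implicit Defensive.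

Theorem theorem6 (R : realType) (d : measure_display) (T : measurableType d)
  (vol : probability T R) (G : seq bool -> set T)
  (hG : tree_partition vol G)
  (alpha u s : R) (halpha : 0 < alpha)
  (hu : 0 <= u <= 1) (hs : 0 <= s <= 1) (hus : u + s = 1)
  (Q : probability T R) (qdot : seq bool -> R) (hQ : branching_of G Q qdot)
  (d' : measure_display) (Omega : measurableType d') (P : probability Omega R)
  (X : nat -> {RV P >-> T}) (hX : iid Q X)
  (z : seq bool) (m' : nat) (hz : (size z <= m')%N) :
  let Dz n omega := sublist G z (data X n omega) in
  let nz omega n := size (Dz n omega) in
  (* existence *)
  [/\ forall D : seq T,
        cvg (evidence G alpha u s m z (sublist G z D) @[m --> \oo]),
      forall A, measurable A ->
        cvg (marg_prior alpha u s m z m' A @[m --> \oo]),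
      forall (D : seq T) A, measurable A ->
        cvg (marg_posterior G alpha u s m z m' (sublist G z D) A @[m --> \oo]) &
      forall m, le_height m' m ->
        is_probability (marg_prior_h alpha u s m z m') /\
        forall D : seq T,
          is_probability (marg_posterior_h G alpha u s m z m' (sublist G z D))]
  /\
  (* (i) *)
  (forall m1 m2, le_height m' m1 -> le_height m' m2 -> forall A, measurable A ->
     marg_prior_h alpha u s m1 z m' A = marg_prior_h alpha u s m2 z m' A)
  /\
  (* (ii) *)
  (0 < u * s -> exists2 c : R, 0 < c &
     {ae P, forall omega, exists N0, forall n, (N0 <= nz omega n)%N ->
        forall m, le_height m' m -> nonuniform qdot m z ->
          ((expR (c * (nz omega n)%:R))%:E
             <= evidence_h G alpha u s m z (Dz n omega))%E})
  /\
  (* (iii) *)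
  (0 < s \/ ~ nonuniform qdot (Some m') z ->
   (forall y, (size (z ++ y) < m')%N -> (0 < Q (G (z ++ y)))%E) ->
     {ae P, forall omega,
        unif_weak_cvg (nz omega) m'
          (fun n m => marg_posterior_h G alpha u s m z m' (Dz n omega))
          (\d_((fun w => qdot (val w)) : branching R z m'))})
  /\
  (* (iv) *)
  (0 < s \/ ~ nonuniform qdot (Some m') z ->
     {ae P, forall omega, forall ys : seq (seq bool),
        (forall y, y \in ys -> (size y <= m')%N) ->
        unif_cvg (nz omega) m'
          (fun n m => cells_posterior G alpha u s m z m' ys (Dz n omega))
          (\prod_(y <- ys) cell qdot z y)}).
Proof.
move=> Dz nz; split; [split|split; [|split; [|split]]].
- by move=> D; exact: (cvg_evidence hG).
- move=> A mA; apply/cvg_ex; exists (marg_prior alpha u s m' z m' A).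
  exact: (cvg_marg_prior hG).
- move=> D A mA; apply/cvg_ex.
  exists (tree_post (m' - size z) m' z (stop_prob_h G alpha u s None D) (beta_param G alpha D) A).
  exact: (cvg_marg_posterior hG).
- move=> m hm; split; first exact: (is_probability_marg_prior_h hG).
  by move=> D; exact: (is_probability_marg_posterior_h hG).
- by move=> m1 m2 h1 h2 A mA; rewrite !(marg_prior_hE hG).
- exact: (evidence_h_growth hG halpha hu hs hus hQ hX hz).
- exact: (posterior_h_weak_cvg hG halpha hu hs hus hQ hX hz).
- exact: (cells_posterior_h_cvg hG halpha hu hs hus hQ hX hz).
Qed.
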